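(* Let $M_{\langle 3\rangle}=M_{\langle 3,3,3\rangle}\in \mathbb{C}^{9}\otimes\mathbb{C}^{9}\otimes\mathbb{C}^{9}$ be the $3\times 3$ matrix multiplication tensor. Then its border rank satisfies $\underline{\mathbf{R}}(M_{\langle 3\rangle})\geq 17$.
   Context: All vector spaces are over $\mathbb{C}$. A tensor $T\in A\otimes B\otimes C$ has rank one if $T=a\otimes b\otimes c$ for nonzero $a\in A$, $b\in B$, $c\in C$. The border rank $\underline{\mathbf{R}}(T)$ is the smallest $r$ such that $T$ is a limit of sums of $r$ rank one tensors (equivalently $[T]$ lies in the $r$-th secant variety of the Segre variety of rank one tensors). The matrix multiplication tensor $M_{\langle u,v,w\rangle}\in \mathbb{C}^{uv}\otimes\mathbb{C}^{vw}\otimes\mathbb{C}^{wu}$ is $\sum_{i=1}^{u}\sum_{j=1}^{v}\sum_{k=1}^{w} x^i_j\otimes y^j_k\otimes z^k_i$, where $\{x^i_j\}$, $\{y^j_k\}$, $\{z^k_i\}$ are bases of the three factors; equivalently, it is the reordering of $\mathrm{Id}_U\otimes \mathrm{Id}_V\otimes\mathrm{Id}_W$ in $(U^*\otimes V)\otimes(V^*\otimes W)\otimes(W^*\otimes U)$ with $\dim U=u$, $\dim V=v$, $\dim W=w$. One writes $M_{\langle n\rangle}=M_{\langle n,n,n\rangle}$. *)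

(* Defs.v *)
From mathcomp Require Import all_boot all_order all_algebra.
From mathcomp Require Import boolp classical_sets reals topology normedtype sequences.
From mathcomp Require Import complex.

Set Implicit Arguments.
Unset Strict Implicit.
Unset Printing Implicit Defensive.

Import Order.TTheory GRing.Theory Num.Theory.
Import numFieldNormedType.Exports.

Local Open Scope ring_scope.
Local Open Scope classical_set_scope.

(* K^I (x) K^J (x) K^L in coordinates, with respect to the standard bases
   indexed by the finite types I, J and L. *)
Notation tensor K I J L := {ffun (I * J * L)%type -> K} (only parsing).

Definition tprod (K : numFieldType) (I J L : finType)
    (a : {ffun I -> K}) (b : {ffun J -> K}) (c : {ffun L -> K}) :
    tensor K I J L :=
  [ffun p => a p.1.1 * b p.1.2 * c p.2].

Definition std_basis (K : numFieldType) (I : finType) (i : I) : {ffun I -> K} :=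
  [ffun i' => (i' == i)%:R].

Definition rank_one (K : numFieldType) (I J L : finType)
    (T : tensor K I J L) : Prop :=
  exists (a : {ffun I -> K}) (b : {ffun J -> K}) (c : {ffun L -> K}),
    [/\ a != 0, b != 0, c != 0 & T = tprod a b c].

Definition sum_of_rank_one (K : numFieldType) (I J L : finType) (r : nat)
    (T : tensor K I J L) : Prop :=
  exists t : 'I_r -> tensor K I J L,
    (forall s, rank_one (t s)) /\ T = \sum_(s < r) t s.

(* Convergence in the finite-dimensional space of tensors is convergence of
   every coordinate; [K^o] only serves to select the topology of the field. *)
Definition tensor_cvg (K : numFieldType) (I J L : finType)
    (S : nat -> tensor K I J L) (T : tensor K I J L) : Prop :=
  forall p : I * J * L, (fun n => S n p : K^o) @ \oo --> (T p : K^o).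

Definition limit_of_rank (K : numFieldType) (I J L : finType)
    (T : tensor K I J L) (r : nat) : Prop :=
  exists S : nat -> tensor K I J L,
    (forall n, sum_of_rank_one r (S n)) /\ tensor_cvg S T.

Lemma std_basis_neq0 (K : numFieldType) (I : finType) (i : I) :
  std_basis K i != 0.
Proof.
apply/eqP => /ffunP/(_ i); rewrite !ffunE eqxx => /eqP.
by rewrite oner_eq0.
Qed.

Lemma sum_of_rank_one_support (K : numFieldType) (I J L : finType)
    (T : tensor K I J L) :
  sum_of_rank_one #|[pred p | T p != 0]| T.
Proof.
pose A := [pred p | T p != 0].
pose F (p : I * J * L) : tensor K I J L :=
  tprod [ffun i => T p * std_basis K p.1.1 i] (std_basis K p.1.2)
        (std_basis K p.2).
exists (fun s => F (enum_val s)); split=> [s|].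
  have := enum_valP s; set p := enum_val s; rewrite inE => Tp.
  exists [ffun i => T p * std_basis K p.1.1 i], (std_basis K p.1.2),
    (std_basis K p.2).
  split=> //; try exact: std_basis_neq0.
  apply/eqP => /ffunP/(_ p.1.1); rewrite !ffunE eqxx mulr1 => /eqP.
  by rewrite (negbTE Tp).
rewrite -(big_enum_val (idx := 0) (op := +%R) (A := A) F).
apply/ffunP => q; rewrite sum_ffunE.
have FE p : F p q = T p * (q == p)%:R.
  case: p q => [[i j] l] [[i' j'] l'].
  by rewrite !ffunE /= -!mulrA -!natrM !mulnb !xpair_eqE andbA.
under eq_bigr do rewrite FE.
case: (boolP (q \in A)) => qA.
  rewrite (bigD1 q) //= eqxx mulr1 big1 ?addr0 // => p /andP[_ pq].
  by rewrite eq_sym (negbTE pq) mulr0.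
rewrite big1 => [|p pA]; first by move: qA; rewrite inE negbK => /eqP.
by case: eqVneq pA qA => [->->|]; rewrite ?mulr0.
Qed.

Lemma limit_of_rank_exists (K : numFieldType) (I J L : finType)
    (T : tensor K I J L) :
  exists r : nat, `[< limit_of_rank T r >].
Proof.
exists #|[pred p | T p != 0]|; apply/asboolP; exists (fun=> T).
by split=> [_|p]; [exact: sum_of_rank_one_support | exact: cvg_cst].
Qed.

Definition border_rank (K : numFieldType) (I J L : finType)
    (T : tensor K I J L) : nat :=
  ex_minn (limit_of_rank_exists T).

Definition matmul_tensor (K : numFieldType) (u v w : nat) :
    tensor K ('I_u * 'I_v)%type ('I_v * 'I_w)%type ('I_w * 'I_u)%type :=
  \sum_(i < u) \sum_(j < v) \sum_(k < w)
    tprod (std_basis K (i, j)) (std_basis K (j, k)) (std_basis K (k, i)).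

(* Main.v *)
From Stdlib Require Import ZArith NArith.
Require Import Defs.
From mathcomp Require Import all_boot all_order all_algebra.
From mathcomp Require Import boolp classical_sets reals topology normedtype sequences.
From mathcomp Require Import complex mxtens ssrZ zify ring.

Set Implicit Arguments.
Unset Strict Implicit.
Unset Printing Implicit Defensive.

Import Order.TTheory GRing.Theory Num.Theory.
Import numFieldNormedType.Exports.

Local Open Scope ring_scope.
Local Open Scope classical_set_scope.

(** The proof is by border apolarity, in a form in which only subspaces of the
    products of two factors occur.

    Let T be a limit of tensors T_t, each a sum of r = 16 terms
    a_k (x) b_k (x) c_k, and let n = 9.  After a small perturbation the products
    a_k (x) b_k are independent, and likewise for the other two pairs of
    factors, so that they span spaces E_0(t), E_1(t), E_2(t) of dimension r.
    Each contains the slices of T_t.  Moreover the r independent triples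
    a_k (x) b_k (x) a_k of E_0(t) (x) A are symmetric in their outer factors,
    the triples a_k (x) b_k (x) b_k are symmetric in the last two, and the r
    triples a_k (x) b_k (x) c_k are common to E_0(t), E_1(t) and E_2(t), each
    multiplied by the missing factor.  These facts are upper bounds on ranks of
    matrices that depend linearly on the E_i(t); a limit of the E_i(t) along an
    ultrafilter inherits them and contains the slices of T ([border_apolarity]).
    A configuration (E_0, E_1, E_2) with these properties is called [apolar].

    The group of matrix multiplication, of changes of basis in the three
    underlying spaces, acts on the apolar configurations, and the conditions
    are closed, so a solvable subgroup has a fixed point.  For the
    one-parameter subgroups in use this is elementary: a polynomial curve of
    subspaces has a limit at infinity, and the limit of a flow is fixed by the
    flow ([flow_limit], [borel_fixed]).  Hence there is an apolar configuration
    that is stable under the triangular matrices of the three spaces.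

    A subspace E_i that is fixed in this way is combinatorial.  It is graded by
    the nine cells of outer indices; in a cell it consists of some elementary
    matrices and of a space of diagonal matrices that contains the identity,
    and the raising operators link the elementary matrices inside a cell and
    the cells to each other ([raising]).  A finite code records what matters,
    and an enumeration of all arrays of nine codes of total dimension 16, with
    an integer elimination for each, shows that the two symmetry conditions
    leave only subspaces of two explicit spaces of dimension 21
    ([bounded_support]).  Finally, for each of the eight choices of three of
    those spaces of dimension 21 the matrix of the triple intersection has rank
    at least 552, hence at least 552 - 3 * (21 - 16) * 9 = 417 on subspaces of
    dimension 16 ([bounded_cube]), while the apolarity condition requires at
    most 3 * 16 * 9 - 16 = 416. *)

(** * Entrywise limits of matrices *)

Section EntrywiseLimits.
Variables (K : numFieldType) (T : Type).
Implicit Type F : set_system T.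

Definition mxcvg F m n (M : T -> 'M[K]_(m, n)) (L : 'M[K]_(m, n)) :=
  forall i j, (fun t => M t i j : K^o) @ F --> (L i j : K^o).

Lemma cvg_bigsum F (FF : Filter F) (I : Type) (r : seq I) (P : pred I)
    (f : I -> T -> K) (l : I -> K) :
  (forall i, P i -> (f i : T -> K^o) @ F --> (l i : K^o)) ->
  (fun t => \sum_(i <- r | P i) f i t : K^o) @ F --> (\sum_(i <- r | P i) l i : K^o).
Proof.
move=> fl; elim: r => [|i r IH].
  rewrite big_nil; under eq_fun do rewrite big_nil; exact: cvg_cst.
rewrite big_cons; under eq_fun do rewrite big_cons.
by case: ifP => // Pi; apply: cvgD => //; apply: fl.
Qed.

Lemma cvg_bigprod F (FF : Filter F) (I : Type) (r : seq I) (P : pred I)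
    (f : I -> T -> K) (l : I -> K) :
  (forall i, P i -> (f i : T -> K^o) @ F --> (l i : K^o)) ->
  (fun t => \prod_(i <- r | P i) f i t : K^o) @ F --> (\prod_(i <- r | P i) l i : K^o).
Proof.
move=> fl; elim: r => [|i r IH].
  rewrite big_nil; under eq_fun do rewrite big_nil; exact: cvg_cst.
rewrite big_cons; under eq_fun do rewrite big_cons.
by case: ifP => // Pi; apply: cvgM => //; apply: fl.
Qed.

Lemma mxcvg_cst F (FF : Filter F) m n (L : 'M[K]_(m, n)) : mxcvg F (fun=> L) L.
Proof. by move=> i j; apply: cvg_cst. Qed.

Lemma mxcvg_mul F (FF : Filter F) m n p (M : T -> 'M[K]_(m, n)) L
    (N : T -> 'M[K]_(n, p)) L' :
  mxcvg F M L -> mxcvg F N L' -> mxcvg F (fun t => M t *m N t) (L *m L').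
Proof.
move=> ML NL i j; rewrite mxE; under eq_fun do rewrite mxE.
by apply: cvg_bigsum => k _; apply: cvgM; [apply: ML | apply: NL].
Qed.

Lemma mxcvg_tens F (FF : Filter F) m n p q (M : T -> 'M[K]_(m, n)) L
    (N : T -> 'M[K]_(p, q)) L' :
  mxcvg F M L -> mxcvg F N L' -> mxcvg F (fun t => M t *t N t) (L *t L').
Proof.
move=> ML NL i j; rewrite mxE; under eq_fun do rewrite mxE.
by apply: cvgM; [apply: ML | apply: NL].
Qed.

Lemma mxcvg_col F m1 m2 n (M : T -> 'M[K]_(m1, n)) L (N : T -> 'M[K]_(m2, n)) L' :
  mxcvg F M L -> mxcvg F N L' ->
  mxcvg F (fun t => col_mx (M t) (N t)) (col_mx L L').
Proof.
by move=> ML NL i j; rewrite -(splitK i); case: (split i) => k /=;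
  rewrite ?(col_mxEu, col_mxEd);
  under eq_fun do rewrite ?(col_mxEu, col_mxEd); [apply: ML | apply: NL].
Qed.

Lemma mxcvg_row F m n1 n2 (M : T -> 'M[K]_(m, n1)) L (N : T -> 'M[K]_(m, n2)) L' :
  mxcvg F M L -> mxcvg F N L' ->
  mxcvg F (fun t => row_mx (M t) (N t)) (row_mx L L').
Proof.
by move=> ML NL i j; rewrite -(splitK j); case: (split j) => k /=;
  rewrite ?(row_mxEl, row_mxEr);
  under eq_fun do rewrite ?(row_mxEl, row_mxEr); [apply: ML | apply: NL].
Qed.

Lemma cvg_det F (FF : Filter F) n (M : T -> 'M[K]_n) L :
  mxcvg F M L -> (fun t => \det (M t) : K^o) @ F --> (\det L : K^o).
Proof.
move=> ML; apply: cvg_bigsum => s _; apply: cvgM; first exact: cvg_cst.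
by apply: cvg_bigprod => i _; apply: ML.
Qed.

(** A nonvanishing minor of the limit does not vanish near the limit. *)
Lemma rank_limit F (FF : ProperFilter F) m n k (M : T -> 'M[K]_(m, n)) L :
  mxcvg F M L -> (\forall t \near F, \rank (M t) <= k)%N -> (\rank L <= k)%N.
Proof.
move=> ML Mk; set r := \rank L.
pose A : 'M[K]_(r, m) := pid_mx r *m invmx (col_ebase L).
pose B : 'M[K]_(n, r) := invmx (row_ebase L) *m pid_mx r.
have ALB : A *m L *m B = 1%:M.
  rewrite -(mulmx_ebase L) -/r /A /B.
  rewrite !mulmxA mulmxKV ?col_ebase_unit // mulmxK ?row_ebase_unit //.
  by rewrite !mul_pid_mx !minnn (minn_idPr (rank_leq_row L)) minnn
    (minn_idPr (rank_leq_col L)) pid_mx_1.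
have dets : (fun t => \det (A *m M t *m B) : K^o) @ F --> (1 : K^o).
  rewrite -(det1 K r) -ALB; apply: cvg_det.
  apply: mxcvg_mul; last exact: mxcvg_cst.
  by apply: mxcvg_mul; first exact: mxcvg_cst.
have := cvgr_neq0 (V := K^o) _ dets (oner_neq0 K).
move=> det0; near F => t; have dt : \det (A *m M t *m B) != 0 by near: t; exact: det0.
have Mt : (\rank (M t) <= k)%N by near: t.
have : A *m M t *m B \in unitmx by rewrite unitmxE unitfE.
rewrite -row_full_unit => /eqP <-; apply: leq_trans Mt.
by rewrite (leq_trans (mxrankM_maxl _ _)) // mxrankM_maxr.
Unshelve. all: by end_near. Qed.

End EntrywiseLimits.

(** * Minors, and convergence of complex numbers *)

(** Cramer's rule: the coordinates in the basis given by a minor are quotients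
    of two minors. *)
Lemma cramer_minor (A : comPzRingType) r N (f : 'I_r -> 'I_N) (M : 'M[A]_(r, N)) i j :
  (\adj (colsub f M) *m M) i j =
  \det (colsub (fun k => if k == i then j else f k) M).
Proof.
rewrite mxE [RHS](expand_det_col _ i); apply: eq_bigr => k _.
rewrite !mxE eqxx mulrC; congr (_ * ((-1) ^+ _ * \det _)).
apply/matrixP => a b; rewrite !mxE.
by rewrite eq_sym (negbTE (neq_lift i b)).
Qed.

Lemma rank_nonzero_minor (K : fieldType) r N (M : 'M[K]_(r, N)) :
  \rank M = r -> exists f : {ffun 'I_r -> 'I_N}, \det (colsub f M) != 0.
Proof.
move=> rM; have fullM : row_full M^T by rewrite /row_full mxrank_tr rM.
exists (fullrankfun fullM).
have := mxrank_fullrowsub fullM.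
rewrite -mxrank_tr trmx_mxsub trmxK => rk.
rewrite -unitfE -unitmxE -row_full_unit /row_full.
by rewrite -[X in _ == X]rk; apply/eqP; congr (\rank _); apply/matrixP => a b; rewrite !mxE.
Qed.

Section Complex.
Variable R : realType.
Local Notation C := R[i].

Lemma norm_realC (x : R) : `|x%:C%C : C| = `|x|%:C%C.
Proof. by rewrite normc_def /= expr0n addr0 sqrtr_sqr. Qed.

Lemma cvg_realC (T : Type) (F : set_system T) (FF : Filter F) (f : T -> R) (a : R) :
  (f : T -> R^o) @ F --> (a : R^o) ->
  (fun t => (f t)%:C%C : C^o) @ F --> (a%:C%C : C^o).
Proof.
move=> /cvgrPdist_lt fa; apply/cvgrPdist_lt => -[e e'] /= e0.
have [epos ->] : 0 < e /\ e' = 0 by move: e0; rewrite ltcE /= => /andP[/eqP-> ->].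
apply: filterS (fa e epos) => t.
by rewrite -rmorphB /= norm_realC ltcR.
Qed.

Lemma cvg_complex (T : Type) (F : set_system T) (FF : Filter F) (f : T -> C) (a b : R) :
  (fun t => complex.Re (f t) : R^o) @ F --> (a : R^o) ->
  (fun t => complex.Im (f t) : R^o) @ F --> (b : R^o) ->
  (f : T -> C^o) @ F --> ((a +i* b)%C : C^o).
Proof.
move=> fa fb.
have fE : f = (fun t => (complex.Re (f t))%:C%C + 'i%C * (complex.Im (f t))%:C%C).
  by apply/funext => t; case: (f t) => x y /=; simpc.
rewrite fE [X in _ --> X](_ : _ = (a%:C%C + 'i%C * b%:C%C : C^o)); last by simpc.
by apply: cvgD; [|apply: cvgM; [apply: cvg_cst|]]; apply: cvg_realC.
Qed.

Lemma cvg_natinv : (fun n : nat => n%:R^-1 : C^o) @ \oo --> (0 : C^o).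
Proof.
rewrite -(rmorph0 (real_complex R)).
rewrite (_ : (fun n => _) = (fun n => (n%:R^-1 : R)%:C%C)); last first.
  by apply/funext => n; rewrite fmorphV /= rmorph_nat.
apply: cvg_realC; rewrite -(cvg_shiftS (fun n => n%:R^-1 : R^o)).
exact: cvg_harmonic.
Qed.

(** The real and imaginary parts stay in a compact interval. *)
Lemma ultra_cvg_bounded (T : Type) (U : set_system T) (UU : UltraFilter U)
    (f : T -> C) :
  (\forall t \near U, `|f t| <= 1) -> exists l : C, (f : T -> C^o) @ U --> (l : C^o).
Proof.
move=> fb.
have key (g : T -> R) : (\forall t \near U, `|g t| <= 1) ->
    exists l : R, (g : T -> R^o) @ U --> (l : R^o).
  move=> gb.
  have := @segment_compact R (-1) 1; rewrite compact_ultra => /(_ (g @ U)).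
  case.
  + apply: Build_UltraFilter => G PG UG.
    apply/seteqP; split=> A; last exact: UG.
    move=> GA; have [//|UnA] := in_ultra_setVsetC (g @^-1` A) UU.
    have [x []] := filter_ex (filterI GA (UG (~` A) UnA)); by [].
  + by apply: filterS gb => t; rewrite /= in_itv /= -ler_norml.
  + by move=> l [_ /= gl]; exists l.
have [|a fa] := key (fun t => complex.Re (f t)).
  apply: filterS fb => t ft.
  by have := le_trans (normc_ge_Re (f t)) ft; rewrite -[1]/(1%:C%C) lecR.
have [|b fbb] := key (fun t => complex.Im (f t)).
  apply: filterS fb => t ft.
  have := le_trans (normc_ge_Re ('i%C * f t)) _; rewrite normrM.
  have -> : complex.Re ('i%C * f t) = - complex.Im (f t) by case: (f t) => x y; simpc.
  have -> : `|'i%C| = 1 :> C by rewrite normc_def /= expr0n expr1n add0r sqrtr1.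
  by rewrite mul1r normrN => /(_ _ ft); rewrite -[1]/(1%:C%C) lecR.
by exists (a +i* b)%C; apply: cvg_complex.
Qed.

End Complex.

(** * Limits of families of subspaces *)

Lemma rank_colsub (F : fieldType) m n p (f : 'I_p -> 'I_n) (M : 'M[F]_(m, n)) :
  (\rank (colsub f M) <= \rank M)%N.
Proof.
have -> : colsub f M = M *m (\matrix_(i, j) (i == f j)%:R).
  apply/matrixP => i j; rewrite !mxE (bigD1 (f j)) //= mxE eqxx mulr1 big1 ?addr0 // => k kf.
  by rewrite mxE (negbTE kf) mulr0.
exact: mxrankM_maxl.
Qed.

Section Subspaces.
Variable R : realType.
Local Notation C := R[i].

(** Normalise on the maximal minor of largest modulus; by Cramer's rule the
    other entries are quotients of minors by the largest one. *)
Lemma bounded_basis r N (M : 'M[C]_(r, N)) : \rank M = r ->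
  exists (f : {ffun 'I_r -> 'I_N}) (G : 'M[C]_r),
    [/\ G \in unitmx, colsub f (G *m M) = 1%:M & forall i j, `|(G *m M) i j| <= 1].
Proof.
move=> /rank_nonzero_minor[f0 f0n].
case: (@real_arg_maxP C _ f0 xpredT (fun f : {ffun 'I_r -> 'I_N} => `|\det (colsub f M)|)) =>
  // [g _|f _ le_det]; first exact: normr_real.
have detf : \det (colsub f M) != 0.
  by rewrite -normr_gt0 (lt_le_trans _ (le_det f0 isT)) // normr_gt0.
have uf : colsub f M \in unitmx by rewrite unitmxE unitfE.
exists f, (invmx (colsub f M)); split; first by rewrite unitmx_inv.
  rewrite -(mulVmx uf); apply/matrixP => i j; rewrite !mxE.
  by apply: eq_bigr => k _; rewrite !mxE.
move=> i j; rewrite /invmx uf -scalemxAl mxE cramer_minor normrM normfV.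
rewrite ler_pdivrMl ?normr_gt0 // mulr1.
have -> : colsub (fun k => if k == i then j else f k) M =
    colsub [ffun k => if k == i then j else f k] M.
  by apply/matrixP => a b; rewrite !mxE ffunE.
exact: le_det.
Qed.

(** Compactness of the Grassmannian: in the normalised bases of [bounded_basis]
    the entries are bounded and some minor equals 1 along the ultrafilter. *)
Lemma ultra_limit_subspace (T : Type) (U : set_system T) (UU : UltraFilter U)
    r N (M : T -> 'M[C]_(r, N)) : (forall t, \rank (M t) = r) ->
  exists (G : T -> 'M[C]_r) (L : 'M[C]_(r, N)),
    [/\ forall t, G t \in unitmx, \rank L = r & mxcvg U (fun t => G t *m M t) L].
Proof.
move=> rM.
have /choice[fG fGP] t : exists fG : {ffun 'I_r -> 'I_N} * 'M[C]_r,
    [/\ fG.2 \in unitmx, colsub fG.1 (fG.2 *m M t) = 1%:M &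
        forall i j, `|(fG.2 *m M t) i j| <= 1].
  by have [f [G GP]] := bounded_basis (rM t); exists (f, G).
pose G t := (fG t).2.
have /choice[l lP] (ij : 'I_r * 'I_N) :
    exists l : C, (fun t => (G t *m M t) ij.1 ij.2 : C^o) @ U --> (l : C^o).
  by apply: ultra_cvg_bounded; near=> t; case: (fGP t) => _ _; apply.
pose L : 'M[C]_(r, N) := \matrix_(i, j) l (i, j).
have GL : mxcvg U (fun t => G t *m M t) L by move=> i j; rewrite mxE; apply: (lP (i, j)).
exists G, L; split => //; first by move=> t; case: (fGP t).
have [f Uf] : exists f, U [set t | (fG t).1 = f].
  apply: contrapT => /forallNP nUf.
  have UnF f : U (~` [set t | (fG t).1 = f]).
    by have [/(nUf f)|] := in_ultra_setVsetC [set t | (fG t).1 = f] UU.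
  have nF : \forall t \near U, forall f, (fG t).1 <> f by apply: filter_forall.
  by have [t /(_ (fG t).1)] := filter_ex nF.
have Lf : colsub f L = 1%:M.
  apply/matrixP => i j; rewrite mxE.
  apply: (@cvg_unique C^o _ ((fun t => (G t *m M t) i (f j) : C^o) @ U)).
  - exact: norm_hausdorff.
  - exact: GL.
  - apply: cvg_near_cst.
    apply: filterS Uf => t /= ft; rewrite -ft.
    by case: (fGP t) => _ /matrixP/(_ i j) + _; rewrite mxE.
apply/eqP; rewrite eqn_leq rank_leq_row /=.
by rewrite -[X in (X <= _)%N](mxrank1 C r) -Lf; exact: rank_colsub.
Unshelve. all: by end_near. Qed.

Lemma cvg_leading_coef (p : {poly C}) (d : nat) : (size p <= d.+1)%N ->
  (fun n : nat => n%:R ^- d * p.[n%:R] : C^o) @ \oo --> (p`_d : C^o).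
Proof.
move=> sp.
have -> : p`_d = \sum_(i < d.+1) p`_i * \prod_(k < d - i) (0 : C).
  rewrite big_ord_recr /= subnn big_ord0 mulr1 big1 ?add0r // => i _.
  by rewrite prodr_const card_ord expr0n subn_eq0 leqNgt ltn_ord mulr0.
apply: (@cvg_trans _ ((fun n : nat => \sum_(i < d.+1) p`_i *
    \prod_(k < d - i) (n%:R^-1 : C) : C^o) @ \oo)); last first.
  apply: cvg_bigsum => i _; apply: cvgM; first exact: cvg_cst.
  by apply: cvg_bigprod => k _; exact: cvg_natinv.
apply: near_eq_cvg; near=> n.
have n0 : n%:R != 0 :> C by rewrite pnatr_eq0 -lt0n; near: n; exact: nbhs_infty_gt.
rewrite (horner_coef_wide _ sp) mulr_sumr; apply: eq_bigr => i _.
rewrite prodr_const card_ord mulrCA exprVn; congr (_ * _).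
have id : (i <= d)%N by rewrite -ltnS.
move: (nat_of_ord i) id => k kd.
by rewrite -[in X in X * _](subnK kd) exprD invfM -mulrA mulVf ?expf_neq0 // mulr1.
Unshelve. all: by end_near. Qed.

Lemma near_horner_neq0 (p : {poly C}) : p != 0 ->
  \forall n \near \oo, p.[(n : nat)%:R] != 0.
Proof.
move=> p0; have sp : (size p <= (size p).-1.+1)%N by exact: leqSpred.
have := cvgr_neq0 (V := C^o) _ (cvg_leading_coef sp).
rewrite -lead_coefE lead_coef_eq0 => /(_ _ p0); apply: filterS => n.
by rewrite mulf_eq0 => /norP[].
Qed.

(** A polynomial curve of subspaces has a limit at infinity: divide the
    adjugate of the minor of largest degree by its leading monomial. *)
Lemma curve_limit r N (M : 'M[{poly C}]_(r, N)) (n0 : C) :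
  \rank (map_mx (horner_eval n0) M) = r ->
  exists (G : nat -> 'M[C]_r) (L : 'M[C]_(r, N)),
    [/\ \forall n \near \oo, G n \in unitmx, \rank L = r &
        mxcvg \oo (fun n : nat => G n *m map_mx (horner_eval n%:R) M) L].
Proof.
move=> /rank_nonzero_minor[f0 f0n].
pose m (f : {ffun 'I_r -> 'I_N}) := \det (colsub f M).
have mE (f : {ffun 'I_r -> 'I_N}) x : \det (colsub f (map_mx (horner_eval x) M)) = (m f).[x].
  by rewrite -[RHS]/(horner_eval x (m f)) -det_map_mx; congr (\det _);
    apply/matrixP => i j; rewrite !mxE.
case: (@arg_maxnP _ f0 xpredT (fun f => size (m f)) isT) => f _ fmax.
have mf0 : m f != 0.
  apply: contraNneq f0n => mf; rewrite mE.
  have /= := fmax f0 isT; rewrite mf size_poly0 leqn0 size_poly_eq0 => /eqP->.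
  by rewrite horner0.
set d := (size (m f)).-1.
have sd : size (m f) = d.+1 by rewrite prednK // size_poly_gt0.
pose A := \adj (colsub f M) *m M.
have sA i j : (size (A i j) <= d.+1)%N.
  rewrite /A cramer_minor -sd.
  rewrite (_ : colsub _ M = colsub [ffun k => if k == i then j else f k] M).
    exact: fmax.
  by apply/matrixP => a b; rewrite !mxE ffunE.
pose L : 'M[C]_(r, N) := \matrix_(i, j) (A i j)`_d.
exists (fun n => n%:R ^- d *: map_mx (horner_eval n%:R) (\adj (colsub f M))), L; split.
- near=> n.
  have n0' : n%:R != 0 :> C by rewrite pnatr_eq0 -lt0n; near: n; exact: nbhs_infty_gt.
  have fn : (m f).[n%:R] != 0 by near: n; exact: near_horner_neq0.
  rewrite unitmxZ ?unitfE ?invr_eq0 ?expf_neq0 // map_mx_adj.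
  have uM : map_mx (horner_eval n%:R) (colsub f M) \in unitmx.
    by rewrite unitmxE det_map_mx unitfE.
  have /mulmx1_unit[] // : (\det (map_mx (horner_eval n%:R) (colsub f M)))^-1 *:
     map_mx (horner_eval n%:R) (colsub f M) *m \adj (map_mx (horner_eval n%:R) (colsub f M)) = 1%:M.
  by rewrite -scalemxAl mul_mx_adj scale_scalar_mx mulVf // -unitfE -unitmxE.
- have Lf : colsub f L = (lead_coef (m f))%:M.
    apply/matrixP => i j.
    have AE : A i (f j) = ((m f)%:M : 'M_r) i j.
      rewrite -mul_adj_mx [LHS]mxE [RHS]mxE.
      by apply: eq_bigr => k _; rewrite [X in _ = _ * X]mxE.
    rewrite [LHS]mxE [LHS]mxE AE [RHS]mxE mxE.
    by case: eqP; rewrite ?mulr1n ?mulr0n ?coef0.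
  apply/eqP; rewrite eqn_leq rank_leq_row /=.
  have uLf : colsub f L \in unitmx.
    by rewrite Lf unitmxE det_scalar unitfE expf_neq0 // lead_coef_eq0.
  rewrite -[X in (X <= _)%N](mxrank_unit uLf).
  exact: rank_colsub.
- move=> i j; rewrite mxE.
  apply: cvg_trans (cvg_leading_coef (sA i j)).
  apply: near_eq_cvg; near=> n.
  by rewrite -scalemxAl -map_mxM /= !mxE /=.
Unshelve. all: by end_near. Qed.

End Subspaces.

(** * Symmetrisation tests on subspaces of a tensor square *)

Notation "A *t B" := (tensmx A B)
  (at level 40, left associativity, format "A  *t  B").

Section TensorTests.
Variables (K : fieldType) (n : nat).

Lemma tensmx11 m q : (1%:M : 'M[K]_m) *t (1%:M : 'M_q) = 1%:M.
Proof.
apply/matrixP => u v; case: (mxtens_indexP u) => a b; case: (mxtens_indexP v) => c d.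
by rewrite tensmxE !mxE -natrM mulnb (can_eq (@mxtens_indexK _ _)) xpair_eqE.
Qed.

Lemma tensmxDl m1 m2 p q (A B : 'M[K]_(m1, p)) (D : 'M_(m2, q)) :
  (A + B) *t D = A *t D + B *t D.
Proof. by apply/matrixP => i j; rewrite !mxE mulrDl. Qed.

Lemma tensmxDr m1 m2 p q (A B : 'M[K]_(m1, p)) (D : 'M_(m2, q)) :
  D *t (A + B) = D *t A + D *t B.
Proof. by apply/matrixP => i j; rewrite !mxE mulrDr. Qed.

Lemma tensmxZl m1 m2 p q c (A : 'M[K]_(m1, p)) (D : 'M_(m2, q)) :
  (c *: A) *t D = c *: (A *t D).
Proof. by apply/matrixP => i j; rewrite !mxE mulrA. Qed.

Lemma tensmxZr m1 m2 p q c (A : 'M[K]_(m1, p)) (D : 'M_(m2, q)) :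
  D *t (c *: A) = c *: (D *t A).
Proof. by apply/matrixP => i j; rewrite !mxE mulrCA. Qed.

Definition idx3 (p q z : 'I_n) : 'I_(n * n * n) :=
  mxtens_index (mxtens_index (p, q), z).

Definition unidx3 (u : 'I_(n * n * n)) : 'I_n * 'I_n * 'I_n :=
  let v := mxtens_unindex u in (mxtens_unindex v.1, v.2).

Lemma idx3K p q z : unidx3 (idx3 p q z) = (p, q, z).
Proof. by rewrite /unidx3 /idx3 !mxtens_indexK. Qed.

Variant idx3_spec : 'I_(n * n * n) -> Type := Idx3 p q z : idx3_spec (idx3 p q z).

Lemma idx3P u : idx3_spec u.
Proof. by case: (mxtens_indexP u) => v z; case: (mxtens_indexP v) => p q; apply: Idx3. Qed.

Definition swap13 u := let: (p, q, z) := unidx3 u in idx3 z q p.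
Definition swap23 u := let: (p, q, z) := unidx3 u in idx3 p z q.
Definition rot3 u := let: (p, q, z) := unidx3 u in idx3 z p q.

Definition relabel N (s : 'I_N -> 'I_N) : 'M[K]_N := \matrix_(u, v) (v == s u)%:R.

Lemma mul_relabel N (s : 'I_N -> 'I_N) m (M : 'M[K]_(m, N)) t :
  cancel t s -> cancel s t -> M *m relabel s = \matrix_(i, j) M i (t j).
Proof.
move=> ts st; apply/matrixP => i j; rewrite !mxE (bigD1 (t j)) //= mxE ts eqxx mulr1.
rewrite big1 ?addr0 // => k kt; rewrite mxE; case: eqP => [jE|]; last by rewrite mulr0.
by rewrite jE st eqxx in kt.
Qed.

Lemma relabel_mul N (s : 'I_N -> 'I_N) m (M : 'M[K]_(N, m)) :
  relabel s *m M = \matrix_(i, j) M (s i) j.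
Proof.
apply/matrixP => i j; rewrite !mxE (bigD1 (s i)) //= mxE eqxx mul1r.
by rewrite big1 ?addr0 // => k kt; rewrite mxE (negbTE kt) mul0r.
Qed.

Lemma swap13K : involutive swap13.
Proof. by move=> u; case: (idx3P u) => p q z; rewrite /swap13 !idx3K. Qed.

Lemma swap23K : involutive swap23.
Proof. by move=> u; case: (idx3P u) => p q z; rewrite /swap23 !idx3K. Qed.

Lemma rot3_inv : cancel (fun u => rot3 (rot3 u)) rot3.
Proof. by move=> u; case: (idx3P u) => p q z; rewrite /rot3 !idx3K. Qed.

Lemma rot3K : cancel rot3 (fun u => rot3 (rot3 u)).
Proof. by move=> u; case: (idx3P u) => p q z; rewrite /rot3 !idx3K. Qed.

Lemma tens3_swap13 (P Q S : 'M[K]_n) :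
  (P *t Q *t S) *m relabel swap13 = relabel swap13 *m (S *t Q *t P).
Proof.
rewrite (mul_relabel _ swap13K swap13K) relabel_mul; apply/matrixP => u v; rewrite !mxE.
case: (idx3P u) => a b c; case: (idx3P v) => x y z.
by rewrite /swap13 !idx3K !mxtens_indexK /=; ring.
Qed.

Lemma tens3_swap23 (P Q S : 'M[K]_n) :
  (P *t Q *t S) *m relabel swap23 = relabel swap23 *m (P *t S *t Q).
Proof.
rewrite (mul_relabel _ swap23K swap23K) relabel_mul; apply/matrixP => u v; rewrite !mxE.
case: (idx3P u) => a b c; case: (idx3P v) => x y z.
by rewrite /swap23 !idx3K !mxtens_indexK /=; ring.
Qed.

Lemma tens3_rot3 (P Q S : 'M[K]_n) :
  (P *t Q *t S) *m relabel rot3 = relabel rot3 *m (S *t P *t Q).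
Proof.
rewrite (mul_relabel _ rot3_inv rot3K).
rewrite relabel_mul; apply/matrixP => u v; rewrite !mxE.
case: (idx3P u) => a b c; case: (idx3P v) => x y z.
by rewrite /rot3 !idx3K !mxtens_indexK /=; ring.
Qed.

(** A triple in E (x) A that is symmetric in its first and third factors is a
    relation between the rows of this matrix. *)
Definition skew_left r (E : 'M[K]_(r, n * n)) : 'M_(r * n, n * n * n) :=
  (E *t (1%:M : 'M_n)) *m (1%:M - relabel swap13).

(** The same for the last two factors, with E (x) B. *)
Definition skew_right r (E : 'M[K]_(r, n * n)) : 'M_(r * n, n * n * n) :=
  (E *t (1%:M : 'M_n)) *m (1%:M - relabel swap23).

(** The matrix of (x, y, z) |-> (x + y, x + z): its kernel is isomorphic to the
    intersection of the three row spaces when their rows are independent. *)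
Definition pairwise_diff m1 m2 m3 N (X : 'M[K]_(m1, N)) (Y : 'M_(m2, N)) (Z : 'M_(m3, N)) :=
  col_mx (row_mx X X) (col_mx (row_mx Y 0) (row_mx 0 Z)).

(** The rotations bring E2 (x) A and E3 (x) B into the order A, B, C of the
    factors of E1 (x) C. *)
Definition cube r1 r2 r3 (E1 : 'M[K]_(r1, n * n)) (E2 : 'M[K]_(r2, n * n))
    (E3 : 'M[K]_(r3, n * n)) :=
  pairwise_diff (E1 *t (1%:M : 'M_n)) ((E2 *t (1%:M : 'M_n)) *m relabel rot3)
    ((E3 *t (1%:M : 'M_n)) *m relabel rot3 *m relabel rot3).

Lemma rank_conj m m' N (H : 'M[K]_(m', m)) (M : 'M_(m, N)) (P : 'M_N) :
  (\rank (H *m M *m P) <= \rank M)%N.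
Proof. by rewrite (leq_trans (mxrankM_maxl _ _)) // mxrankM_maxr. Qed.

Lemma rank_pairwise_diff m1 m2 m3 p1 p2 p3 N (X : 'M[K]_(m1, N)) (Y : 'M_(m2, N)) (Z : 'M_(m3, N))
    (A : 'M_(p1, m1)) (B : 'M_(p2, m2)) (D : 'M_(p3, m3)) (P : 'M_N) :
  (\rank (pairwise_diff (A *m X *m P) (B *m Y *m P) (D *m Z *m P)) <=
   \rank (pairwise_diff X Y Z))%N.
Proof.
pose H := block_mx A 0 0 (block_mx B 0 0 D).
pose Q : 'M_(N + N) := block_mx P 0 0 P.
suff -> : pairwise_diff (A *m X *m P) (B *m Y *m P) (D *m Z *m P) =
          H *m pairwise_diff X Y Z *m Q by apply: rank_conj.
rewrite /H /pairwise_diff mul_block_col mul_block_col !mul0mx !addr0 !add0r.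
by rewrite !mul_mx_row !mulmx0 !mul_col_mx !mul_row_block !mulmx0 !mul0mx !addr0 !add0r.
Qed.

Section Action.
Variables (r : nat).
Implicit Types (E : 'M[K]_(r, n * n)) (P Q S : 'M[K]_n).

(** The symmetrisation commutes with an action that is the same on the two
    factors it exchanges, so the extra factor is made to follow the first one. *)
Lemma skew_left_act E P Q : P \in unitmx ->
  (\rank (skew_left (E *m (P *t Q))) <= \rank (skew_left E))%N.
Proof.
move=> uP; have -> : skew_left (E *m (P *t Q)) =
    (1%:M *t invmx P) *m skew_left E *m (P *t Q *t P); last exact: rank_conj.
rewrite /skew_left !mulmxBr !mulmxBl !mulmx1 mulmxA.
rewrite -[in RHS]mulmxA -[in RHS](mulmxA _ (relabel _)) -tens3_swap13 !mulmxA.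
by rewrite !tensmx_mul !mul1mx !mulmx1 mulVmx.
Qed.

Lemma skew_right_act E P Q : Q \in unitmx ->
  (\rank (skew_right (E *m (P *t Q))) <= \rank (skew_right E))%N.
Proof.
move=> uP; have -> : skew_right (E *m (P *t Q)) =
    (1%:M *t invmx Q) *m skew_right E *m (P *t Q *t Q); last exact: rank_conj.
rewrite /skew_right !mulmxBr !mulmxBl !mulmx1 mulmxA.
rewrite -[in RHS]mulmxA -[in RHS](mulmxA _ (relabel _)) -tens3_swap23 !mulmxA.
by rewrite !tensmx_mul !mul1mx !mulmx1 mulVmx.
Qed.

Lemma cube_act E1 E2 E3 P Q S : P \in unitmx -> Q \in unitmx -> S \in unitmx ->
  (\rank (cube (E1 *m (P *t Q)) (E2 *m (Q *t S)) (E3 *m (S *t P))) <=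
   \rank (cube E1 E2 E3))%N.
Proof.
move=> uP uQ uS; rewrite /cube.
have e1 : (E1 *m (P *t Q)) *t 1%:M =
    (1%:M *t invmx S) *m (E1 *t 1%:M) *m (P *t Q *t S).
  by rewrite !tensmx_mul !mul1mx !mulmx1 mulVmx.
have e2 : (E2 *m (Q *t S)) *t 1%:M *m relabel rot3 =
    (1%:M *t invmx P) *m ((E2 *t 1%:M) *m relabel rot3) *m (P *t Q *t S).
  by rewrite -!mulmxA -tens3_rot3 !mulmxA !tensmx_mul !mul1mx !mulmx1 mulVmx.
have e3 : (E3 *m (S *t P)) *t 1%:M *m relabel rot3 *m relabel rot3 =
    (1%:M *t invmx Q) *m ((E3 *t 1%:M) *m relabel rot3 *m relabel rot3) *m (P *t Q *t S).
  rewrite -!mulmxA -tens3_rot3 [in RHS](mulmxA (relabel _) _ (relabel _)) -tens3_rot3 !mulmxA.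
  by rewrite !tensmx_mul !mul1mx !mulmx1 mulVmx.
rewrite e1 e2 e3; exact: rank_pairwise_diff.
Qed.

Lemma skew_left_row (G : 'M_r) E : (\rank (skew_left (G *m E)) <= \rank (skew_left E))%N.
Proof.
have -> : skew_left (G *m E) = (G *t 1%:M) *m skew_left E.
  by rewrite /skew_left mulmxA tensmx_mul mul1mx.
exact: mxrankM_maxr.
Qed.

Lemma skew_right_row (G : 'M_r) E : (\rank (skew_right (G *m E)) <= \rank (skew_right E))%N.
Proof.
have -> : skew_right (G *m E) = (G *t 1%:M) *m skew_right E.
  by rewrite /skew_right mulmxA tensmx_mul mul1mx.
exact: mxrankM_maxr.
Qed.

Lemma cube_row (G1 G2 G3 : 'M_r) E1 E2 E3 :
  (\rank (cube (G1 *m E1) (G2 *m E2) (G3 *m E3)) <= \rank (cube E1 E2 E3))%N.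
Proof.
have e G E : (G *m E) *t 1%:M = (G *t (1%:M : 'M_n)) *m (E *t 1%:M).
  by rewrite tensmx_mul mul1mx.
have := rank_pairwise_diff (E1 *t (1%:M : 'M_n)) ((E2 *t (1%:M : 'M_n)) *m relabel rot3)
    ((E3 *t (1%:M : 'M_n)) *m relabel rot3 *m relabel rot3)
    (G1 *t (1%:M : 'M_n)) (G2 *t (1%:M : 'M_n)) (G3 *t (1%:M : 'M_n)) 1%:M.
by rewrite !mulmx1 !mulmxA -!e.
Qed.

End Action.
End TensorTests.

(** * Configurations of three subspaces and limits of flows *)

Section Configurations.
Variables (R : realType) (n r : nat).
Local Notation C := R[i].
Local Notation config := ('I_3 -> 'M[C]_(r, n * n)).
Local Notation frame := ('I_3 -> 'M[C]_n).

(** Factors are indexed cyclically by 'I_3; the i-th subspace lives in the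
    product of the factors i and i + 1. *)
Definition pair_mx (P : frame) (i : 'I_3) : 'M[C]_(n * n) := P i *t P (i + 1).

Definition act (E : config) (P : frame) : config := fun i => E i *m pair_mx P i.

(** In the intended case [W] has the slices of a cyclically symmetric tensor as
    rows, which is why it is the same for the three pairs of factors. *)
Record apolar (W : 'M[C]_(n, n * n)) (E : config) : Prop := Apolar {
  apolar_rank : forall i, \rank (E i) = r;
  apolar_sub : forall i, (W <= E i)%MS;
  apolar_left : forall i, (\rank (skew_left (E i)) <= r * n - r)%N;
  apolar_right : forall i, (\rank (skew_right (E i)) <= r * n - r)%N;
  apolar_cube : (\rank (cube (E 0%R) (E 1%R) (E (1 + 1)%R)) <= 3 * (r * n) - r)%N }.

(** What is used of a closed subset of a product of Grassmannians, with
    subspaces represented by bases. *)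
Record degenerable (X : config -> Prop) : Prop := Degenerable {
  degen_rank : forall E, X E -> forall i, \rank (E i) = r;
  degen_basis : forall E (G : 'I_3 -> 'M[C]_r), (forall i, G i \in unitmx) ->
    X E -> X (fun i => G i *m E i);
  degen_limit : forall (F : set_system nat), ProperFilter F ->
    forall (E : nat -> config) (L : config), (\forall t \near F, X (E t)) ->
    (forall i, mxcvg F (E^~ i) (L i)) -> (forall i, \rank (L i) = r) -> X L }.

(** An inclusion is a bound on a rank, and hence is preserved by limits. *)
Lemma sub_rank_col m N (W : 'M[C]_(m, N)) (E : 'M[C]_(r, N)) :
  \rank E = r -> (W <= E)%MS = (\rank (col_mx W E) <= r)%N.
Proof.
move=> rE; rewrite -addsmxE -[X in (_ <= X)%N]rE.
apply/idP/idP => [WE|le]; first by rewrite (addsmx_idPr WE).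
apply/addsmx_idPr/eqmxP; rewrite addsmxSr andbT.
by rewrite -(geq_leqif (mxrank_leqif_sup (addsmxSr W E))).
Qed.

Lemma sub_limit (F : set_system nat) (FF : ProperFilter F) m N (W : nat -> 'M[C]_(m, N))
    (E : nat -> 'M[C]_(r, N)) W' E' :
  (\forall t \near F, \rank (E t) = r /\ (W t <= E t)%MS) ->
  mxcvg F W W' -> mxcvg F E E' -> \rank E' = r -> (W' <= E')%MS.
Proof.
move=> WE cW cE rE'; rewrite sub_rank_col //.
apply: (@rank_limit _ _ F _ _ _ _ (fun t => col_mx (W t) (E t)) _); first exact: mxcvg_col.
by apply: filterS WE => t [rE sub]; rewrite -sub_rank_col.
Qed.

Lemma apolar_degenerable W : degenerable (apolar W).
Proof.
split=> [E []//|E G uG [rE subE lE rtE cE]|F FF E L EX EL rL].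
- split=> [i|i|i|i|].
  + by rewrite eqmxMfull ?row_full_unit ?rE.
  + by rewrite eqmxMfull ?row_full_unit.
  + exact: leq_trans (skew_left_row _ _) (lE i).
  + exact: leq_trans (skew_right_row _ _) (rtE i).
  + exact: leq_trans (cube_row _ _ _ _ _ _) cE.
- have cvt i : mxcvg F (fun t => E t i *t (1%:M : 'M_n)) (L i *t 1%:M).
    by apply: mxcvg_tens; [exact: EL | exact: mxcvg_cst].
  split=> // [i|i|i|].
  + apply: (@sub_limit F _ _ _ (fun=> W) (E^~ i)) => //; last exact: mxcvg_cst.
    by apply: filterS EX => t [].
  + apply: (@rank_limit _ _ F _ _ _ _ (fun t => skew_left (E t i))).
      by apply: mxcvg_mul; [exact: cvt | exact: mxcvg_cst].
    by apply: filterS EX => t [].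
  + apply: (@rank_limit _ _ F _ _ _ _ (fun t => skew_right (E t i))).
      by apply: mxcvg_mul; [exact: cvt | exact: mxcvg_cst].
    by apply: filterS EX => t [].
  + apply: (@rank_limit _ _ F _ _ _ _ (fun t => cube (E t 0%R) (E t 1%R) (E t (1 + 1)%R)) _); last first.
      by apply: filterS EX => t [].
    have c0 : mxcvg F (fun=> 0 : 'M[C]_(r * n, n * n * n)) 0 by exact: mxcvg_cst.
    have crot : mxcvg F (fun=> relabel C (@rot3 n)) (relabel C (@rot3 n)) by exact: mxcvg_cst.
    apply: mxcvg_col; first by apply: mxcvg_row; exact: cvt.
    apply: mxcvg_col; apply: mxcvg_row.
    + exact: (mxcvg_mul _ (cvt 1) crot).
    + exact: c0.
    + exact: c0.
    + exact: (mxcvg_mul _ (mxcvg_mul _ (cvt _) crot) crot).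
Qed.

Lemma pair_mx_unit P : (forall i, P i \in unitmx) -> forall i, pair_mx P i \in unitmx.
Proof.
move=> uP i.
have : (invmx (P i) *t invmx (P (i + 1))) *m pair_mx P i = 1%:M.
  rewrite tensmx_mul !mulVmx //; apply/matrixP => u v.
  case: (mxtens_indexP u) => a b; case: (mxtens_indexP v) => c d.
  by rewrite tensmxE !mxE -natrM mulnb (can_eq (@mxtens_indexK _ _)) xpair_eqE.
by case/mulmx1_unit.
Qed.

Lemma apolar_act W E P : (forall i, P i \in unitmx) ->
  (forall i, (W *m pair_mx P i <= W)%MS) -> apolar W E -> apolar W (act E P).
Proof.
move=> uP WP [rE subE lE rtE cE].
have upair := pair_mx_unit uP.
split=> [i|i|i|i|].
- by rewrite mxrankMfree ?rE // row_free_unit.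
- have : (W *m pair_mx P i <= act E P i)%MS by rewrite submxMr.
  apply: submx_trans; move: (WP i).
  by rewrite -(geq_leqif (mxrank_leqif_sup (WP i))) mxrankMfree // row_free_unit.
- exact: leq_trans (skew_left_act _ _ (uP _)) (lE i).
- exact: leq_trans (skew_right_act _ _ (uP _)) (rtE i).
- apply: leq_trans cE.
  have -> : act E P 0 = E 0 *m (P 0 *t P 1) by rewrite /act /pair_mx add0r.
  have e0 : 1 + 1 + 1 = 0 :> 'I_3 by apply/val_inj.
  have -> : act E P (1 + 1) = E (1 + 1) *m (P (1 + 1) *t P 0) by rewrite /act /pair_mx e0.
  exact: cube_act.
Qed.

(** The flow is a polynomial curve of subspaces, hence has a limit at infinity,
    and a transformation that only reparametrises the curve fixes the limit. *)
Lemma flow_limit (X : config -> Prop) (E : config) (Q : 'I_3 -> 'M[{poly C}]_n)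
    (P : nat -> frame) :
  degenerable X -> (forall t i, P t i = map_mx (horner_eval t%:R) (Q i)) ->
  (\forall t \near \oo, X (act E (P t)) /\ forall i, P t i \in unitmx) -> X E ->
  exists2 L, X L & forall (s : frame) (m : nat -> nat), m @ \oo --> \oo ->
    (forall t i, P t i *m s i = P (m t) i) ->
    forall i, (L i *m pair_mx s i <= L i)%MS.
Proof.
move=> dX PE XP XE.
pose M i : 'M[{poly C}]_(r, n * n) := map_mx polyC (E i) *m (Q i *t Q (i + 1)).
have ME t i : map_mx (horner_eval t%:R) (M i) = act E (P t) i.
  rewrite map_mxM map_mxT -map_mx_comp; rewrite /act /pair_mx !PE; congr (_ *m _).
  by apply/matrixP => a b; rewrite !mxE /= /horner_eval hornerC.
have [t0 [XP0 uP0]] := filter_ex XP.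
have /choice[GL GLP] (i : 'I_3) : exists GL : (nat -> 'M[C]_r) * 'M[C]_(r, n * n),
    [/\ \forall t \near \oo, GL.1 t \in unitmx, \rank GL.2 = r &
        mxcvg \oo (fun t : nat => GL.1 t *m map_mx (horner_eval t%:R) (M i)) GL.2].
  have rk0 : \rank (map_mx (horner_eval t0%:R) (M i)) = r.
    by rewrite ME; apply: (degen_rank dX).
  by have [G [L GL]] := curve_limit rk0; exists (G, L).
pose G i := (GL i).1; pose L i := (GL i).2.
have cvL i : mxcvg \oo (fun t => G i t *m act E (P t) i) (L i).
  by case: (GLP i) => _ _; under eq_fun do rewrite ME.
have rL i : \rank (L i) = r by case: (GLP i).
have uG : \forall t \near \oo, forall i, G i t \in unitmx.
  by apply: filter_forall => i; case: (GLP i).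
exists L.
  apply: (@degen_limit X dX \oo _ (fun t i => G i t *m act E (P t) i)) => //.
  near=> t; apply: (degen_basis dX); first by near: t.
  by have [] : X (act E (P t)) /\ forall i, P t i \in unitmx by near: t.
move=> s m minf Ps i.
have cvs : mxcvg \oo (fun t => G i t *m act E (P (m t)) i) (L i *m pair_mx s i).
  have cs : mxcvg \oo (fun=> pair_mx s i) (pair_mx s i) by exact: mxcvg_cst.
  have <- : (fun t => G i t *m act E (P t) i *m pair_mx s i) =
            (fun t => G i t *m act E (P (m t)) i).
    by apply/funext => t; rewrite /act /pair_mx -2!mulmxA tensmx_mul !Ps.
  exact: mxcvg_mul.
have cvm : mxcvg \oo (fun t => G i (m t) *m act E (P (m t)) i) (L i).
  by move=> a b; apply: cvg_comp minf (cvL i a b).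
apply: (sub_limit _ _ cvs cvm (rL i)).
have uGm : \forall t \near \oo, forall j, G j (m t) \in unitmx := minf _ uG.
have XPm : \forall t \near \oo, X (act E (P (m t))) /\ forall i, P (m t) i \in unitmx := minf _ XP.
apply: filterS (filterI uGm XPm) => t [uGt [XPt _]].
split; first by rewrite eqmxMfull ?row_full_unit // (degen_rank dX XPt).
apply: (submx_trans (submxMl _ _)).
by rewrite (eqmxMfull _ (_ : row_full (G i (m t)))) ?row_full_unit ?submx_refl.
Unshelve. all: by end_near. Qed.

End Configurations.

(** * Fixed points of unipotent and diagonal groups *)

Section Flows.
Variables (R : realType) (n r : nat).
Local Notation C := R[i].
Local Notation config := ('I_3 -> 'M[C]_(r, n * n)).
Local Notation frame := ('I_3 -> 'M[C]_n).

Definition lie (x : frame) (i : 'I_3) : 'M[C]_(n * n) :=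
  x i *t (1%:M : 'M_n) + (1%:M : 'M_n) *t x (i + 1).

Definition stable (x : frame) (E : config) : Prop :=
  forall i, (E i *m lie x i <= E i)%MS.

Lemma stable_comb c x y E : stable x E -> stable y E ->
  stable (fun i => x i + c *: y i) E.
Proof.
move=> sx sy i.
have -> : lie (fun j => x j + c *: y j) i = lie x i + c *: lie y i.
  by rewrite /lie tensmxDl tensmxDr tensmxZl tensmxZr scalerDr addrACA.
by rewrite mulmxDr -scalemxAr addmx_sub ?scalemx_sub.
Qed.

Lemma stable_act (P x y : frame) E :
  (forall i, P i *m x i = y i *m P i) -> stable y E -> stable x (act E P).
Proof.
move=> Pxy sy i.
have comm : pair_mx P i *m lie x i = lie y i *m pair_mx P i.
  by rewrite /pair_mx /lie mulmxDr mulmxDl !tensmx_mul !Pxy !mulmx1 !mul1mx.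
by rewrite /act -mulmxA comm mulmxA submxMr.
Qed.

Lemma stable_degenerable (X : config -> Prop) x :
  degenerable X -> degenerable (fun E => X E /\ stable x E).
Proof.
move=> dX; split=> [E [XE _]|E G uG [XE sE]|F FF E L EX EL rL].
- exact: degen_rank dX _ XE.
- split=> [|i]; first exact: (degen_basis dX).
  have fG : row_full (G i) by rewrite row_full_unit.
  by rewrite -mulmxA !(eqmxMfull _ fG).
- split; first by apply: (@degen_limit _ _ _ X dX F FF E L _ EL rL); apply: filterS EX => t [].
  move=> i.
  have cl : mxcvg F (fun=> lie x i) (lie x i) by exact: mxcvg_cst.
  apply: (sub_limit _ _ (mxcvg_mul _ (EL i) cl) (EL i) (rL i)).
  by apply: filterS EX => t [XE sE]; split; [exact: (degen_rank dX XE) | exact: sE].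
Qed.

Definition one_param (x : frame) (t : C) : frame := fun i => 1%:M + t *: x i.

Lemma one_param_unit x t : (forall i, x i *m x i = 0) -> forall i, one_param x t i \in unitmx.
Proof.
move=> x2 i; have : one_param x t i *m one_param x (- t) i = 1%:M.
  rewrite /one_param mulmxDl !mulmxDr mulmx1 mul1mx mulmx1 -scalemxAl -scalemxAr x2.
  by rewrite !scaler0 addr0 scaleNr addrAC -addrA subrr addr0.
by case/mulmx1_unit.
Qed.

(** A limit of the flow is fixed by the one-parameter group, and the derivation
    is a combination of its elements. *)
Lemma unipotent_fixed (X : config -> Prop) (x : frame) E :
  degenerable X -> (forall i, x i *m x i = 0) ->
  (forall E (t : nat), X E -> X (act E (one_param x t%:R))) -> X E ->
  exists2 L, X L & stable x L.
Proof.
move=> dX x2 Xx XE.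
pose Q i : 'M[{poly C}]_n := 1%:M + 'X *: map_mx polyC (x i).
have QE t i : map_mx (horner_eval t) (Q i) = one_param x t i.
  apply/matrixP => a b; rewrite !mxE /= /horner_eval hornerD hornerM hornerX hornerC.
  by case: (a == b); rewrite ?hornerC ?horner0.
have near1 : \forall t \near \oo, X (act E (one_param x (t : nat)%:R)) /\
    forall i, one_param x t%:R i \in unitmx.
  by near=> t; split=> [|i]; [exact: Xx | exact: one_param_unit].
have [L XL Lfix] := flow_limit dX (fun t i => esym (QE t%:R i)) near1 XE.
exists L => // i.
have P1 t j : one_param x t%:R j *m one_param x 1 j = one_param x (t.+1)%:R j.
  rewrite /one_param mulmxDr mulmx1 scale1r mulmxDl mul1mx -scalemxAl x2 scaler0 addr0.
  by rewrite -natr1 scalerDl scale1r addrA.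
have step : (L i *m pair_mx (one_param x 1) i <= L i)%MS.
  apply: (Lfix _ succn) => //; apply/cvgnyPge => A; near=> t.
  by rewrite leqW //; near: t; exact: nbhs_infty_ge.
set u := pair_mx (one_param x 1) i in step.
have uu : (L i *m (u *m u) <= L i)%MS.
  by rewrite mulmxA (submx_trans _ step) // submxMr.
(* If u = 1 + X + Y with u^2 = 1 + 2 X + 4 Y, then 2 X = 4 u - u^2 - 3. *)
have lieE : 2%:R *: lie x i = 4%:R *: u - u *m u - 3%:R *: 1%:M.
  have P11 j : one_param x 1 j *m one_param x 1 j = one_param x 2%:R j by exact: (P1 1%N).
  rewrite /u /pair_mx tensmx_mul !P11 /one_param /lie.
  rewrite !scale1r !tensmxDl !tensmxDr !tensmxZl !tensmxZr tensmx11.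
  set a := x i *t _; set b := _ *t x (i + 1); set c := x i *t x (i + 1).
  apply/matrixP => k l; rewrite !mxE; ring.
have : (L i *m (2%:R *: lie x i) <= L i)%MS.
  rewrite lieE !mulmxBr -!scalemxAr mulmx1.
  by rewrite !addmx_sub ?eqmx_opp ?scalemx_sub.
by rewrite -scalemxAr eqmx_scale // pnatr_eq0.
Unshelve. all: by end_near. Qed.

(** Each step of the chain keeps the stability achieved before, because the
    new one-parameter group normalises the earlier directions. *)
Lemma unipotent_chain (xs : nat -> frame) (N : nat) (X : config -> Prop) E :
  degenerable X -> (forall k i, (k < N)%N -> xs k i *m xs k i = 0) ->
  (forall k E (t : nat), (k < N)%N -> X E -> X (act E (one_param (xs k) t%:R))) ->
  (forall k j, (j < k < N)%N -> exists c l, (l < k)%N /\ forall i,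
     xs k i *m xs j i = xs j i *m xs k i + c *: xs l i /\
     c *: (xs l i *m xs k i) = 0) ->
  X E -> exists2 L, X L & forall k, (k < N)%N -> stable (xs k) L.
Proof.
move=> dX x2 Xx norm XE.
suff : forall k, (k <= N)%N -> degenerable (fun L => X L /\ forall j, (j < k)%N -> stable (xs j) L) /\
    exists L, X L /\ forall j, (j < k)%N -> stable (xs j) L.
  by move=> /(_ N (leqnn N))[_ [L [XL sL]]]; exists L.
elim=> [_|k IH kN].
  split; last by exists E.
  split=> [L [XL _]|L G uG [XL _]|F FF D L XD DL rL].
  - exact: degen_rank dX _ XL.
  - by split => //; apply: (degen_basis dX).
  - split=> //; apply: (@degen_limit _ _ _ X dX F FF D L _ DL rL).
    by apply: filterS XD => t [].
have [dXk [L0 XL0]] := IH (ltnW kN).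
pose Xk L := X L /\ forall j, (j < k)%N -> stable (xs j) L.
have Xk_act L (t : nat) : Xk L -> Xk (act L (one_param (xs k) t%:R)).
  move=> [XL sL]; split=> [|j jk]; first exact: Xx.
  have [|c [l [lk nrm]]] := norm k j; first by rewrite jk.
  apply: (@stable_act _ _ (fun i => xs j i + (t%:R * c) *: xs l i)).
    move=> i; have [e1 e2] := nrm i; rewrite /one_param mulmxDl mulmxDr mul1mx mulmx1.
    rewrite -scalemxAl -scalemxAr mulmxDl -scalemxAl e1.
    rewrite -[(t%:R * c) *: (_ *m _)]scalerA e2 scaler0 addr0 scalerDr addrAC addrA scalerA.
    by rewrite addrAC.
  by apply: stable_comb; apply: sL.
have [L [XL sL] skL] := unipotent_fixed dXk (fun i => x2 k i kN) Xk_act XL0.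
have jE j : (j < k.+1)%N -> j = k \/ (j < k)%N.
  by rewrite ltnS leq_eqVlt => /orP[/eqP|]; [left|right].
split; last first.
  by exists L; split; [exact: XL | move=> j /jE[->|]; [exact: skL | exact: sL]].
have := stable_degenerable (xs k) dXk; congr degenerable.
apply/funext => D; apply/propext; split.
  by move=> [[XD sD] skD]; split; [exact: XD | move=> j /jE[->|]; [exact: skD | exact: sD]].
by move=> [XD sD]; split; [split; [exact: XD | move=> j jk; apply: sD; exact: ltnW] | exact: sD].
Qed.

Definition torus (w : 'I_3 -> 'I_n -> nat) (t : C) : frame :=
  fun i => diag_mx (\row_a t ^+ w i a).

Lemma torus_unit w t : t != 0 -> forall i, torus w t i \in unitmx.
Proof.
move=> t0 i; rewrite unitmxE det_diag unitfE; apply/prodf_neq0 => a _.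
by rewrite mxE expf_neq0.
Qed.

(** A single element of the torus is enough: the doubling t |-> 2 t
    reparametrises the flow. *)
Lemma torus_fixed (X : config -> Prop) w E :
  degenerable X ->
  (forall E (t : nat), (0 < t)%N -> X E -> X (act E (torus w t%:R))) -> X E ->
  exists2 L, X L & forall i, (L i *m pair_mx (torus w 2%:R) i <= L i)%MS.
Proof.
move=> dX Xw XE.
pose Q i : 'M[{poly C}]_n := diag_mx (\row_a 'X ^+ w i a).
have QE t i : torus w t i = map_mx (horner_eval t) (Q i).
  apply/matrixP => a b; rewrite !mxE /= /horner_eval.
  by case: (a == b); rewrite ?mulr1n ?mulr0n ?horner0 ?hornerXn.
have near1 : \forall t \near \oo, X (act E (torus w (t : nat)%:R)) /\
    forall i, torus w t%:R i \in unitmx.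
  near=> t; have t0 : (0 < t)%N by near: t; exact: nbhs_infty_gt.
  by split=> [|i]; [exact: Xw | rewrite torus_unit // pnatr_eq0 -lt0n].
have [L XL Lfix] := flow_limit dX (fun t i => QE t%:R i) near1 XE.
exists L => //; apply: (Lfix _ (fun t => t * 2)%N); first exact: cvg_mulnr.
move=> t i; apply/matrixP => a b; rewrite mul_diag_mx !mxE natrM exprMn.
by rewrite mulrnAr.
Unshelve. all: by end_near. Qed.

(** Borel's fixed point theorem for a group given by generators.  The torus
    comes last: it normalises every unipotent direction up to scaling, so that
    its limit keeps the stability already achieved. *)
Lemma borel_fixed (xs : nat -> frame) (N : nat) w (X : config -> Prop) E :
  degenerable X -> (forall k i, (k < N)%N -> xs k i *m xs k i = 0) ->
  (forall k E (t : nat), (k < N)%N -> X E -> X (act E (one_param (xs k) t%:R))) ->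
  (forall k j, (j < k < N)%N -> exists c l, (l < k)%N /\ forall i,
     xs k i *m xs j i = xs j i *m xs k i + c *: xs l i /\
     c *: (xs l i *m xs k i) = 0) ->
  (forall E (t : nat), (0 < t)%N -> X E -> X (act E (torus w t%:R))) ->
  (forall k t, (k < N)%N -> t != 0 -> exists c, forall i,
     torus w t i *m xs k i = c *: xs k i *m torus w t i) ->
  X E -> exists2 L, X L & (forall k, (k < N)%N -> stable (xs k) L) /\
                      (forall i, (L i *m pair_mx (torus w 2%:R) i <= L i)%MS).
Proof.
move=> dX x2 Xx nrm Xw wn XE.
have [L0 XL0 sL0] := unipotent_chain dX x2 Xx nrm XE.
suff dXN : degenerable (fun L => X L /\ forall k, (k < N)%N -> stable (xs k) L).
  have Xw' D (t : nat) : (0 < t)%N -> (X D /\ forall k, (k < N)%N -> stable (xs k) D) ->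
      X (act D (torus w t%:R)) /\ forall k, (k < N)%N -> stable (xs k) (act D (torus w t%:R)).
    move=> t0 [XD sD]; split=> [|k kN]; first exact: Xw.
    have t0' : t%:R != 0 :> C by rewrite pnatr_eq0 -lt0n.
    have [c cP] := wn k t%:R kN t0'.
    apply: (stable_act cP) => i.
    have -> : lie (fun i => c *: xs k i) i = c *: lie (xs k) i.
      by rewrite /lie tensmxZl tensmxZr scalerDr.
    by rewrite -scalemxAr scalemx_sub // sD.
  have [L [XL sL] wL] := torus_fixed dXN Xw' (conj XL0 sL0).
  by exists L.
split=> [L [XL _]|L G uG [XL sL]|F FF D L XD DL rL].
- exact: degen_rank dX _ XL.
- split=> [|k kN i]; first exact: (degen_basis dX).
  have fG : row_full (G i) by rewrite row_full_unit.
  by rewrite -mulmxA !(eqmxMfull _ fG); exact: sL.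
- split=> [|k kN i].
    by apply: (@degen_limit _ _ _ X dX F FF D L _ DL rL); apply: filterS XD => t [].
  have [|_ skL] := @degen_limit _ _ _ _ (stable_degenerable (xs k) dX) F FF D L _ DL rL.
    by apply: filterS XD => t [XDt sDt]; split=> //; exact: sDt.
  exact: skL.
Qed.

End Flows.

(** * Border apolarity *)

Section BorderApolarity.
Variables (R : realType) (n r : nat).
Local Notation C := R[i].
Local Notation vectors := ('I_r -> 'I_3 -> 'I_n -> C).

Definition rank_one_sum (v : vectors) (i : 'I_3) (p q s : 'I_n) : C :=
  \sum_k v k i p * v k (i + 1) q * v k (i + 1 + 1) s.

Lemma rank_one_sum_rot v i p q s :
  rank_one_sum v (i + 1) p q s = rank_one_sum v i s p q.
Proof.
have e : i + 1 + 1 + 1 = i by apply/val_inj; case: i => -[|[|[|]]].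
by rewrite /rank_one_sum e; apply: eq_bigr => k _; ring.
Qed.

Definition pair_rows (v : vectors) (i : 'I_3) : 'M[C]_(r, n * n) :=
  \matrix_(k, u) (v k i (mxtens_unindex u).1 * v k (i + 1) (mxtens_unindex u).2).

Definition flat (T : 'I_n -> 'I_n -> 'I_n -> C) : 'M[C]_(n, n * n) :=
  \matrix_(s, u) T (mxtens_unindex u).1 (mxtens_unindex u).2 s.

(** The coefficients of the relations: row k is e_k (x) v_k. *)
Definition block_rows (v : vectors) (i : 'I_3) : 'M[C]_(r, r * n) :=
  \matrix_(k, u) (((mxtens_unindex u).1 == k)%:R * v k i (mxtens_unindex u).2).

Definition triple_rows (v : vectors) (i : 'I_3) (j : 'I_3) (l : 'I_3) : 'M[C]_(r, n * n * n) :=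
  \matrix_(k, u) (v k i (unidx3 u).1.1 * v k j (unidx3 u).1.2 * v k l (unidx3 u).2).

Lemma block_rows_mul v i l :
  block_rows v l *m (pair_rows v i *t (1%:M : 'M_n)) = triple_rows v i (i + 1) l.
Proof.
apply/matrixP => k u; rewrite !mxE; case: (idx3P u) => p q z.
rewrite idx3K /= (bigD1 (mxtens_index (k, z))) //= !mxE !mxtens_indexK /= !eqxx mul1r mulr1.
rewrite big1 ?addr0 => [|w wk]; first by rewrite mulrC.
case: (mxtens_indexP w) wk => a b wk; rewrite !mxE !mxtens_indexK /=.
case: (eqVneq a k) => [ak|]; last by rewrite !mul0r.
case: (eqVneq b z) => [bz|]; last by rewrite !mulr0.
by rewrite ak bz eqxx in wk.
Qed.

Lemma triple_rows_swap13 v i j l :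
  triple_rows v i j l *m relabel C (@swap13 n) = triple_rows v l j i.
Proof.
rewrite (mul_relabel _ (@swap13K n) (@swap13K n)); apply/matrixP => k u; rewrite !mxE.
by case: (idx3P u) => p q z; rewrite /swap13 !idx3K /=; ring.
Qed.

Lemma triple_rows_swap23 v i j l :
  triple_rows v i j l *m relabel C (@swap23 n) = triple_rows v i l j.
Proof.
rewrite (mul_relabel _ (@swap23K n) (@swap23K n)); apply/matrixP => k u; rewrite !mxE.
by case: (idx3P u) => p q z; rewrite /swap23 !idx3K /=; ring.
Qed.

Lemma triple_rows_rot3 v i j l :
  triple_rows v i j l *m relabel C (@rot3 n) = triple_rows v l i j.
Proof.
rewrite (mul_relabel _ (@rot3_inv n) (@rot3K n)); apply/matrixP => k u; rewrite !mxE.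
by case: (idx3P u) => p q z; rewrite /rot3 !idx3K /=; ring.
Qed.

Lemma flat_sub v i :
  (flat (rank_one_sum v i) <= pair_rows v i)%MS.
Proof.
apply/submxP; exists (\matrix_(s, k) v k (i + 1 + 1) s).
apply/matrixP => s u; rewrite !mxE; apply: eq_bigr => k _; rewrite !mxE; ring.
Qed.

Section Independent.
Variable v : vectors.
Hypothesis indep : forall i, \rank (pair_rows v i) = r.

Lemma block_rows_free i : \rank (block_rows v i) = r.
Proof.
have nz k : exists p, v k i p != 0.
  apply: contrapT => /forallNP v0.
  have free : row_free (pair_rows v i) by rewrite /row_free indep.
  have : delta_mx 0 k *m pair_rows v i = 0 :> 'rV_(n * n).
    rewrite -rowE; apply/rowP => u; rewrite !mxE.
    have /negP := v0 (mxtens_unindex u).1.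
    by rewrite negbK => /eqP->; rewrite mul0r.
  move=> /eqP; rewrite (mulmx_free_eq0 _ free) => /eqP/rowP/(_ k).
  by rewrite !mxE !eqxx => /eqP; rewrite oner_eq0.
have /choice[p vp] := nz.
pose D : 'M[C]_(r * n, r) := \matrix_(u, k)
  ((u == mxtens_index (k, p k))%:R / v k i (p k)).
have BD : block_rows v i *m D = 1%:M.
  apply/matrixP => k l; rewrite !mxE (bigD1 (mxtens_index (l, p l))) //=.
  rewrite !mxE mxtens_indexK /= eqxx big1 ?addr0 => [|u ul].
    by case: (eqVneq l k) => [->|_]; rewrite ?mul0r // !mul1r divff.
  by rewrite !mxE (negbTE ul) mul0r mulr0.
by apply/eqP; rewrite eqn_leq rank_leq_row -[X in (X <= _)%N](mxrank1 C r) -BD mxrankM_maxl.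
Qed.

(** For a decomposition into rank one terms, each term yields one relation in
    each of the tests, and these relations are independent. *)
Lemma pair_rows_apolar : apolar 0 (pair_rows v).
Proof.
split=> [||i|i|]; first exact: indep; first by move=> i; rewrite sub0mx.
- rewrite -[X in (_ - X)%N](block_rows_free i) leq_subRL ?rank_leq_col //.
  apply: mulmx0_rank_max.
  by rewrite /skew_left mulmxA block_rows_mul mulmxBr mulmx1 triple_rows_swap13 subrr.
- rewrite -[X in (_ - X)%N](block_rows_free (i + 1)) leq_subRL ?rank_leq_col //.
  apply: mulmx0_rank_max.
  by rewrite /skew_right mulmxA block_rows_mul mulmxBr mulmx1 triple_rows_swap23 subrr.
- pose D := row_mx (block_rows v (1 + 1)) (row_mx (- block_rows v 0) (- block_rows v 1)).
  have rD : \rank D = r.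
    apply/eqP; rewrite eqn_leq rank_leq_row -[X in (X <= _)%N](block_rows_free (1 + 1)).
    have -> : block_rows v (1 + 1) = D *m col_mx 1%:M (col_mx 0 0).
      by rewrite !mul_row_col mulmx1 !mulmx0 !addr0.
    exact: mxrankM_maxl.
  have -> : (3 * (r * n) = r * n + (r * n + r * n))%N by rewrite !mulSn mul0n addn0.
  rewrite -[X in (_ - X)%N]rD leq_subRL ?rank_leq_col //; apply: mulmx0_rank_max.
  have e0 : 1 + 1 + 1 = 0 :> 'I_3 by apply/val_inj.
  rewrite /cube /pairwise_diff /D !mul_row_col !mul_mx_row !mulNmx !mulmx0 !mulmxA.
  rewrite !block_rows_mul !triple_rows_rot3 e0.
  have -> : 0 + 1 = 1 :> 'I_3 by apply/val_inj.
  rewrite !add_row_mx !oppr0 !add0r !addr0 !subrr.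
  exact: row_mx0.
Qed.

End Independent.

(** Moving every vector a little towards distinct basis vectors makes the
    pairs independent: the relevant minor is a polynomial in the inverse of the
    displacement, equal to 1 at the origin. *)
Lemma perturb_independent (e : 'I_r -> 'I_3 -> 'I_n) (v : vectors) (eps : C) :
  (forall i, injective (fun k => (e k i, e k (i + 1)))) -> 0 < eps ->
  exists2 v' : vectors, forall i, \rank (pair_rows v' i) = r &
    forall p q s, `|rank_one_sum v' 0 p q s - rank_one_sum v 0 p q s| < eps.
Proof.
move=> einj eps0.
pose v' (t : nat) : vectors := fun k i p => v k i p + t%:R^-1 * (p == e k i)%:R.
have near_rank : \forall t \near \oo, forall i, \rank (pair_rows (v' t) i) = r.
  apply: filter_forall => i.
  have [f fE] : exists f : 'I_r -> 'I_(n * n), forall k, mxtens_unindex (f k) = (e k i, e k (i + 1)).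
    by exists (fun k => mxtens_index (e k i, e k (i + 1))) => k; rewrite mxtens_indexK.
  pose V j k (l : 'I_r) : {poly C} := 'X * (v k j (e l j))%:P + (e l j == e k j)%:R.
  pose M : 'M[{poly C}]_r := \matrix_(k, l) (V i k l * V (i + 1) k l).
  have M0 : \det M != 0.
    suff : (\det M).[0] != 0 by apply: contraNneq => ->; rewrite horner0.
    rewrite -[_.[0]]/(horner_eval 0 (\det M)) -det_map_mx.
    rewrite (_ : map_mx _ _ = 1%:M) ?det1 ?oner_neq0 //.
    apply/matrixP => k l; rewrite !mxE /= /horner_eval /V hornerM !hornerD !hornerM !hornerX.
    rewrite !mul0r !add0r -!polyC_natr !hornerC -natrM mulnb -xpair_eqE.
    by rewrite (inj_eq (einj i)) eq_sym.
  apply: filterS2 (near_horner_neq0 M0) (nbhs_infty_gt 0) => t Mt t0.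
  have tn0 : t%:R != 0 :> C by rewrite pnatr_eq0 -lt0n.
  apply/eqP; rewrite eqn_leq rank_leq_row /=.
  apply: leq_trans (rank_colsub f _).
  rewrite -(@eqmx_scale _ _ _ (t%:R ^+ 2)) ?expf_neq0 //.
  rewrite (_ : _ *: _ = map_mx (horner_eval t%:R) M).
    by rewrite mxrank_unit // unitmxE det_map_mx unitfE.
  apply/matrixP => k l; rewrite !mxE fE /= /horner_eval hornerM !hornerD !hornerM !hornerX !hornerC.
  rewrite -!polyC_natr !hornerC /v' /=; field.
  exact: tn0.
have cvg_sum p q s : (fun t => rank_one_sum (v' t) 0 p q s : C^o) @ \oo -->
    (rank_one_sum v 0 p q s : C^o).
  have cv k i x : (fun t => v' t k i x : C^o) @ \oo --> (v k i x : C^o).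
    rewrite -[v k i x]addr0 -[X in _ + X](mul0r (x == e k i)%:R).
    apply: cvgD; first exact: cvg_cst.
    by apply: cvgM; [exact: cvg_natinv | exact: cvg_cst].
  by apply: cvg_bigsum => k _; apply: cvgM; [apply: cvgM|]; apply: cv.
have near_eps : \forall t \near \oo, forall pqs : 'I_n * 'I_n * 'I_n,
    `|rank_one_sum (v' t) 0 pqs.1.1 pqs.1.2 pqs.2 - rank_one_sum v 0 pqs.1.1 pqs.1.2 pqs.2| < eps.
  apply: filter_forall => -[[p q] s] /=.
  have /cvgrPdist_lt/(_ _ eps0) := cvg_sum p q s.
  by apply: filterS => t; rewrite distrC.
have [t [rt et]] := filter_ex (filterI near_rank near_eps).
by exists (v' t) => // p q s; exact: (et (p, q, s)).
Qed.

(** The vectors [e] only serve to perturb the given decompositions into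
    independent ones. *)
Theorem border_apolarity (e : 'I_r -> 'I_3 -> 'I_n) (T : 'I_n -> 'I_n -> 'I_n -> C)
    (v : nat -> vectors) :
  (forall i, injective (fun k => (e k i, e k (i + 1)))) ->
  (forall p q s, T p q s = T q s p) ->
  (forall p q s, (fun t => rank_one_sum (v t) 0 p q s : C^o) @ \oo --> (T p q s : C^o)) ->
  exists E : 'I_3 -> 'M[C]_(r, n * n), apolar (flat T) E.
Proof.
move=> einj cycT vT.
have /choice[w wP] (t : nat) : exists w : vectors, (forall i, \rank (pair_rows w i) = r) /\
    forall p q s, `|rank_one_sum w 0 p q s - rank_one_sum (v t) 0 p q s| < t.+1%:R^-1.
  have eps0 : 0 < t.+1%:R^-1 :> C by rewrite invr_gt0 ltr0Sn.
  by have [w w1 w2] := perturb_independent (v t) einj eps0; exists w.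
have wT p q s : (fun t => rank_one_sum (w t) 0 p q s : C^o) @ \oo --> (T p q s : C^o).
  have err : (fun t => rank_one_sum (w t) 0 p q s - rank_one_sum (v t) 0 p q s : C^o) @ \oo --> (0 : C^o).
    have invS : (fun t : nat => t.+1%:R^-1 : C^o) @ \oo --> (0 : C^o).
      by rewrite (cvg_shiftS (fun t => t%:R^-1 : C^o)); exact: cvg_natinv.
    apply/cvgrPdist_lt => eps eps0.
    have /cvgrPdist_lt/(_ _ eps0) := invS; apply: filterS => t.
    rewrite !sub0r !normrN ger0_norm ?invr_ge0 ?ler0n //.
    by move=> lt_eps; apply: lt_trans lt_eps; exact: (wP t).2.
  have -> : (fun t => rank_one_sum (w t) 0 p q s) = (fun t => (rank_one_sum (w t) 0 p q s -
      rank_one_sum (v t) 0 p q s) + rank_one_sum (v t) 0 p q s).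
    by apply/funext => t; rewrite subrK.
  by rewrite -[T p q s]add0r; exact: (cvgD err (vT p q s)).
have [U [UU oU]] := ultraFilterLemma (eventually_filter : ProperFilter \oo).
have /choice[GL GLP] (i : 'I_3) : exists GL : (nat -> 'M[C]_r) * 'M[C]_(r, n * n),
    [/\ forall t, GL.1 t \in unitmx, \rank GL.2 = r &
        mxcvg U (fun t => GL.1 t *m pair_rows (w t) i) GL.2].
  have rw t : \rank (pair_rows (w t) i) = r by case: (wP t).
  by have [G [L GL]] := ultra_limit_subspace UU rw; exists (G, L).
pose L i := (GL i).2; exists L.
have rL i : \rank (L i) = r by case: (GLP i).
have apoE t : apolar 0 (fun i => (GL i).1 t *m pair_rows (w t) i).
  have uG i : (GL i).1 t \in unitmx by case: (GLP i).
  have [rw _] := wP t.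
  exact: (@degen_basis _ _ _ _ (apolar_degenerable r 0) _ (fun i => (GL i).1 t) uG
    (pair_rows_apolar rw)).
have cvL i : mxcvg U (fun t => (GL i).1 t *m pair_rows (w t) i) (L i) by case: (GLP i).
have [_ _ h1 h2 h3] : apolar 0 L.
  apply: (@degen_limit _ _ _ _ (apolar_degenerable r 0) U _
    (fun t i => (GL i).1 t *m pair_rows (w t) i) L) => //.
  by near=> t.
split=> // i.
have wTi (j : nat) p q s : (fun t => rank_one_sum (w t) j%:R p q s : C^o) @ \oo --> (T p q s : C^o).
  elim: j p q s => [|j IH] p q s; first exact: wT.
  rewrite -natr1 -cycT.
  have -> : (fun t => rank_one_sum (w t) (j%:R + 1) p q s) =
            (fun t => rank_one_sum (w t) j%:R s p q).
    by apply/funext => t; rewrite rank_one_sum_rot.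
  exact: IH.
have cvS : mxcvg U (fun t => flat (rank_one_sum (w t) i)) (flat T).
  move=> s u; rewrite mxE; under eq_fun do rewrite mxE.
  by move=> A /(wTi i); rewrite natr_Zp; exact: oU.
apply: (sub_limit _ _ cvS (cvL i) (rL i)); near=> t.
case: (wP t) => rw _; case: (GLP i) => uG _ _.
split; first by rewrite eqmxMfull ?row_full_unit.
by rewrite eqmxMfull ?row_full_unit ?flat_sub.
Unshelve. all: by end_near. Qed.

End BorderApolarity.

(** * Subspaces stable under a diagonal matrix *)

Section Graded.
Variables (F : fieldType) (n : nat).

Definition coord_proj (P : pred 'I_n) : 'M[F]_n := diag_mx (\row_u (P u)%:R).

Lemma mul_coord_proj m (M : 'M[F]_(m, n)) P i u :
  (M *m coord_proj P) i u = M i u * (P u)%:R.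
Proof. by rewrite mul_mx_diag !mxE. Qed.

Definition color_proj (T : eqType) (col : 'I_n -> T) (c : T) :=
  coord_proj (fun u => col u == c).

Definition list_proj (T : eqType) (col : 'I_n -> T) (S : seq T) :=
  coord_proj (fun u => col u \in S).

Lemma diag_horner (d : 'rV[F]_n) r (E : 'M_(r, n)) (p : {poly F}) :
  (E *m diag_mx d <= E)%MS -> (E *m diag_mx (map_mx (fun x => p.[x]) d) <= E)%MS.
Proof.
move=> Ed; elim/poly_ind: p => [|p c IH].
  have -> : diag_mx (map_mx (fun x : F => (0 : {poly F}).[x]) d) = 0.
    by apply/matrixP => i j; rewrite !mxE horner0 mul0rn.
  by rewrite mulmx0 sub0mx.
have -> : diag_mx (map_mx (fun x => (p * 'X + c%:P).[x]) d) =
    diag_mx (map_mx (fun x => p.[x]) d) *m diag_mx d + c%:M.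
  apply/matrixP => i j; rewrite mul_diag_mx !mxE hornerD hornerMX hornerC mulrnDl mulrnAr.
  by case: (eqVneq i j) => [->|_]; rewrite ?mulr1n ?mulr0n.
rewrite mulmxDr mulmxA mul_mx_scalar addmx_sub ?scalemx_sub //.
by rewrite (submx_trans _ Ed) // submxMr.
Qed.

(** Lagrange interpolation turns stability under a diagonal matrix into
    stability under the projections onto its eigenspaces. *)
Lemma eigen_proj_sub (d : 'rV[F]_n) r (E : 'M_(r, n)) (x : F) :
  (E *m diag_mx d <= E)%MS -> (E *m color_proj (d 0) x <= E)%MS.
Proof.
move=> Ed; pose vs := [seq y <- [seq d 0 u | u : 'I_n] | y != x].
pose p : {poly F} := \prod_(y <- vs) ((x - y)^-1 *: ('X - y%:P)).
suff -> : color_proj (d 0) x = diag_mx (map_mx (fun z => p.[z]) d).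
  exact: diag_horner.
congr diag_mx; apply/rowP => u; rewrite !mxE horner_prod.
case: eqVneq => [->|dx].
  rewrite big_seq big1 // => y; rewrite mem_filter => /andP[yx _].
  by rewrite hornerZ hornerXsubC mulVf // subr_eq0 eq_sym.
have dvs : d 0 u \in vs by rewrite mem_filter dx map_f // mem_enum.
by rewrite (big_rem _ dvs) /= hornerZ hornerXsubC subrr mulr0 mul0r.
Qed.

Lemma coord_proj_id (P : pred 'I_n) m (v : 'M[F]_(m, n)) :
  (forall i u, ~~ P u -> v i u = 0) -> v *m coord_proj P = v.
Proof.
move=> v0; apply/matrixP => i u; rewrite mul_coord_proj.
by case: (boolP (P u)) => [_|/v0->]; rewrite ?mulr1 ?mul0r.
Qed.

Lemma rank_graded (I : finType) (col : 'I_n -> I) r (E : 'M[F]_(r, n)) :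
  (forall c, (E *m color_proj col c <= E)%MS) ->
  \rank E = (\sum_c \rank (E *m color_proj col c))%N.
Proof.
move=> gE.
have split_cons c S (M : 'M[F]_(r, n)) : c \notin S ->
    M *m list_proj col (c :: S) =
    M *m color_proj col c + M *m list_proj col S.
  move=> cS; apply/matrixP => i u; rewrite [RHS]mxE !mul_coord_proj -mulrDr inE.
  by case: eqVneq => [->|_]; rewrite ?(negbTE cS) ?addr0 ?add0r.
have absorb (P Q : pred 'I_n) m (M : 'M[F]_(m, n)) : subpred P Q ->
    (M *m coord_proj P <= M)%MS -> (M *m coord_proj P <= M *m coord_proj Q)%MS.
  move=> PQ /submxP[D MP].
  have -> : M *m coord_proj P = D *m (M *m coord_proj Q).
    rewrite mulmxA -MP [RHS]coord_proj_id // => i u Qu; rewrite mul_coord_proj.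
    by rewrite (negbTE (contra (PQ u) Qu)) mulr0.
  exact: submxMl.
have key (S : seq I) : uniq S -> (E *m list_proj col S <= E)%MS /\
    (\rank (E *m list_proj col S) =
     \sum_(c <- S) \rank (E *m color_proj col c))%N.
  elim: S => [_|c S IH /= /andP[cS uS]].
    rewrite big_nil (_ : list_proj _ _ = 0) ?mulmx0 ?mxrank0 ?sub0mx //.
    by apply/matrixP => i j; rewrite !mxE mul0rn.
  have [subS rkS] := IH uS.
  have subcS : (E *m list_proj col (c :: S) <= E)%MS.
    by rewrite split_cons // addmx_sub.
  split=> //; rewrite big_cons -rkS -mxrank_disjoint_sum.
    apply: eqmx_rank; apply/andP; split.
      by rewrite split_cons // addmx_sub_adds.
    rewrite addsmx_sub; apply/andP; split.
      by apply: absorb (gE c) => u /= cu; rewrite inE cu.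
    by apply: absorb subS => u /= cu; rewrite inE cu orbT.
  apply/eqP; rewrite -submx0; apply/rV_subP => v; rewrite sub_capmx => /andP[].
  move=> /submxP[a ->] /submxP[b ab]; rewrite submx0; apply/eqP/rowP => u.
  rewrite mulmxA mul_coord_proj [RHS]mxE.
  case: (eqVneq (col u) c) => cu; last by rewrite mulr0.
  move/rowP/(_ u): ab; rewrite !mulmxA !mul_coord_proj cu eqxx (negbTE cS) mulr0.
  exact.
have [_] := key (index_enum I) (index_enum_uniq I); move <-.
congr (\rank _); rewrite coord_proj_id // => i u.
by rewrite mem_index_enum.
Qed.

End Graded.

(** * Ranks of sparse integer matrices *)

Section Certificates.
Local Open Scope nat_scope.

(** A vector as a list of pairs of a coordinate and a coefficient; repeated
    coordinates are allowed and add up. *)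
Definition sparse := seq (N * Z).

Definition entry (c : N) (v : sparse) : Z :=
  foldr (fun x s => if N.eqb x.1 c then Z.add x.2 s else s) Z0 v.

Definition smap (a : Z) (v : sparse) : sparse := [seq (x.1, Z.mul a x.2) | x <- v].

Definition scons (k : N) (z : Z) (v : sparse) : sparse :=
  if Z.eqb z 0 then v else (k, z) :: v.

Fixpoint comb (a : Z) (v : sparse) (b : Z) : sparse -> sparse :=
  match v with
  | [::] => smap b
  | x :: v' => fix aux (w : sparse) : sparse :=
      match w with
      | [::] => smap a v
      | y :: w' => match N.compare x.1 y.1 with
        | Lt => (x.1, Z.mul a x.2) :: comb a v' b w
        | Eq => scons x.1 (Z.add (Z.mul a x.2) (Z.mul b y.2)) (comb a v' b w')
        | Gt => (y.1, Z.mul b y.2) :: aux w'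
        end
      end
  end.

Definition clear (c : N) (a : Z) (r s : sparse) : sparse :=
  let g := entry c s in if Z.eqb g 0 then s else comb a s (- g) r.

Definition pivot (n : N) (v : sparse) : option (N * Z) :=
  ohead [seq x <- [seq (x.1, entry x.1 v) | x <- v] | N.ltb x.1 n && ~~ Z.eqb x.2 0].

(** A pair (v, w) stands for x v + y w with unknown nonzero x and y.  Such a
    vector certainly has a nonzero coordinate where exactly one of v and w has
    one, whatever x and y are. *)
Definition pure_pivot (n : N) (v : sparse * sparse) (vs : seq (sparse * sparse)) : option N :=
  ohead [seq c <- [seq x.1 | x <- v.1 ++ v.2] |
    [&& N.ltb c n, Z.eqb (entry c v.1) 0 != Z.eqb (entry c v.2) 0 &
        all (fun w => Z.eqb (entry c w.1) 0 && Z.eqb (entry c w.2) 0) vs]].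

Fixpoint pure_rank (n : N) (vs : seq (sparse * sparse)) : nat :=
  if vs is v :: vs' then
    if pure_pivot n v vs' is Some _ then (pure_rank n vs').+1 else pure_rank n vs'
  else 0.

(** A lower bound for the rank of the vectors [rs] together with the pairs [vs]:
    Gaussian elimination without divisions on the former, then a count of the
    pairs that are certainly independent of the rest. *)
Fixpoint elim_rank (fuel : nat) (n : N) (rs : seq sparse) (vs : seq (sparse * sparse)) : nat :=
  if fuel isn't f.+1 then 0 else
  if rs is r :: rs' then
    if pivot n r is Some (c, a) then
      (elim_rank f n [seq clear c a r s | s <- rs']
        [seq (if Z.eqb (entry c v.1) 0 && Z.eqb (entry c v.2) 0 then v else
           (comb a v.1 (- entry c v.1) r, comb a v.2 (- entry c v.2) r)) | v <- vs]).+1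
    else elim_rank f n rs' vs
  else pure_rank n vs.

Definition sort_sparse (v : sparse) : sparse :=
  foldr (fun x w => comb 1 [:: x] 1 w) [::] v.

Local Open Scope N_scope.

Definition nines : seq N := [:: 0; 1; 2; 3; 4; 5; 6; 7; 8].
Definition threes : seq N := [:: 0; 1; 2].

(** Coordinates of products of two or three factors are numbered in base 9; the
    rows of [skew_left] and [skew_right] given by a vector v and a basis vector
    x of the extra factor. *)
Definition left_row (v : sparse) (x : N) : sparse :=
  sort_sparse ([seq (9 * y.1 + x, y.2) | y <- v] ++
    [seq (9 * (9 * x + y.1 mod 9) + y.1 / 9, Z.opp y.2) | y <- v]).
Definition right_row (v : sparse) (x : N) : sparse :=
  sort_sparse ([seq (9 * y.1 + x, y.2) | y <- v] ++
    [seq (9 * (9 * (y.1 / 9) + x) + y.1 mod 9, Z.opp y.2) | y <- v]).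

(** The basis vector (i, j) (x) (j', k) in base 3.  The indices (i, k) are the
    cell, and (j, j') is a position in the 3 x 3 matrix carried by the cell. *)
Definition vec (i j j' k : N) : N := 27 * i + 9 * j + 3 * j' + k.

Definition offdiag : seq (N * N) := [:: (2,0); (1,0); (2,1); (0,1); (1,2); (0,2)].

(** A code describes a subspace of a cell that is graded by the torus: which
    elementary matrices off the diagonal it contains, the dimension of its
    diagonal part modulo the identity, and whether the first two ([al]),
    respectively the last two ([ar]), diagonal coordinates agree on it. *)
Definition code := (seq bool * nat * (bool * bool))%type.
Definition Code (bl : seq bool) (d : nat) (a b : bool) : code := (bl, d, (a, b)).
Definition bits (c : code) := c.1.1.
Definition diag (c : code) := c.1.2.
Definition al (c : code) := c.2.1.
Definition ar (c : code) := c.2.2.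

Definition bit (c : code) (n : nat) := nth false (bits c) n.

Definition bools := [:: false; true].
Definition bitlists : seq (seq bool) :=
  foldr (fun _ ls => allpairs cons bools ls) [:: nil] offdiag.

(** The effect of the two simple raising operators inside a cell: they lead
    from (0, 2) to (0, 1) and (1, 2), from there to the differences of
    consecutive diagonal units, from the diagonal to (1, 0) and (2, 1), and from
    there to (2, 0). *)
Definition valid (c : code) : bool :=
  [&& bit c 1 ==> bit c 0, bit c 2 ==> bit c 0,
      (bit c 3 || bit c 4) ==> ~~ al c && ~~ ar c,
      bit c 5 ==> bit c 3 && bit c 4,
      al c || bit c 1, ar c || bit c 2,
      (diag c == 0%nat) == (al c && ar c) &
      (diag c == 2%nat) ==> ~~ al c && ~~ ar c].

Definition dimc (c : code) : nat := (count id (bits c) + diag c)%nat.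

(** Nine of the sixteen dimensions are taken by the identities of the cells, so
    that seven are left to distribute. *)
Definition codes : seq code :=
  [seq c <- [seq Code p.1 p.2 q.1 q.2 |
      p <- [seq (bl, d) | bl <- bitlists, d <- iota 0%nat 3%nat],
      q <- [seq (x, y) | x <- bools, y <- bools]] | valid c && (dimc c <= 7)%nat].

Definition le_code (c d : code) : bool :=
  [&& all2 implb (bits c) (bits d), (diag c <= diag d)%nat, al d ==> al c & ar d ==> ar c].

Definition code0 := Code nil 0%nat true true.

(** Cells are listed in the order (0, 2), (0, 1), (0, 0), (1, 2) and so on:
    raising the first index or the last one leads from a cell to the one that
    comes three places, respectively one place, earlier. *)
Definition admissible (cs : seq code) (c : code) : bool :=
  let n := size cs in
  [&& (n %% 3 != 0)%nat ==> le_code c (nth code0 cs (n - 1)),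
      (3 <= n)%nat ==> le_code c (nth code0 cs (n - 3)) &
      (sumn (map dimc cs) + dimc c <= 7)%nat].

Fixpoint check_arrays (fuel : nat) (P : seq code -> bool) (cs : seq code) : bool :=
  if fuel is f.+1 then
    all (fun c => if admissible cs c then check_arrays f P (rcons cs c) else true) codes
  else if (sumn (map dimc cs) == 7)%nat then P cs else true.

Definition cells : seq (N * N) := [seq (i, k) | i <- threes, k <- [:: 2; 1; 0]].

Definition unit_vec (k : N) : sparse := [:: (k, Z.pos 1)].

Definition id_vec (i k : N) : sparse :=
  [:: (vec i 0 0 k, Z.pos 1); (vec i 1 1 k, Z.pos 1); (vec i 2 2 k, Z.pos 1)].

(** Vectors that every subspace with the given code contains.  When the
    diagonal part has dimension 2, it is spanned by the identity and one corner
    as soon as two consecutive coordinates agree. *)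
Definition gens_cell (ik : N * N) (c : code) : seq sparse :=
  let v j j' := vec ik.1 j j' ik.2 in
  [:: id_vec ik.1 ik.2] ++
  [seq unit_vec (v p.1 p.2) | p <- mask (bits c) offdiag] ++
  (if (diag c == 2%nat) || (diag c == 1%nat) && al c then [:: unit_vec (v 2 2)] else [::]) ++
  (if (diag c == 2%nat) || (diag c == 1%nat) && ar c then [:: unit_vec (v 0 0)] else [::]).

Definition gens (cs : seq code) : seq sparse :=
  flatten [seq gens_cell p.1 p.2 | p <- zip cells cs].

(** When the diagonal part of the cell (0, 2) has dimension 2 and no two
    consecutive coordinates agree, it contains diag (x + y, y, 0) for some
    nonzero x and y that the code does not determine. *)
Definition lin_gens (cs : seq code) : seq (sparse * sparse) :=
  let c := nth code0 cs 0%nat in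
  if (diag c == 1%nat) && ~~ al c && ~~ ar c then
    [:: ([:: (vec 0 0 0 2, Z.pos 1)], [:: (vec 0 0 0 2, Z.pos 1); (vec 0 1 1 2, Z.pos 1)])]
  else [::].

Definition test_rank (row : sparse -> N -> sparse) (cs : seq code) : nat :=
  let rs := [seq row v x | v <- gens cs, x <- nines] in
  elim_rank (size rs).+1 729 rs
    [seq (row v.1 x, row v.2 x) | v <- lin_gens cs, x <- nines].

(** The diagonal part fits when the bound allows everything, when it consists of
    scalars, or when both have the direction of the same corner. *)
Definition within (ub : code) (c : code) :=
  all2 implb (bits c) (bits ub) && [|| diag ub == 2%nat, diag c == 0%nat,
     [&& diag ub == 1%nat, al ub & al c] | [&& diag ub == 1%nat, ar ub & ar c]].

Definition full_cell := Code [:: true; true; true; true; true; true] 2%nat false false.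
Definition corner_cell := Code [:: true; false; false; false; false; false] 0%nat true true.
Definition scalar_cell := Code [:: false; false; false; false; false; false] 0%nat true true.
Definition corner_cell_al := Code [:: true; false; true; false; false; false] 1%nat true false.
Definition corner_cell_ar := Code [:: true; true; false; false; false; false] 1%nat false true.

Definition bound_a := [:: full_cell; corner_cell; scalar_cell;
  corner_cell_al; scalar_cell; scalar_cell; scalar_cell; scalar_cell; scalar_cell].
Definition bound_b := [:: full_cell; corner_cell_ar; scalar_cell;
  corner_cell; scalar_cell; scalar_cell; scalar_cell; scalar_cell; scalar_cell].

(** The number 128 = 16 * 9 - 16 is the largest rank that the symmetry
    conditions allow in dimension 16. *)
Definition array_ok (cs : seq code) : bool :=
  if all2 within bound_a cs then true else
  if all2 within bound_b cs then true else
  if (128 < test_rank left_row cs)%nat then true else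
  (128 < test_rank right_row cs)%nat.

(** Rows of [cube]: coordinates from 729 on belong to the second copy of the
    space of triples. *)
Definition cube_row0 (v : sparse) (x : N) : sparse :=
  sort_sparse ([seq (9 * y.1 + x, y.2) | y <- v] ++ [seq (729 + (9 * y.1 + x), y.2) | y <- v]).
Definition cube_row1 (v : sparse) (x : N) : sparse :=
  sort_sparse [seq (81 * x + y.1, y.2) | y <- v].
Definition cube_row2 (v : sparse) (x : N) : sparse :=
  sort_sparse [seq (729 + (9 * (9 * (y.1 mod 9) + x) + y.1 / 9), y.2) | y <- v].

Definition cube_rank (V0 V1 V2 : seq sparse) : nat :=
  let rs := [seq cube_row1 v x | v <- V1, x <- nines] ++
    [seq cube_row2 v x | v <- V2, x <- nines] ++ [seq cube_row0 v x | v <- V0, x <- nines] in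
  elim_rank (size rs).+1 1458 rs [::].

Definition bounds := [:: gens bound_a; gens bound_b].

(** The constant is the smallest one that makes the final count a
    contradiction. *)
Definition cubes_ok :=
  all (fun a => all (fun b => all (fun c => (552 <= cube_rank a b c)%nat) bounds) bounds) bounds.

End Certificates.

(** * Soundness of the elimination *)

Section SparseSemantics.
Variable F : numFieldType.

Definition zf (z : Z) : F := (int_of_Z z)%:~R.

Lemma zfD a b : zf (Z.add a b) = zf a + zf b.
Proof. by rewrite /zf -intrD -rmorphD. Qed.

Lemma zfM a b : zf (Z.mul a b) = zf a * zf b.
Proof. by rewrite /zf -intrM -rmorphM. Qed.

Lemma zfN a : zf (Z.opp a) = - zf a.
Proof. by rewrite /zf -[RHS]mulrNz -rmorphN. Qed.

Lemma zf_eq0 a : (zf a == 0) = Z.eqb a 0.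
Proof.
rewrite /zf intr_eq0; case: Z.eqb_spec => [->|]; first by rewrite rmorph0 eqxx.
by move=> a0; apply/eqP => e0; apply: a0; rewrite -[a]int_of_ZK e0.
Qed.

Definition den n (v : sparse) : 'rV[F]_n := \row_u zf (entry (bin_of_nat u) v).

Lemma entry_smap c a v : entry c (smap a v) = Z.mul a (entry c v).
Proof.
elim: v => [|[k z] v IH] /=; first by rewrite Z.mul_0_r.
by rewrite IH; case: N.eqb; rewrite ?Z.mul_add_distr_l.
Qed.

Lemma entry_scons c k z v :
  entry c (scons k z v) = if N.eqb k c then Z.add z (entry c v) else entry c v.
Proof. by rewrite /scons; case: Z.eqb_spec => [->|_] //=; case: ifP. Qed.

Lemma entry_comb c a v b w :
  entry c (comb a v b w) = Z.add (Z.mul a (entry c v)) (Z.mul b (entry c w)).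
Proof.
elim: v w => [|[k z] v IH] w; first by rewrite /= entry_smap Z.mul_0_r.
elim: w => [|[l y] w IHw]; first by rewrite -/(smap a ((k, z) :: v)) entry_smap /= Z.mul_0_r Z.add_0_r.
rewrite /=; case: N.compare_spec => kl /=.
- by rewrite entry_scons IH /= kl; case: N.eqb; rewrite ?Z.mul_add_distr_l; lia.
- by rewrite IH /=; case: N.eqb; case: N.eqb; rewrite ?Z.mul_add_distr_l; lia.
- by rewrite /= in IHw; rewrite IHw; case: N.eqb; case: N.eqb; rewrite ?Z.mul_add_distr_l; lia.
Qed.

Lemma entry_sort c v : entry c (sort_sparse v) = entry c v.
Proof.
elim: v => [|[k z] v IH] //.
have -> : sort_sparse ((k, z) :: v) = comb 1 [:: (k, z)] 1 (sort_sparse v) by [].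
rewrite entry_comb IH !Z.mul_1_l.
by rewrite /=; case: N.eqb; rewrite ?Z.add_0_r.
Qed.

Lemma den_comb n a v b w : den n (comb a v b w) = zf a *: den n v + zf b *: den n w.
Proof. by apply/rowP => u; rewrite !mxE entry_comb zfD !zfM. Qed.

(** Imposing the vanishing of a coordinate that does not vanish on the row
    space loses one dimension. *)
Lemma vanishing_part m n (M : 'M[F]_(m, n)) (r : 'rV_n) (c : 'I_n) :
  (r <= M)%MS -> r 0 c != 0 -> exists M' : 'M_n,
    (\rank M' < \rank M)%N /\ forall s : 'rV_n, (s <= M)%MS -> s 0 c = 0 -> (s <= M')%MS.
Proof.
move=> rM rc; pose D : 'cV[F]_n := delta_mx c 0.
have cD (s : 'rV_n) : (s <= kermx D)%MS = (s 0 c == 0).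
  rewrite sub_kermx -colE; apply/eqP/eqP => [/matrixP/(_ 0 0)|s0]; first by rewrite !mxE.
  by apply/matrixP => i j; rewrite !mxE !ord1.
exists (M :&: kermx D)%MS; split=> [|s sM s0]; last by rewrite sub_capmx sM cD s0 eqxx.
have : (M :&: kermx D < M)%MS.
  rewrite ltmxE capmxSl /=; apply: contra rc => sub.
  by rewrite -cD (submx_trans rM) // (submx_trans sub) // capmxSr.
by rewrite ltmxErank => /andP[].
Qed.

Definition lin n (x y : F) (v : sparse * sparse) : 'rV[F]_n :=
  x *: den n v.1 + y *: den n v.2.

Lemma pure_rank_le m n (M : 'M[F]_(m, n)) (N : N) x y vs :
  nat_of_bin N = n -> x != 0 -> y != 0 ->
  (forall v, v \in vs -> (lin n x y v <= M)%MS) ->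
  (pure_rank N vs <= \rank M)%N.
Proof.
move=> Nn x0 y0; elim: vs m M => [//|v vs IH] m M vsM /=.
case pv : pure_pivot => [c|]; last by apply: IH => w wvs; apply: vsM; rewrite inE wvs orbT.
have [cN ev evs] : [/\ N.ltb c N, Z.eqb (entry c v.1) 0 != Z.eqb (entry c v.2) 0 &
    all (fun w => Z.eqb (entry c w.1) 0 && Z.eqb (entry c w.2) 0) vs].
  move: pv; rewrite /pure_pivot; set l := [seq _ | x <- _ ++ _].
  elim: l => [//|d l IHl] /=; case: ifP => [/and3P[? ? ?] [<-]//|_]; exact: IHl.
have cn : (nat_of_bin c < n)%N by move/N.ltb_spec0: cN; lia.
have binc : bin_of_nat (Ordinal cn) = c by rewrite /= nat_of_binK.
have linc w : lin n x y w 0 (Ordinal cn) = x * zf (entry c w.1) + y * zf (entry c w.2).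
  by rewrite !mxE binc.
have va : lin n x y v 0 (Ordinal cn) != 0.
  move: ev; rewrite linc -!zf_eq0.
  case: (eqVneq (zf (entry c v.1)) 0) => [->|e1];
    case: (eqVneq (zf (entry c v.2)) 0) => [->|e2] // _.
    by rewrite mulr0 add0r mulf_neq0.
  by rewrite mulr0 addr0 mulf_neq0.
have [M' [rM' sM']] := vanishing_part (vsM _ (mem_head _ _)) va.
apply: leq_trans rM'; rewrite ltnS; apply: IH => w wvs.
apply: sM'; first by apply: vsM; rewrite inE wvs orbT.
move/allP/(_ w wvs): evs.
by rewrite linc -!zf_eq0 => /andP[/eqP-> /eqP->]; rewrite !mulr0 addr0.
Qed.

Lemma elim_rank_le fuel m n (M : 'M[F]_(m, n)) (N : N) x y rs vs :
  nat_of_bin N = n -> x != 0 -> y != 0 ->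
  (forall r, r \in rs -> (den n r <= M)%MS) ->
  (forall v, v \in vs -> (lin n x y v <= M)%MS) ->
  (elim_rank fuel N rs vs <= \rank M)%N.
Proof.
move=> Nn x0 y0; elim: fuel m M rs vs => [//|f IH] m M [|r rs] vs rsM vsM /=.
  exact: (pure_rank_le Nn x0 y0).
case pv : pivot => [[c a]|]; last by apply: IH => // s srs; apply: rsM; rewrite inE srs orbT.
have [cN ac a0] : [/\ N.ltb c N, a = entry c r & ~~ Z.eqb a 0].
  move: pv; rewrite /pivot; set l := (X in [seq _ | x <- X]); move: l => l.
  elim: l => [//|[k z] l IHl] /=; case: ifP => [/andP[kN e0]|_]; last exact: IHl.
  by move=> /= [<- <-].
have cn : (nat_of_bin c < n)%N by move/N.ltb_spec0: cN; lia.
have binc : bin_of_nat (Ordinal cn) = c by rewrite /= nat_of_binK.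
have denc s : den n s 0 (Ordinal cn) = zf (entry c s) by rewrite !mxE binc.
have rM : (den n r <= M)%MS by apply: rsM; exact: mem_head.
have zfa : zf a != 0 by rewrite zf_eq0.
have ra : den n r 0 (Ordinal cn) != 0 by rewrite denc -ac.
have [M' [rM' sM']] := vanishing_part rM ra.
apply: leq_trans rM'; rewrite ltnS; apply: IH.
- move=> _ /mapP[s srs ->]; rewrite /clear.
  have sM : (den n s <= M)%MS by apply: rsM; rewrite inE srs orbT.
  case: Z.eqb_spec => [s0|_]; apply: sM' => //.
  + by rewrite denc s0 /zf rmorph0.
  + by rewrite den_comb addmx_sub ?scalemx_sub.
  + by rewrite denc entry_comb -ac zfD !zfM zfN mulNr mulrC subrr.
- move=> _ /mapP[v vvs ->].
  have vM : (lin n x y v <= M)%MS by apply: vsM.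
  have linc w : lin n x y w 0 (Ordinal cn) = x * zf (entry c w.1) + y * zf (entry c w.2).
    by rewrite !mxE binc.
  case: ifP => [/andP[/Z.eqb_spec e1 /Z.eqb_spec e2]|_]; apply: sM' => //.
  + by rewrite linc e1 e2 /zf rmorph0 !mulr0 addr0.
  + rewrite /lin /= !den_comb.
    have -> : x *: (zf a *: den n v.1 + zf (- entry c v.1) *: den n r) +
              y *: (zf a *: den n v.2 + zf (- entry c v.2) *: den n r) =
              zf a *: lin n x y v + (x * zf (- entry c v.1) + y * zf (- entry c v.2)) *: den n r.
      by rewrite /lin !scalerDr !scalerA scalerDl addrACA ![zf a * _]mulrC.
    by rewrite addmx_sub ?scalemx_sub.
  + rewrite linc /= !entry_comb !zfD !zfM !zfN -ac ![zf a * _]mulrC !mulNr !subrr.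
    by rewrite !mulr0 addr0.
Qed.

End SparseSemantics.

(** * Rows of the test matrices *)

Section Columns.
Local Open Scope N_scope.

Lemma bin_of_natE (m : nat) : bin_of_nat m = N.of_nat m.
Proof. lia. Qed.

Lemma divmod9 (k : N) : exists a b : N,
  [/\ k = 9 * a + b, b < 9, k / 9 = a & k mod 9 = b].
Proof.
exists (k / 9), (k mod 9); split=> //; first exact: N.div_mod'.
exact: N.mod_lt.
Qed.

Section Keys.
Variables (p q z : nat) (k x : N).
Hypotheses (p9 : (p < 9)%N) (q9 : (q < 9)%N) (z9 : (z < 9)%N) (x9 : x < 9) (k81 : k < 81).

Lemma key_last :
  N.eqb (9 * k + x) (bin_of_nat ((p * 9 + q) * 9 + z)) =
  N.eqb x (bin_of_nat z) && N.eqb k (bin_of_nat (p * 9 + q)).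
Proof.
rewrite !bin_of_natE.
apply/N.eqb_spec/andP => [e|[/N.eqb_spec e1 /N.eqb_spec e2]]; last by lia.
by split; apply/N.eqb_spec; lia.
Qed.

Lemma key_first :
  N.eqb (81 * x + k) (bin_of_nat ((p * 9 + q) * 9 + z)) =
  N.eqb x (bin_of_nat p) && N.eqb k (bin_of_nat (q * 9 + z)).
Proof.
rewrite !bin_of_natE.
apply/N.eqb_spec/andP => [e|[/N.eqb_spec e1 /N.eqb_spec e2]]; last by lia.
have ex : x = N.of_nat p by lia.
by split; apply/N.eqb_spec; lia.
Qed.

Lemma key_swap13 :
  N.eqb (9 * (9 * x + k mod 9) + k / 9) (bin_of_nat ((p * 9 + q) * 9 + z)) =
  N.eqb x (bin_of_nat p) && N.eqb k (bin_of_nat (z * 9 + q)).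
Proof.
rewrite !bin_of_natE; have [a [b [kE b9 -> ->]]] := divmod9 k.
have a9 : a < 9 by lia.
rewrite kE; apply/N.eqb_spec/andP => [e|[/N.eqb_spec e1 /N.eqb_spec e2]].
  have ea : a = N.of_nat z by lia.
  have ex : x = N.of_nat p by lia.
  by split; apply/N.eqb_spec; lia.
have ea : a = N.of_nat z by lia.
have eb : b = N.of_nat q by lia.
lia.
Qed.

Lemma key_swap23 :
  N.eqb (9 * (9 * (k / 9) + x) + k mod 9) (bin_of_nat ((p * 9 + q) * 9 + z)) =
  N.eqb x (bin_of_nat q) && N.eqb k (bin_of_nat (p * 9 + z)).
Proof.
rewrite !bin_of_natE; have [a [b [kE b9 -> ->]]] := divmod9 k.
have a9 : a < 9 by lia.
rewrite kE; apply/N.eqb_spec/andP => [e|[/N.eqb_spec e1 /N.eqb_spec e2]].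
  have eb : b = N.of_nat z by lia.
  have ex : x = N.of_nat q by lia.
  by split; apply/N.eqb_spec; lia.
have ea : a = N.of_nat p by lia.
have eb : b = N.of_nat z by lia.
lia.
Qed.

Lemma key_rot :
  N.eqb (9 * (9 * (k mod 9) + x) + k / 9) (bin_of_nat ((p * 9 + q) * 9 + z)) =
  N.eqb x (bin_of_nat q) && N.eqb k (bin_of_nat (z * 9 + p)).
Proof.
rewrite !bin_of_natE; have [a [b [kE b9 -> ->]]] := divmod9 k.
have a9 : a < 9 by lia.
rewrite kE; apply/N.eqb_spec/andP => [e|[/N.eqb_spec e1 /N.eqb_spec e2]].
  have ea : a = N.of_nat z by lia.
  have ex : x = N.of_nat q by lia.
  by split; apply/N.eqb_spec; lia.
have ea : a = N.of_nat z by lia.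
have eb : b = N.of_nat p by lia.
lia.
Qed.

End Keys.

Lemma entry_cat c v w : entry c (v ++ w) = Z.add (entry c v) (entry c w).
Proof. by elim: v => [|[k z] v IH] //=; rewrite IH; case: N.eqb; lia. Qed.

Definition small_keys (v : sparse) := all (fun y => N.ltb y.1 81) v.

Lemma entry_map (f : N -> N) c (b : bool) d (v : sparse) :
  small_keys v -> (forall k, k < 81 -> N.eqb (f k) c = b && N.eqb k d) ->
  entry c [seq (f y.1, y.2) | y <- v] = if b then entry d v else Z0.
Proof.
move=> + fE; elim: v => [|[k z] v IH] /=; first by case: b {fE}.
case/andP => /N.ltb_spec0 k81 /IH ->; rewrite fE //.
by case: b {fE IH} => //=.
Qed.

Lemma entry_map_opp (f : N -> N) c (v : sparse) :
  entry c [seq (f y.1, Z.opp y.2) | y <- v] = Z.opp (entry c [seq (f y.1, y.2) | y <- v]).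
Proof. by elim: v => [|[k z] v IH] //=; rewrite IH; case: N.eqb; lia. Qed.

End Columns.

Section TestRows.
Variable F : numFieldType.
Local Notation n := 9%N.

Lemma idx3_val (p q z : 'I_n) : idx3 p q z = ((p * 9 + q) * 9 + z)%N :> nat.
Proof. by []. Qed.

Lemma eqb_ord (x : N) (i : 'I_n) (x9 : (nat_of_bin x < 9)%N) :
  N.eqb x (bin_of_nat i) = (i == Ordinal x9).
Proof.
rewrite bin_of_natE; apply/N.eqb_spec/eqP => [e|->]; last by rewrite /=; lia.
by apply/val_inj => /=; lia.
Qed.

Lemma small_index x : N.lt x 9 -> (nat_of_bin x < 9)%N.
Proof. lia. Qed.

Lemma zf0 : zf F Z0 = 0.
Proof. by []. Qed.

Lemma zf_if (b : bool) (k : Z) : zf F (if b then k else Z0) = b%:R * zf F k.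
Proof. by case: b; rewrite ?mul1r // mul0r zf0. Qed.

Lemma den_tens v (o : 'I_n) p q z :
  (den F (n * n) v *t (delta_mx 0 o : 'rV_n)) 0 (idx3 p q z) =
  (z == o)%:R * zf F (entry (bin_of_nat (p * 9 + q)) v).
Proof.
rewrite mxE !mxtens_indexK [X in X * _]mxE [X in _ * X]mxE /=.
by rewrite mulrC.
Qed.

Lemma left_row_eq v x (x9 : (nat_of_bin x < 9)%N) : small_keys v -> N.lt x 9 ->
  (den F (n * n * n) (left_row v x) : 'M_(1 * 1, n * n * n)) =
  (den F (n * n) v *t (delta_mx 0 (Ordinal x9) : 'rV_n)) *m (1%:M - relabel F (@swap13 n)).
Proof.
move=> sv lx; rewrite mulmxBr mulmx1 (mul_relabel _ (@swap13K n) (@swap13K n)).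
apply/rowP => u; rewrite [LHS]mxE [RHS]mxE [X in _ + X]mxE [X in - X]mxE.
case: (idx3P u) => p q z; rewrite /swap13 idx3K !den_tens /left_row /right_row entry_sort entry_cat.
rewrite (entry_map_opp (fun k => (9 * (9 * x + k mod 9) + k / 9)%num)).
rewrite (entry_map (f := fun k => (9 * k + x)%num) (b := N.eqb x (bin_of_nat z)) (d := bin_of_nat (p * 9 + q))) //; last first.
  by move=> k k81; rewrite idx3_val key_last.
rewrite (entry_map (f := fun k => (9 * (9 * x + k mod 9) + k / 9)%num)
  (b := N.eqb x (bin_of_nat p)) (d := bin_of_nat (z * 9 + q))) //; last first.
  by move=> k k81; rewrite idx3_val key_swap13.
by rewrite zfD zfN !zf_if !(eqb_ord _ x9).
Qed.

Lemma left_row_sub r (E : 'M[F]_(r, n * n)) a b v x :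
  small_keys v.1 -> small_keys v.2 -> N.lt x 9 ->
  (lin (n * n) a b v <= E)%MS ->
  (lin (n * n * n) a b (left_row v.1 x, left_row v.2 x) <= skew_left E)%MS.
Proof.
move=> s1 s2 x9 /submxP[D Dv]; pose o := Ordinal (small_index x9).
suff e : (lin (n * n * n) a b (left_row v.1 x, left_row v.2 x) : 'M_(1 * 1, n * n * n)) =
    (D *t (delta_mx 0 o : 'rV_n)) *m skew_left E.
  by have := submxMl (D *t (delta_mx 0 o : 'rV_n)) (skew_left E); rewrite -e.
rewrite /skew_left mulmxA tensmx_mul -Dv mulmx1.
rewrite /lin /= !(left_row_eq (small_index x9)) // tensmxDl !tensmxZl mulmxDl.
by rewrite -!scalemxAl.
Qed.

Lemma right_row_eq v x (x9 : (nat_of_bin x < 9)%N) : small_keys v -> N.lt x 9 ->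
  (den F (n * n * n) (right_row v x) : 'M_(1 * 1, n * n * n)) =
  (den F (n * n) v *t (delta_mx 0 (Ordinal x9) : 'rV_n)) *m (1%:M - relabel F (@swap23 n)).
Proof.
move=> sv lx; rewrite mulmxBr mulmx1 (mul_relabel _ (@swap23K n) (@swap23K n)).
apply/rowP => u; rewrite [LHS]mxE [RHS]mxE [X in _ + X]mxE [X in - X]mxE.
case: (idx3P u) => p q z; rewrite /swap23 idx3K !den_tens /left_row /right_row entry_sort entry_cat.
rewrite (entry_map_opp (fun k => (9 * (9 * (k / 9) + x) + k mod 9)%num)).
rewrite (entry_map (f := fun k => (9 * k + x)%num) (b := N.eqb x (bin_of_nat z)) (d := bin_of_nat (p * 9 + q))) //; last first.
  by move=> k k81; rewrite idx3_val key_last.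
rewrite (entry_map (f := fun k => (9 * (9 * (k / 9) + x) + k mod 9)%num)
  (b := N.eqb x (bin_of_nat q)) (d := bin_of_nat (p * 9 + z))) //; last first.
  by move=> k k81; rewrite idx3_val key_swap23.
by rewrite zfD zfN !zf_if !(eqb_ord _ x9).
Qed.

Lemma right_row_sub r (E : 'M[F]_(r, n * n)) a b v x :
  small_keys v.1 -> small_keys v.2 -> N.lt x 9 ->
  (lin (n * n) a b v <= E)%MS ->
  (lin (n * n * n) a b (right_row v.1 x, right_row v.2 x) <= skew_right E)%MS.
Proof.
move=> s1 s2 x9 /submxP[D Dv]; pose o := Ordinal (small_index x9).
suff e : (lin (n * n * n) a b (right_row v.1 x, right_row v.2 x) : 'M_(1 * 1, n * n * n)) =
    (D *t (delta_mx 0 o : 'rV_n)) *m skew_right E.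
  by have := submxMl (D *t (delta_mx 0 o : 'rV_n)) (skew_right E); rewrite -e.
rewrite /skew_right mulmxA tensmx_mul -Dv mulmx1.
rewrite /lin /= !(right_row_eq (small_index x9)) // tensmxDl !tensmxZl mulmxDl.
by rewrite -!scalemxAl.
Qed.

Lemma lshift_val m1 m2 (w : 'I_m1) : nat_of_ord (lshift m2 w) = w.
Proof. by []. Qed.

Lemma rshift_val m1 m2 (w : 'I_m2) : nat_of_ord (rshift m1 w) = (m1 + w)%N.
Proof. by []. Qed.

Lemma bin_shift (k : N) (u : nat) : (u < 729)%N ->
  N.eqb (729 + k)%num (bin_of_nat (n * n * n + u)) = N.eqb k (bin_of_nat u) /\
  N.eqb (729 + k)%num (bin_of_nat u) = false.
Proof.
move=> u729; rewrite !bin_of_natE; split; last by apply/N.eqb_spec; lia.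
by apply/N.eqb_spec/N.eqb_spec; lia.
Qed.

Lemma bin_below (k : N) (u : nat) : N.lt k 729 -> N.eqb k (bin_of_nat (n * n * n + u)) = false.
Proof. by move=> k729; rewrite bin_of_natE; apply/N.eqb_spec; lia. Qed.

Lemma idx3_lt (p q z : 'I_n) : ((p * 9 + q) * 9 + z < 729)%N.
Proof. by case: p q z => [p p9] [q q9] [z z9] /=; lia. Qed.

Lemma cube_row0_sub r0 r1 r2 (V0 : 'M[F]_(r0, n * n)) (V1 : 'M_(r1, n * n)) (V2 : 'M_(r2, n * n))
    v x : small_keys v -> N.lt x 9 -> (den F (n * n) v <= V0)%MS ->
  (den F (n * n * n + n * n * n) (cube_row0 v x) <= cube V0 V1 V2)%MS.
Proof.
move=> sv x9 /submxP[D Dv]; pose o := Ordinal (small_index x9).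
pose M : 'M_(1 * 1, n * n * n) := den F (n * n) v *t (delta_mx 0 o : 'rV_n).
have <- : row_mx M M = den F (n * n * n + n * n * n) (cube_row0 v x).
  apply/rowP => u; rewrite [RHS]mxE /cube_row0 entry_sort entry_cat.
  case: (split_ordP u) => w ->; rewrite ?row_mxEl ?row_mxEr ?lshift_val ?rshift_val;
    case: (idx3P w) => p q z; rewrite idx3_val den_tens.
  - rewrite (entry_map (f := fun k => (9 * k + x)%num)
      (b := N.eqb x (bin_of_nat z)) (d := bin_of_nat (p * 9 + q))) //; last first.
      by move=> k k81; rewrite key_last.
    rewrite (entry_map (f := fun k => (729 + (9 * k + x))%num) (b := false) (d := N0)) //; last first.
      by move=> k k81; rewrite (bin_shift _ (idx3_lt p q z)).2.
    by rewrite Z.add_0_r zf_if (eqb_ord _ (small_index x9)).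
  - rewrite (entry_map (f := fun k => (9 * k + x)%num) (b := false) (d := N0)) //; last first.
      by move=> k k81; rewrite bin_below //; lia.
    rewrite (entry_map (f := fun k => (729 + (9 * k + x))%num)
      (b := N.eqb x (bin_of_nat z)) (d := bin_of_nat (p * 9 + q))) //; last first.
      by move=> k k81; rewrite (bin_shift _ (idx3_lt p q z)).1 key_last.
    by rewrite Z.add_0_l zf_if (eqb_ord _ (small_index x9)).
have e : row_mx M M = (D *t (delta_mx 0 o : 'rV_n)) *m
    row_mx (V0 *t (1%:M : 'M_n)) (V0 *t (1%:M : 'M_n)).
  by rewrite mul_mx_row tensmx_mul mulmx1 -Dv.
rewrite /cube /pairwise_diff -addsmxE; apply: submx_trans (addsmxSl _ _).
by apply/submxP; exists (D *t (delta_mx 0 o : 'rV_n)); exact: e.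
Qed.

Lemma cube_row1_sub r0 r1 r2 (V0 : 'M[F]_(r0, n * n)) (V1 : 'M_(r1, n * n)) (V2 : 'M_(r2, n * n))
    v x : small_keys v -> N.lt x 9 -> (den F (n * n) v <= V1)%MS ->
  (den F (n * n * n + n * n * n) (cube_row1 v x) <= cube V0 V1 V2)%MS.
Proof.
move=> sv x9 /submxP[D Dv]; pose o := Ordinal (small_index x9).
pose M : 'M_(1 * 1, n * n * n) :=
  (den F (n * n) v *t (delta_mx 0 o : 'rV_n)) *m relabel F (@rot3 n).
have <- : row_mx M 0 = den F (n * n * n + n * n * n) (cube_row1 v x).
  apply/rowP => u; rewrite [RHS]mxE /cube_row1 entry_sort.
  case: (split_ordP u) => w ->; rewrite ?row_mxEl ?row_mxEr ?lshift_val ?rshift_val;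
    case: (idx3P w) => p q z; rewrite idx3_val.
  - rewrite /M (mul_relabel _ (@rot3_inv n) (@rot3K n)) mxE /rot3 !idx3K den_tens.
    rewrite (entry_map (f := fun k => (81 * x + k)%num)
      (b := N.eqb x (bin_of_nat p)) (d := bin_of_nat (q * 9 + z))) //; last first.
      by move=> k k81; rewrite key_first.
    by rewrite zf_if (eqb_ord _ (small_index x9)).
  - rewrite mxE (entry_map (f := fun k => (81 * x + k)%num) (b := false) (d := N0)) //.
    by move=> k k81; rewrite bin_below //; lia.
have e : row_mx M (0 : 'M_(1 * 1, n * n * n)) = (D *t (delta_mx 0 o : 'rV_n)) *m
    row_mx (V1 *t (1%:M : 'M_n) *m relabel F (@rot3 n)) (0 : 'M_(r1 * n, n * n * n)).
  by rewrite [RHS]mul_mx_row mulmx0 mulmxA tensmx_mul mulmx1 -Dv.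
rewrite /cube /pairwise_diff -addsmxE; apply: submx_trans (addsmxSr _ _).
rewrite -addsmxE; apply: submx_trans (addsmxSl _ _).
by apply/submxP; exists (D *t (delta_mx 0 o : 'rV_n)); exact: e.
Qed.

Lemma cube_row2_sub r0 r1 r2 (V0 : 'M[F]_(r0, n * n)) (V1 : 'M_(r1, n * n)) (V2 : 'M_(r2, n * n))
    v x : small_keys v -> N.lt x 9 -> (den F (n * n) v <= V2)%MS ->
  (den F (n * n * n + n * n * n) (cube_row2 v x) <= cube V0 V1 V2)%MS.
Proof.
move=> sv x9 /submxP[D Dv]; pose o := Ordinal (small_index x9).
pose M : 'M_(1 * 1, n * n * n) :=
  (den F (n * n) v *t (delta_mx 0 o : 'rV_n)) *m relabel F (@rot3 n) *m relabel F (@rot3 n).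
have <- : row_mx 0 M = den F (n * n * n + n * n * n) (cube_row2 v x).
  apply/rowP => u; rewrite [RHS]mxE /cube_row2 entry_sort.
  case: (split_ordP u) => w ->; rewrite ?row_mxEl ?row_mxEr ?lshift_val ?rshift_val;
    case: (idx3P w) => p q z; rewrite idx3_val.
  - rewrite mxE (entry_map (f := fun k => (729 + (9 * (9 * (k mod 9) + x) + k / 9))%num)
      (b := false) (d := N0)) //.
    by move=> k k81; rewrite (bin_shift _ (idx3_lt p q z)).2.
  - rewrite /M !(mul_relabel _ (@rot3_inv n) (@rot3K n)) mxE mxE /rot3 !idx3K den_tens.
    rewrite (entry_map (f := fun k => (729 + (9 * (9 * (k mod 9) + x) + k / 9))%num)
      (b := N.eqb x (bin_of_nat q)) (d := bin_of_nat (z * 9 + p))) //; last first.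
      by move=> k k81; rewrite (bin_shift _ (idx3_lt p q z)).1 key_rot.
    by rewrite zf_if (eqb_ord _ (small_index x9)).
have e : row_mx (0 : 'M_(1 * 1, n * n * n)) M = (D *t (delta_mx 0 o : 'rV_n)) *m
    row_mx (0 : 'M_(r2 * n, n * n * n)) (V2 *t (1%:M : 'M_n) *m relabel F (@rot3 n) *m relabel F (@rot3 n)).
  by rewrite [RHS]mul_mx_row mulmx0 !mulmxA tensmx_mul mulmx1 -Dv.
rewrite /cube /pairwise_diff -addsmxE; apply: submx_trans (addsmxSr _ _).
rewrite -addsmxE; apply: submx_trans (addsmxSr _ _).
by apply/submxP; exists (D *t (delta_mx 0 o : 'rV_n)); exact: e.
Qed.

End TestRows.

(** * Subspaces closed under the raising operators *)

Definition o0 : 'I_3 := @Ordinal 3 0 isT.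
Definition o1 : 'I_3 := @Ordinal 3 1 isT.
Definition o2 : 'I_3 := @Ordinal 3 2 isT.

Variant o3_spec : 'I_3 -> Type := O3_0 : o3_spec o0 | O3_1 : o3_spec o1 | O3_2 : o3_spec o2.

Lemma o3P i : o3_spec i.
Proof.
by case: i => -[|[|[|//]]] p; [rewrite (_ : Ordinal p = o0) | rewrite (_ : Ordinal p = o1)
  | rewrite (_ : Ordinal p = o2)]; do ?[constructor | exact/val_inj].
Qed.

Section Positions.
Variable F : numFieldType.
Local Notation rows := 'rV[F]_(9 * 9).

Definition pos (i j j' k : 'I_3) : 'I_(9 * 9) :=
  @mxtens_index 9 9 (@mxtens_index 3 3 (i, j), @mxtens_index 3 3 (j', k)).

Definition unpos (u : 'I_(9 * 9)) : 'I_3 * 'I_3 * ('I_3 * 'I_3) :=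
  let v := @mxtens_unindex 9 9 u in
  (@mxtens_unindex 3 3 v.1, @mxtens_unindex 3 3 v.2).

Lemma posK i j j' k : unpos (pos i j j' k) = (i, j, (j', k)).
Proof. by rewrite /unpos /pos !mxtens_indexK. Qed.

Variant pos_spec : 'I_(9 * 9) -> Type := Pos i j j' k : pos_spec (pos i j j' k).

Lemma posP u : pos_spec u.
Proof.
case: (@mxtens_indexP 9 9 u) => p q.
by case: (@mxtens_indexP 3 3 p) => i j; case: (@mxtens_indexP 3 3 q) => j' k.
Qed.

Lemma pos_eq i j j' k a b b' c :
  (pos i j j' k == pos a b b' c) = [&& i == a, j == b, j' == b' & k == c].
Proof.
have inj : injective (fun x : 'I_3 * 'I_3 * ('I_3 * 'I_3) => pos x.1.1 x.1.2 x.2.1 x.2.2).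
  by move=> [[? ?] [? ?]] [[? ?] [? ?]] /(congr1 unpos); rewrite !posK.
by rewrite (inj_eq inj (_, _, (_, _)) (_, _, (_, _))) !xpair_eqE !andbA.
Qed.

Definition at4 (v : rows) i j j' k := v 0 (pos i j j' k).

Definition row4 (f : 'I_3 -> 'I_3 -> 'I_3 -> 'I_3 -> F) : rows :=
  \row_u f (unpos u).1.1 (unpos u).1.2 (unpos u).2.1 (unpos u).2.2.

Lemma row4E f i j j' k : at4 (row4 f) i j j' k = f i j j' k.
Proof. by rewrite /at4 mxE posK. Qed.

Lemma row4P (v w : rows) : (forall i j j' k, at4 v i j j' k = at4 w i j j' k) -> v = w.
Proof. by move=> vw; apply/rowP => u; case: (posP u) => i j j' k; apply: vw. Qed.

Definition e4 i j j' k : rows := delta_mx 0 (pos i j j' k).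

Lemma e4E i j j' k a b b' c :
  at4 (e4 i j j' k) a b b' c = [&& a == i, b == j, b' == j' & c == k]%:R.
Proof. by rewrite /at4 mxE eqxx /= pos_eq. Qed.

Lemma at4D v w i j j' k : at4 (v + w) i j j' k = at4 v i j j' k + at4 w i j j' k.
Proof. by rewrite /at4 mxE. Qed.

Lemma at4Z c v i j j' k : at4 (c *: v) i j j' k = c * at4 v i j j' k.
Proof. by rewrite /at4 mxE. Qed.

Lemma at4N v i j j' k : at4 (- v) i j j' k = - at4 v i j j' k.
Proof. by rewrite /at4 mxE. Qed.

(** The matrix diag (x, y, z) in the cell (i, k). *)
Definition diag4 i k (x y z : F) : rows :=
  x *: e4 i o0 o0 k + y *: e4 i o1 o1 k + z *: e4 i o2 o2 k.

Lemma diag4E i k x y z a b b' c : at4 (diag4 i k x y z) a b b' c =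
  [&& a == i, b == b' & c == k]%:R * (if b == o0 then x else if b == o1 then y else z).
Proof.
rewrite /diag4 !at4D !at4Z !e4E.
by case: (a == i); case: (c == k); case: (o3P b); case: (o3P b'); rewrite /=; ring.
Qed.

(** The elementary matrix sending a to b acts on the indices of a space V of the
    three; which operator results depends on whether V is the outer space on the
    left, the one on the right, where it acts dually, or the middle space, where
    both actions occur. *)
Definition first_op (a b : 'I_3) (v : rows) : rows :=
  row4 (fun i j j' k => (i == b)%:R * at4 v a j j' k).
Definition last_op (a b : 'I_3) (v : rows) : rows :=
  row4 (fun i j j' k => (k == a)%:R * at4 v i j j' b).
Definition mid_op (a b : 'I_3) (v : rows) : rows :=
  row4 (fun i j j' k => (j' == b)%:R * at4 v i j a k - (j == a)%:R * at4 v i b j' k).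

Definition simple_roots : seq ('I_3 * 'I_3) := [:: (o1, o0); (o2, o1)].

Definition cell_proj (i k : 'I_3) : 'M[F]_(9 * 9) :=
  coord_proj F (fun u => u \in [:: pos i o0 o0 k; pos i o1 o1 k; pos i o2 o2 k]).

Lemma mul_cell_proj (v : rows) i k :
  v *m cell_proj i k = diag4 i k (at4 v i o0 o0 k) (at4 v i o1 o1 k) (at4 v i o2 o2 k).
Proof.
apply: row4P => a b b' c; rewrite diag4E /at4 mul_coord_proj !inE !pos_eq mulrC.
case: (eqVneq a i) => [->|_] //=; last by rewrite !mul0r.
case: (eqVneq c k) => [->|_] //=; last by rewrite !andbF !mul0r.
by case: (o3P b); case: (o3P b'); rewrite /= ?mul1r ?mul0r.
Qed.

Definition offdiag3 : seq ('I_3 * 'I_3) :=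
  [:: (o2, o0); (o1, o0); (o2, o1); (o0, o1); (o1, o2); (o0, o2)].

Section Raising.
Variable r : nat.

(** What is known of a subspace fixed by the Borel subgroup: it contains the
    slices of the tensor, it is closed under the simple raising operators, and
    it is graded.  The last three fields express the grading by the torus, whose
    weight spaces are the elementary matrices off the diagonal and the diagonal
    parts of the cells. *)
Record raising (E : 'M[F]_(r, 9 * 9)) : Prop := Raising {
  raising_id : forall i k, (diag4 i k 1 1 1 <= E)%MS;
  raising_first : forall ab, ab \in simple_roots -> forall v : rows,
    (v <= E)%MS -> (first_op ab.1 ab.2 v <= E)%MS;
  raising_last : forall ab, ab \in simple_roots -> forall v : rows,
    (v <= E)%MS -> (last_op ab.1 ab.2 v <= E)%MS;
  raising_mid : forall ab, ab \in simple_roots -> forall v : rows,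
    (v <= E)%MS -> (mid_op ab.1 ab.2 v <= E)%MS;
  raising_off : forall i k j j' (v : rows), j != j' ->
    (v <= E)%MS -> (at4 v i j j' k *: e4 i j j' k <= E)%MS;
  raising_diag : forall i k (v : rows), (v <= E)%MS -> (v *m cell_proj i k <= E)%MS;
  raising_rank : \rank E = (\sum_(i < 3) \sum_(k < 3)
    (\sum_(p <- offdiag3) (e4 i p.1 p.2 k <= E)%MS + \rank (E *m cell_proj i k)))%N }.

Variable E : 'M[F]_(r, 9 * 9).
Hypothesis rE : raising E.

Let root10 : (o1, o0) \in simple_roots. Proof. by []. Qed.
Let root21 : (o2, o1) \in simple_roots. Proof. by []. Qed.

Definition al4 i k : bool := [forall s, E s (pos i o0 o0 k) == E s (pos i o1 o1 k)].
Definition ar4 i k : bool := [forall s, E s (pos i o1 o1 k) == E s (pos i o2 o2 k)].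

Lemma coord_eqP (u w : 'I_(9 * 9)) :
  reflect (forall v : rows, (v <= E)%MS -> v 0 u = v 0 w) [forall s, E s u == E s w].
Proof.
apply: (iffP forallP) => [Euw v /submxP[D ->]|vuw s].
  by rewrite !mxE; apply: eq_bigr => s _; rewrite (eqP (Euw s)).
by have := vuw (row s E) (row_sub s E); rewrite !mxE => ->.
Qed.

Lemma al4P i k : reflect (forall v : rows, (v <= E)%MS -> at4 v i o0 o0 k = at4 v i o1 o1 k)
  (al4 i k).
Proof. exact: coord_eqP. Qed.

Lemma ar4P i k : reflect (forall v : rows, (v <= E)%MS -> at4 v i o1 o1 k = at4 v i o2 o2 k)
  (ar4 i k).
Proof. exact: coord_eqP. Qed.

Lemma not_al4 i k : ~~ al4 i k -> exists2 v : rows, (v <= E)%MS & at4 v i o0 o0 k != at4 v i o1 o1 k.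
Proof. by move=> /forallPn[s ne]; exists (row s E); [exact: row_sub | rewrite /at4 !mxE]. Qed.

Lemma not_ar4 i k : ~~ ar4 i k -> exists2 v : rows, (v <= E)%MS & at4 v i o1 o1 k != at4 v i o2 o2 k.
Proof. by move=> /forallPn[s ne]; exists (row s E); [exact: row_sub | rewrite /at4 !mxE]. Qed.

Definition bit4 i k (p : 'I_3 * 'I_3) : bool := (e4 i p.1 p.2 k <= E)%MS.

Definition code4 i k : code :=
  Code [seq bit4 i k p | p <- offdiag3] (\rank (E *m cell_proj i k)).-1 (al4 i k) (ar4 i k).

Lemma eq_scale_sub (v w : rows) c : c != 0 -> (v <= E)%MS -> v = c *: w -> (w <= E)%MS.
Proof. by move=> c0 vE vw; rewrite -(eqmx_scale w c0) -vw. Qed.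

Lemma mid10_diag i k x y z : mid_op o1 o0 (diag4 i k x y z) = (y - x) *: e4 i o1 o0 k.
Proof.
apply: row4P => a b b' c; rewrite row4E !diag4E at4Z e4E.
by case: (a == i); case: (c == k); case: (o3P b); case: (o3P b'); rewrite /=; ring.
Qed.

Lemma mid21_diag i k x y z : mid_op o2 o1 (diag4 i k x y z) = (z - y) *: e4 i o2 o1 k.
Proof.
apply: row4P => a b b' c; rewrite row4E !diag4E at4Z e4E.
by case: (a == i); case: (c == k); case: (o3P b); case: (o3P b'); rewrite /=; ring.
Qed.

Lemma mid_e4 i k :
  [/\ mid_op o2 o1 (e4 i o1 o0 k) = (-1) *: e4 i o2 o0 k,
      mid_op o1 o0 (e4 i o2 o1 k) = 1 *: e4 i o2 o0 k,
      mid_op o1 o0 (e4 i o0 o1 k) = diag4 i k 1 (-1) 0,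
      mid_op o2 o1 (e4 i o1 o2 k) = diag4 i k 0 1 (-1) &
      mid_op o1 o0 (e4 i o0 o2 k) = (-1) *: e4 i o1 o2 k /\
      mid_op o2 o1 (e4 i o0 o2 k) = 1 *: e4 i o0 o1 k].
Proof.
split; last split; apply: row4P => a b b' c; rewrite row4E !e4E ?at4Z ?diag4E ?e4E;
  case: (a == i); case: (c == k); case: (o3P b); case: (o3P b'); rewrite /=; ring.
Qed.

Lemma cell_sub m (B : 'M[F]_(m, 9 * 9)) i k :
  (forall v : rows, (v <= E)%MS -> (v *m cell_proj i k <= B)%MS) ->
  (E *m cell_proj i k <= B)%MS.
Proof. by move=> sB; apply/row_subP => s; rewrite row_mul; apply: sB; exact: row_sub. Qed.

Lemma cell_le i k : (E *m cell_proj i k <= E)%MS.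
Proof. by apply: cell_sub => v; exact: (raising_diag rE). Qed.

Lemma id_cell i k : (diag4 i k 1 1 1 <= E *m cell_proj i k)%MS.
Proof.
have -> : diag4 i k 1 1 1 = diag4 i k 1 1 1 *m cell_proj i k.
  by rewrite mul_cell_proj !diag4E !eqxx /= !mul1r.
exact: submxMr (raising_id rE i k).
Qed.

Lemma diag4_neq0 i k x y z : (x != 0) || (y != 0) || (z != 0) -> diag4 i k x y z != 0.
Proof.
move=> xyz; apply/eqP => d0; move: xyz.
have e b : at4 (diag4 i k x y z) i b b k = 0 by rewrite d0 /at4 mxE.
move: (e o0) (e o1) (e o2); rewrite !diag4E !eqxx /= !mul1r => -> -> ->.
by rewrite eqxx.
Qed.

Lemma rank_cell_gt0 i k : (0 < \rank (E *m cell_proj i k))%N.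
Proof.
have := mxrankS (id_cell i k); rewrite rank_rV diag4_neq0 ?oner_neq0 //.
Qed.

Lemma rank_rowvec (v : rows) : (\rank v <= 1)%N.
Proof. exact: rank_leq_row. Qed.

Definition cell_span i k : 'M[F]_(9 * 9) := (e4 i o0 o0 k + (e4 i o1 o1 k + e4 i o2 o2 k))%MS.

Lemma rank_cell_span i k : (\rank (cell_span i k) <= 3)%N.
Proof.
apply: leq_trans (mxrank_adds_leqif _ _) _; rewrite (leq_add (rank_rowvec _)) //.
apply: leq_trans (mxrank_adds_leqif _ _) _; exact: leq_add (rank_rowvec _) (rank_rowvec _).
Qed.

Lemma cell_sub_span i k : (E *m cell_proj i k <= cell_span i k)%MS.
Proof.
apply: cell_sub => v _; rewrite mul_cell_proj /diag4 -addrA.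
by rewrite !addmx_sub_adds ?scalemx_sub.
Qed.

Lemma rank_cell_le3 i k : (\rank (E *m cell_proj i k) <= 3)%N.
Proof. exact: leq_trans (mxrankS (cell_sub_span i k)) (rank_cell_span i k). Qed.

Lemma al_rank_cell i k : al4 i k -> (\rank (E *m cell_proj i k) <= 2)%N.
Proof.
move=> /al4P alE; have : (E *m cell_proj i k <= diag4 i k 1 1 0 + e4 i o2 o2 k)%MS.
  apply: cell_sub => v vE; rewrite mul_cell_proj -(alE v vE).
  have -> : diag4 i k (at4 v i o0 o0 k) (at4 v i o0 o0 k) (at4 v i o2 o2 k) =
    at4 v i o0 o0 k *: diag4 i k 1 1 0 + at4 v i o2 o2 k *: e4 i o2 o2 k.
    by rewrite /diag4 !scalerDr !scalerA !mulr1 mulr0 scale0r addr0.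
  by rewrite addmx_sub_adds ?scalemx_sub.
move=> /mxrankS/leq_trans; apply.
by apply: leq_trans (mxrank_adds_leqif _ _) _; exact: leq_add (rank_rowvec _) (rank_rowvec _).
Qed.

Lemma ar_rank_cell i k : ar4 i k -> (\rank (E *m cell_proj i k) <= 2)%N.
Proof.
move=> /ar4P arE; have : (E *m cell_proj i k <= e4 i o0 o0 k + diag4 i k 0 1 1)%MS.
  apply: cell_sub => v vE; rewrite mul_cell_proj -(arE v vE).
  have -> : diag4 i k (at4 v i o0 o0 k) (at4 v i o1 o1 k) (at4 v i o1 o1 k) =
    at4 v i o0 o0 k *: e4 i o0 o0 k + at4 v i o1 o1 k *: diag4 i k 0 1 1.
    by rewrite /diag4 !scalerDr !scalerA !mulr1 mulr0 scale0r add0r addrA.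
  by rewrite addmx_sub_adds ?scalemx_sub.
move=> /mxrankS/leq_trans; apply.
by apply: leq_trans (mxrank_adds_leqif _ _) _; exact: leq_add (rank_rowvec _) (rank_rowvec _).
Qed.

Lemma al_ar_rank_cell i k : ((\rank (E *m cell_proj i k)).-1 == 0%N) = (al4 i k && ar4 i k).
Proof.
apply/idP/andP => [rk|[/al4P alE /ar4P arE]].
  have rk1 : \rank (E *m cell_proj i k) = 1%N.
    by move: rk (rank_cell_gt0 i k); case: (\rank _) => [|[|]].
  have sub : (E *m cell_proj i k <= diag4 i k 1 1 1)%MS.
    rewrite -(geq_leqif (mxrank_leqif_sup (id_cell i k))) rk1.
    by rewrite rank_rV diag4_neq0 ?oner_neq0.
  have eqs (v : rows) : (v <= E)%MS -> exists c, v *m cell_proj i k = c *: diag4 i k 1 1 1.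
    by move=> vE; apply/sub_rVP; exact: submx_trans (submxMr _ vE) sub.
  have at_cell (v : rows) b : at4 v i b b k = at4 (v *m cell_proj i k) i b b k.
    by rewrite mul_cell_proj diag4E !eqxx mul1r; case: (o3P b).
  split; [apply/al4P|apply/ar4P] => v /eqs[c vc].
    by rewrite (at_cell v o0) (at_cell v o1) vc !at4Z !diag4E !eqxx.
  by rewrite (at_cell v o1) (at_cell v o2) vc !at4Z !diag4E !eqxx.
have : (E *m cell_proj i k <= diag4 i k 1 1 1)%MS.
  apply: cell_sub => v vE; rewrite mul_cell_proj -(arE v vE) -(alE v vE).
  have -> : diag4 i k (at4 v i o0 o0 k) (at4 v i o0 o0 k) (at4 v i o0 o0 k) =
    at4 v i o0 o0 k *: diag4 i k 1 1 1 by rewrite /diag4 !scalerDr !scalerA !mulr1.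
  exact: scalemx_sub.
by move=> /mxrankS/leq_trans/(_ (rank_rowvec _)); case: (\rank _) => [|[|]].
Qed.

Lemma valid_code4 i k : valid (code4 i k).
Proof.
have mid := raising_mid rE.
have [m1 m2 m3 m4 [m5 m6]] := mid_e4 i k.
have N1 : (-1 : F) != 0 by rewrite oppr_eq0 oner_neq0.
have one_neqN1 : (1 : F) != -1 by rewrite -subr_eq0 opprK -[1 + 1]/(2%:R) pnatr_eq0.
have raise ab j j' w c : ab \in simple_roots -> c != 0 -> bit4 i k (j, j') ->
    mid_op ab.1 ab.2 (e4 i j j' k) = c *: w -> (w <= E)%MS.
  by move=> abr c0 bE e; apply: (eq_scale_sub c0 (mid _ abr _ bE)).
have h1 : bit4 i k (o0, o1) -> (diag4 i k 1 (-1) 0 <= E)%MS.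
  by move=> b; apply: (raise (o1, o0) _ _ _ 1 root10 (oner_neq0 F) b); rewrite scale1r.
have h2 : bit4 i k (o1, o2) -> (diag4 i k 0 1 (-1) <= E)%MS.
  by move=> b; apply: (raise (o2, o1) _ _ _ 1 root21 (oner_neq0 F) b); rewrite scale1r.
rewrite /valid /bit /code4 /bits /al /ar /diag /=; do ?[apply/andP; split].
- by apply/implyP => b; apply: (raise (o2, o1) _ _ _ (-1) root21 N1 b).
- by apply/implyP => b; apply: (raise (o1, o0) _ _ _ 1 root10 (oner_neq0 F) b).
- apply/implyP => /orP[/h1|/h2] dE; apply/andP; split.
  + apply: contra (one_neqN1) => /al4P/(_ _ dE); rewrite !diag4E !eqxx /= !mul1r.
    by move/eqP.
  + apply: contra N1 => /ar4P/(_ _ dE); rewrite !diag4E !eqxx /= !mul1r.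
    by move/eqP.
  + apply: contra (oner_neq0 F) => /al4P/(_ _ dE); rewrite !diag4E !eqxx /= !mul1r.
    by move/esym/eqP.
  + apply: contra (one_neqN1) => /ar4P/(_ _ dE); rewrite !diag4E !eqxx /= !mul1r.
    by move/eqP.
- apply/implyP => b; apply/andP; split.
    by apply: (raise (o2, o1) _ _ _ 1 root21 (oner_neq0 F) b).
  by apply: (raise (o1, o0) _ _ _ (-1) root10 N1 b).
- case: (boolP (al4 i k)) => //= /not_al4[v vE ne].
  apply: (@eq_scale_sub (mid_op o1 o0 (v *m cell_proj i k)) _
    (at4 v i o1 o1 k - at4 v i o0 o0 k)); first by rewrite subr_eq0 eq_sym.
    exact: (mid _ root10 _ (raising_diag rE _ _ vE)).
  by rewrite mul_cell_proj mid10_diag.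
- case: (boolP (ar4 i k)) => //= /not_ar4[v vE ne].
  apply: (@eq_scale_sub (mid_op o2 o1 (v *m cell_proj i k)) _
    (at4 v i o2 o2 k - at4 v i o1 o1 k)); first by rewrite subr_eq0 eq_sym.
    exact: (mid _ root21 _ (raising_diag rE _ _ vE)).
  by rewrite mul_cell_proj mid21_diag.
- by rewrite al_ar_rank_cell.
- apply/implyP => rk2; rewrite -negb_or; apply/negP => /orP[/al_rank_cell|/ar_rank_cell];
    by move: rk2; case: (\rank _) => [|[|[|]]].
Qed.

Definition diag_coords i k : 'M[F]_(r, 3) := \matrix_(s, j) E s (pos i j j k).

Lemma rank_diag_coords i k : \rank (E *m cell_proj i k) = \rank (diag_coords i k).
Proof.
apply/eqP; rewrite eqn_leq; apply/andP; split.
  have -> : E *m cell_proj i k = diag_coords i k *m (\matrix_j e4 i j j k).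
    apply/row_matrixP => s; rewrite !row_mul mul_cell_proj mulmx_sum_row !big_ord_recl big_ord0.
    rewrite addr0 !rowK addrA /diag4 /at4 !mxE.
    by congr (_ *: e4 _ _ _ _ + _ *: e4 _ _ _ _ + _ *: e4 _ _ _ _); do ?[exact/val_inj
       | congr (E _ (pos _ _ _ _)); exact/val_inj].
  exact: mxrankM_maxl.
have -> : diag_coords i k = (E *m cell_proj i k) *m (\matrix_(u, j) (u == pos i j j k)%:R).
  apply/matrixP => s j; rewrite !mxE (bigD1 (pos i j j k)) //= !mul_coord_proj !mxE eqxx mulr1.
  rewrite big1 ?addr0 => [|u uj]; last by rewrite !mxE (negbTE uj) mulr0.
  by rewrite !inE !pos_eq !eqxx /=; case: (o3P j); rewrite mulr1.
exact: mxrankM_maxl.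
Qed.

Lemma le_code_first a b k : (a, b) \in simple_roots -> le_code (code4 a k) (code4 b k).
Proof.
move=> ab; have first v vE := raising_first rE ab (v := v) vE.
rewrite /le_code /code4 /bits /diag /al /ar /=; apply/and4P; split.
- have bit_mono p : bit4 a k p ==> bit4 b k p.
    apply/implyP => /first; congr (_ <= _)%MS; apply: row4P => x y y' z; rewrite row4E !e4E.
    by rewrite eqxx -natrM mulnb.
  by rewrite !bit_mono.
- rewrite -!subn1 leq_sub2r // !rank_diag_coords; apply: mxrankS.
  apply/row_subP => s; have /submxP[D sD] := first _ (row_sub s E).
  apply/submxP; exists D; apply/rowP => j.
  move/rowP/(_ (pos b j j k)): sD; rewrite -/(at4 _ b j j k) row4E eqxx mul1r /at4 !mxE => ->.
  by apply: eq_bigr => t _; rewrite !mxE.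
- apply/implyP => /al4P alE; apply/al4P => v /first/alE; rewrite !row4E eqxx !mul1r; exact.
- apply/implyP => /ar4P arE; apply/ar4P => v /first/arE; rewrite !row4E eqxx !mul1r; exact.
Qed.

Lemma le_code_last a b i : (a, b) \in simple_roots -> le_code (code4 i b) (code4 i a).
Proof.
move=> ab; have last v vE := raising_last rE ab (v := v) vE.
rewrite /le_code /code4 /bits /diag /al /ar /=; apply/and4P; split.
- have bit_mono p : bit4 i b p ==> bit4 i a p.
    apply/implyP => /last; congr (_ <= _)%MS; apply: row4P => x y y' z; rewrite row4E !e4E.
    by rewrite eqxx -natrM mulnb andbT andbC -!andbA.
  by rewrite !bit_mono.
- rewrite -!subn1 leq_sub2r // !rank_diag_coords; apply: mxrankS.
  apply/row_subP => s; have /submxP[D sD] := last _ (row_sub s E).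
  apply/submxP; exists D; apply/rowP => j.
  move/rowP/(_ (pos i j j a)): sD; rewrite -/(at4 _ i j j a) row4E eqxx mul1r /at4 !mxE => ->.
  by apply: eq_bigr => t _; rewrite !mxE.
- apply/implyP => /al4P alE; apply/al4P => v /last/alE; rewrite !row4E eqxx !mul1r; exact.
- apply/implyP => /ar4P arE; apply/ar4P => v /last/arE; rewrite !row4E eqxx !mul1r; exact.
Qed.

End Raising.
End Positions.

(** * Classification of the closed subspaces of dimension 16 *)

(** The search prunes by a condition on the initial segments; an array whose
    segments all satisfy it is reached. *)
Lemma check_arraysP f (P : seq code -> bool) cs l :
  check_arrays f P cs -> size l = f -> {subset l <= codes} ->
  (forall m, (m < size l)%N -> admissible (cs ++ take m l) (nth code0 l m)) ->
  sumn (map dimc (cs ++ l)) = 7%N -> P (cs ++ l).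
Proof.
elim: f cs l => [|f IH] cs [|c l] chk // sl sub adm sum7.
  by rewrite cats0 in sum7 *; move: chk; rewrite /check_arrays sum7.
have cc : c \in codes by apply: sub; exact: mem_head.
have chkc : (if admissible cs c then check_arrays f P (rcons cs c) else true).
  exact: (@allP _ _ codes chk c cc).
have := adm 0%N isT; rewrite take0 cats0 => admc; rewrite admc in chkc.
rewrite -cat_rcons; apply: (IH _ l chkc); last by rewrite cat_rcons.
- by case: sl.
- by move=> x xl; apply: sub; rewrite inE xl orbT.
- by move=> m ml; have := adm m.+1 ml; rewrite cat_rcons.
Qed.

Lemma mem_codes bl d (a b : bool) : size bl = 6%N -> (d < 3)%N ->
  valid (Code bl d a b) -> (dimc (Code bl d a b) <= 7)%N -> Code bl d a b \in codes.
Proof.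
move=> sbl d3 v d7; rewrite /codes mem_filter v d7 andTb.
apply/allpairsP; exists ((bl, d), (a, b)); split; last by [].
  apply/allpairsP; exists (bl, d); split; [|by rewrite mem_iota|by []].
  case: bl sbl {v d7} => [|b0 [|b1 [|b2 [|b3 [|b4 [|b5 [|//]]]]]]] // _.
  by case: b0; case: b1; case: b2; case: b3; case: b4; case: b5.
by case: a {v d7}; case: b.
Qed.

Definition nb (i : 'I_3) : N := bin_of_nat i.

Lemma vec_pos i j j' k a b b' c :
  N.eqb (vec (nb i) (nb j) (nb j') (nb k)) (bin_of_nat (pos a b b' c)) =
  [&& a == i, b == j, b' == j' & c == k].
Proof.
have key (i0 j0 j'0 k0 a0 b0 b'0 c0 : nat) :
    (i0 < 3)%N -> (j0 < 3)%N -> (j'0 < 3)%N -> (k0 < 3)%N ->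
    (a0 < 3)%N -> (b0 < 3)%N -> (b'0 < 3)%N -> (c0 < 3)%N ->
    N.eqb (27 * N.of_nat i0 + 9 * N.of_nat j0 + 3 * N.of_nat j'0 + N.of_nat k0)
      (N.of_nat ((a0 * 3 + b0) * 9 + (b'0 * 3 + c0))) =
    [&& a0 == i0, b0 == j0, b'0 == j'0 & c0 == k0].
  move=> *; apply/N.eqb_spec/and4P => [e|[/eqP-> /eqP-> /eqP-> /eqP->]]; last by lia.
  have ec : c0 = k0 by lia.
  have eb' : b'0 = j'0 by lia.
  have eb : b0 = j0 by lia.
  by split; apply/eqP; lia.
by rewrite /vec /nb !bin_of_natE; apply: key.
Qed.

Section Classification.
Variable F : numFieldType.
Local Notation rows := 'rV[F]_(9 * 9).
Local Notation den := (den F (9 * 9)).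

Lemma den_unit i j j' k : den (unit_vec (vec (nb i) (nb j) (nb j') (nb k))) = e4 F i j j' k.
Proof.
apply: row4P => a b b' c; rewrite e4E /at4 mxE /unit_vec /= vec_pos.
by case: ifP.
Qed.

Lemma den2 k l : den [:: (k, Z.pos xH); (l, Z.pos xH)] = den (unit_vec k) + den (unit_vec l).
Proof.
apply/rowP => u; rewrite !mxE /unit_vec /entry /=.
by rewrite -!zfD; case: N.eqb; case: N.eqb.
Qed.

Lemma den3 k l m : den [:: (k, Z.pos xH); (l, Z.pos xH); (m, Z.pos xH)] =
  den (unit_vec k) + den (unit_vec l) + den (unit_vec m).
Proof.
apply/rowP => u; rewrite !mxE /unit_vec /entry /=.
by rewrite -!zfD; case: N.eqb; case: N.eqb; case: N.eqb.
Qed.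

Lemma den_id i k : den (id_vec (nb i) (nb k)) = diag4 i k 1 1 1.
Proof.
rewrite /id_vec den3 /diag4 !scale1r.
rewrite -(den_unit i o0 o0 k) -(den_unit i o1 o1 k) -(den_unit i o2 o2 k).
by rewrite ?addrA.
Qed.

Lemma vec_small i j j' k : N.ltb (vec (nb i) (nb j) (nb j') (nb k)) 81.
Proof. by case: (o3P i); case: (o3P j); case: (o3P j'); case: (o3P k). Qed.

Lemma gens_cellP (P : sparse -> Prop) i k c :
  P (id_vec (nb i) (nb k)) ->
  (forall p, p \in mask (bits c) offdiag3 -> P (unit_vec (vec (nb i) (nb p.1) (nb p.2) (nb k)))) ->
  ((diag c == 2%N) || (diag c == 1%N) && al c -> P (unit_vec (vec (nb i) 2 2 (nb k)))) ->
  ((diag c == 2%N) || (diag c == 1%N) && ar c -> P (unit_vec (vec (nb i) 0 0 (nb k)))) ->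
  forall v, v \in gens_cell (nb i, nb k) c -> P v.
Proof.
move=> Pid Poff Pal Par v; rewrite /gens_cell /= inE => /orP[/eqP->//|].
rewrite !mem_cat => /or3P[|  |].
- have -> : offdiag = [seq (nb p.1, nb p.2) | p <- offdiag3] by [].
  by rewrite -map_mask -map_comp => /mapP[p pin ->]; exact: Poff.
- by case: ifP => // h; rewrite inE => /eqP->; exact: Pal.
- by case: ifP => // h; rewrite inE => /eqP->; exact: Par.
Qed.

Definition cells3 : seq ('I_3 * 'I_3) := [seq (i, k) | i <- [:: o0; o1; o2], k <- [:: o2; o1; o0]].

Lemma cellsE : cells = [seq (nb p.1, nb p.2) | p <- cells3].
Proof. by []. Qed.

Definition rows_mx (V : seq sparse) : 'M[F]_(size V, 9 * 9) :=
  \matrix_(i < size V) den (nth [::] V i).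

Lemma rows_mx_sub V v : v \in V -> (den v <= rows_mx V)%MS.
Proof.
move=> vV; have iV : (index v V < size V)%N by rewrite index_mem.
have -> : den v = row (Ordinal iV) (rows_mx V) by rewrite rowK /= nth_index.
exact: row_sub.
Qed.

Lemma row_decomp (w : rows) : w = \sum_i \sum_k
  (w *m cell_proj F i k + \sum_(p <- offdiag3) at4 w i p.1 p.2 k *: e4 F i p.1 p.2 k).
Proof.
apply: row4P => a b b' c.
have at4_sum (I : Type) (s : seq I) (G : I -> rows) :
    at4 (\sum_(x <- s) G x) a b b' c = \sum_(x <- s) at4 (G x) a b b' c.
  by rewrite /at4 summxE.
have cell_at i k : at4 (w *m cell_proj F i k +
    \sum_(p <- offdiag3) at4 w i p.1 p.2 k *: e4 F i p.1 p.2 k) a b b' c =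
    ((a == i) && (c == k))%:R * at4 w a b b' c.
  rewrite at4D mul_cell_proj diag4E at4_sum !big_cons big_nil !at4Z !e4E.
  case: (eqVneq a i) => [->|_] /=; last by rewrite !mulr0 !mul0r !addr0.
  case: (eqVneq c k) => [->|_] /=; last by rewrite !andbF !mulr0 !mul0r !addr0.
  by case: (o3P b); case: (o3P b'); rewrite /=; ring.
rewrite at4_sum (bigD1 a) //= at4_sum (bigD1 c) //= cell_at !eqxx mul1r.
rewrite !big1 ?addr0 // => [i ia|k kc].
  by rewrite at4_sum big1 // => k _; rewrite cell_at eq_sym (negbTE ia) mul0r.
by rewrite cell_at [c == k]eq_sym (negbTE kc) andbF mul0r.
Qed.

Section OneSpace.
Variables (r : nat) (E : 'M[F]_(r, 9 * 9)).
Hypotheses (rE : raising E) (rk16 : \rank E = 16).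

(** Modulo the identity the diagonal part is then everything, or a line; equal
    last coordinates make that line the one of the first corner. *)
Lemma e00_of_ar i k : (diag (code4 E i k) == 2%N) || (diag (code4 E i k) == 1%N) && ar4 E i k ->
  (e4 F i o0 o0 k <= E)%MS.
Proof.
case: (eqVneq (diag (code4 E i k)) 2%N) => [d2 _|_ /andP[/eqP d1 arE]].
  have rk3 : \rank (E *m cell_proj F i k) = 3.
    by move: d2; rewrite /diag /=; case: (\rank _) => [|n] /= => [|->].
  have sub : (cell_span F i k <= E *m cell_proj F i k)%MS.
    rewrite -(geq_leqif (mxrank_leqif_sup (cell_sub_span E i k))) rk3; exact: rank_cell_span.
  by apply: submx_trans (submx_trans sub (cell_le rE i k)); exact: addsmxSl.
have nal : ~~ al4 E i k.
  by have := al_ar_rank_cell rE i k; rewrite arE andbT; move: d1; rewrite /diag /= => -> <-.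
have [v vE ne] := not_al4 nal.
apply: (@eq_scale_sub _ _ E (v *m cell_proj F i k - at4 v i o1 o1 k *: diag4 i k 1 1 1) _
   (at4 v i o0 o0 k - at4 v i o1 o1 k)); first by rewrite subr_eq0.
  by rewrite addmx_sub ?eqmx_opp ?scalemx_sub ?(raising_id rE) ?(raising_diag rE).
rewrite mul_cell_proj (ar4P _ _ _ arE v vE); apply: row4P => a b b' c.
rewrite at4D at4N !at4Z !diag4E e4E.
by case: (a == i); case: (c == k); case: (o3P b); case: (o3P b'); rewrite /=; ring.
Qed.

Lemma e22_of_al i k : (diag (code4 E i k) == 2%N) || (diag (code4 E i k) == 1%N) && al4 E i k ->
  (e4 F i o2 o2 k <= E)%MS.
Proof.
case: (eqVneq (diag (code4 E i k)) 2%N) => [d2 _|_ /andP[/eqP d1 alE]].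
  have rk3 : \rank (E *m cell_proj F i k) = 3.
    by move: d2; rewrite /diag /=; case: (\rank _) => [|n] /= => [|->].
  have sub : (cell_span F i k <= E *m cell_proj F i k)%MS.
    rewrite -(geq_leqif (mxrank_leqif_sup (cell_sub_span E i k))) rk3; exact: rank_cell_span.
  apply: submx_trans (submx_trans sub (cell_le rE i k)).
  exact: submx_trans (addsmxSr _ _) (addsmxSr _ _).
have nar : ~~ ar4 E i k.
  by have := al_ar_rank_cell rE i k; rewrite alE /=; move: d1; rewrite /diag /= => -> <-.
have [v vE ne] := not_ar4 nar.
apply: (@eq_scale_sub _ _ E (v *m cell_proj F i k - at4 v i o1 o1 k *: diag4 i k 1 1 1) _
   (at4 v i o2 o2 k - at4 v i o1 o1 k)); first by rewrite subr_eq0 eq_sym.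
  by rewrite addmx_sub ?eqmx_opp ?scalemx_sub ?(raising_id rE) ?(raising_diag rE).
rewrite mul_cell_proj (al4P _ _ _ alE v vE); apply: row4P => a b b' c.
rewrite at4D at4N !at4Z !diag4E e4E.
by case: (a == i); case: (c == k); case: (o3P b); case: (o3P b'); rewrite /=; ring.
Qed.

(** Two elements that separate the first, respectively the last, two diagonal
    coordinates have a combination separating both. *)
Lemma generic_diag i k : ~~ al4 E i k -> ~~ ar4 E i k ->
  exists x y : F, [/\ x != 0, y != 0 & ((x *: e4 F i o0 o0 k +
     y *: (e4 F i o0 o0 k + e4 F i o1 o1 k))%R <= E)%MS].
Proof.
move=> /not_al4[v vE v01] /not_ar4[w wE w12].
have [u [uE u01 u12]] : exists u : rows, [/\ (u <= E)%MS,
    at4 u i o0 o0 k != at4 u i o1 o1 k & at4 u i o1 o1 k != at4 u i o2 o2 k].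
  case: (eqVneq (at4 v i o1 o1 k) (at4 v i o2 o2 k)) => [v12|v12]; last by exists v.
  case: (eqVneq (at4 w i o0 o0 k) (at4 w i o1 o1 k)) => [w01|w01]; last by exists w.
  exists (v + w); split; first exact: addmx_sub.
    by rewrite !at4D w01 (inj_eq (addIr _)).
  by rewrite !at4D v12 (inj_eq (addrI _)).
exists (at4 u i o0 o0 k - at4 u i o1 o1 k), (at4 u i o1 o1 k - at4 u i o2 o2 k).
rewrite !subr_eq0 u01 u12; split=> //.
have uid : (u *m cell_proj F i k - at4 u i o2 o2 k *: diag4 i k 1 1 1 <= E)%MS.
  by rewrite addmx_sub ?eqmx_opp ?scalemx_sub ?(raising_id rE) ?(raising_diag rE).
move: uid; congr (_ <= _)%MS; rewrite mul_cell_proj; apply: row4P => a b b' c.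
rewrite !(at4D, at4N, at4Z, e4E).
by case: (a == i); case: (c == k); case: (o3P b); case: (o3P b'); rewrite /=; ring.
Qed.

Definition array : seq code := [seq code4 E p.1 p.2 | p <- cells3].

Lemma array_sum : sumn (map dimc array) = 7%N.
Proof.
have dimE i k : (\sum_(p <- offdiag3) (e4 F i p.1 p.2 k <= E)%MS + \rank (E *m cell_proj F i k))%N =
    (dimc (code4 E i k)).+1.
  rewrite /dimc /code4 /bits /diag /= !big_cons big_nil /bit4 /= !addnA addn0.
  by rewrite -addnS prednK // (rank_cell_gt0 rE).
have := raising_rank rE; rewrite rk16.
under eq_bigr do under eq_bigr do rewrite dimE.
rewrite !big_ord_recl !big_ord0 !addn0.
have -> : lift ord0 (ord0 : 'I_2) = o1 by exact/val_inj.
have -> : lift ord0 (lift ord0 (ord0 : 'I_1)) = o2 by exact/val_inj.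
have -> : (ord0 : 'I_3) = o0 by exact/val_inj.
rewrite /array /=; lia.
Qed.

Lemma array_codes : {subset array <= codes}.
Proof.
move=> _ /mapP[p pc ->]; apply: mem_codes => //.
- by have := rank_cell_le3 E p.1 p.2; case: (\rank _) => [|n].
- exact: valid_code4.
- rewrite -/(code4 E p.1 p.2) -array_sum.
  have := map_f (fun p => code4 E p.1 p.2) pc; rewrite -/array.
  elim: array => [//|c cs IH]; rewrite inE /= => /orP[/eqP->|/IH]; first exact: leq_addr.
  by move=> h; exact: leq_trans h (leq_addl _ _).
Qed.

Lemma size_array : size array = 9%N.
Proof. by []. Qed.

Lemma array_first m : (m < 9)%N -> (3 <= m)%N ->
  le_code (nth code0 array m) (nth code0 array (m - 3)).
Proof.
have h10 k : le_code (code4 E o1 k) (code4 E o0 k) by exact: le_code_first.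
have h21 k : le_code (code4 E o2 k) (code4 E o1 k) by exact: le_code_first.
case: m => [|[|[|[|[|[|[|[|[|m]]]]]]]]] // _ _.
- exact: h10 o2.
- exact: h10 o1.
- exact: h10 o0.
- exact: h21 o2.
- exact: h21 o1.
- exact: h21 o0.
Qed.

Lemma array_last m : (m < 9)%N -> (m %% 3 != 0)%N ->
  le_code (nth code0 array m) (nth code0 array (m - 1)).
Proof.
have h10 i : le_code (code4 E i o0) (code4 E i o1) by exact: le_code_last.
have h21 i : le_code (code4 E i o1) (code4 E i o2) by exact: le_code_last.
case: m => [|[|[|[|[|[|[|[|[|m]]]]]]]]] // _ _.
- exact: h21 o0.
- exact: h10 o0.
- exact: h21 o1.
- exact: h10 o1.
- exact: h21 o2.
- exact: h10 o2.
Qed.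

Lemma array_admissible m : (m < size array)%N -> admissible ([::] ++ take m array) (nth code0 array m).
Proof.
move=> ms; have m9 : (m < 9)%N by rewrite -size_array.
have sz : size (take m array) = m by rewrite size_takel // ltnW.
rewrite cat0s /admissible sz; apply/and3P; split.
- apply/implyP => m3; have m0 : (0 < m)%N by case: (m) m3.
  by rewrite nth_take ?subn1 ?prednK // -subn1; exact: array_last.
- apply/implyP => m3; rewrite nth_take ?ltn_subrL ?(leq_trans _ m3) //.
  exact: array_first.
- rewrite -array_sum -[X in (_ <= sumn (map dimc X))%N](cat_take_drop m array).
  by rewrite (drop_nth code0 ms) map_cat sumn_cat leq_add2l leq_addr.
Qed.

Lemma array_okE : array_ok array.
Proof.
have chk : check_arrays 9 array_ok [::] by vm_compute.
have := check_arraysP chk size_array array_codes array_admissible.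
by rewrite cat0s; apply; exact: array_sum.
Qed.

Lemma within_sub (ub : seq code) : size ub = 9%N -> all2 within ub array ->
  (E <= rows_mx (gens ub))%MS.
Proof.
move=> sub wub.
have cellw p : p \in cells3 -> exists2 u, within u (code4 E p.1 p.2) &
    {subset gens_cell (nb p.1, nb p.2) u <= gens ub}.
  rewrite /gens cellsE; move: wub; rewrite /array; move: gens_cell => g.
  elim: cells3 ub {sub} => [//|q cs IH] [|u ub] //= /andP[wu wus].
  rewrite inE => /orP[/eqP->|pcs].
    by exists u => // v vin; rewrite mem_cat vin.
  have [u' wu' su'] := IH _ wus pcs; exists u' => // v /su' vin.
  by rewrite mem_cat vin orbT.
have cells_all i k : (i, k) \in cells3 by case: (o3P i); case: (o3P k).
apply/row_subP => s; set w := row s E; have wE : (w <= E)%MS by exact: row_sub.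
rewrite (row_decomp w); apply: summx_sub => i _; apply: summx_sub => k _.
have [u wu gu] := cellw (i, k) (cells_all i k).
have idS : (diag4 i k 1 1 1 <= rows_mx (gens ub))%MS.
  rewrite -den_id.
  by apply: rows_mx_sub; apply: gu; rewrite /gens_cell mem_head.
have unitS j j' : unit_vec (vec (nb i) (nb j) (nb j') (nb k)) \in gens_cell (nb i, nb k) u ->
    (e4 F i j j' k <= rows_mx (gens ub))%MS.
  by move=> /gu/rows_mx_sub; rewrite den_unit.
move: wu; rewrite /within => /andP[bitsu diagu].
rewrite addmx_sub //; last first.
  rewrite big_seq; apply: summx_sub => p poff.
  case: (eqVneq (at4 w i p.1 p.2 k) 0) => [->|nz]; first by rewrite scale0r sub0mx.
  apply: scalemx_sub; apply: unitS.
  have bp : bit4 E i k p.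
    have jj : p.1 != p.2 by move: poff; rewrite !inE => /or4P[/eqP->|/eqP->|/eqP->|/or3P[]/eqP->].
    by rewrite /bit4 -(eqmx_scale _ nz); exact: (raising_off rE).
  rewrite /gens_cell mem_cat; apply/orP; right; rewrite mem_cat; apply/orP; left.
  apply: (map_f (fun q : N * N => unit_vec (vec (nb i) q.1 q.2 (nb k))) (x := (nb p.1, nb p.2))).
  have -> : offdiag = [seq (nb q.1, nb q.2) | q <- offdiag3] by [].
  rewrite -map_mask; apply: (map_f (fun q => (nb q.1, nb q.2))).
  have {}bitsu : all2 implb [seq bit4 E i k q | q <- offdiag3] (bits u) := bitsu.
  move: poff bp bitsu; elim: offdiag3 (bits u) => [//|q l IH] [|b bs] //.
  rewrite inE map_cons => pq bp; rewrite [all2 _ _ _]/= => /andP[qb lbs].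
  rewrite mask_cons mem_cat; case/orP: pq => [/eqP pE|pl].
    by move: qb; rewrite -pE bp => /= ->; rewrite inE eqxx.
  by rewrite (IH _ pl bp lbs) orbT.
rewrite mul_cell_proj; set x := at4 w i o0 o0 k; set y := at4 w i o1 o1 k; set z := at4 w i o2 o2 k.
have e22S : (diag u == 2%N) || (diag u == 1%N) && al u -> (e4 F i o2 o2 k <= rows_mx (gens ub))%MS.
  move=> h; apply: unitS; rewrite /gens_cell /= inE !mem_cat.
  by apply/orP; right; apply/orP; right; apply/orP; left; rewrite h inE.
have e00S : (diag u == 2%N) || (diag u == 1%N) && ar u -> (e4 F i o0 o0 k <= rows_mx (gens ub))%MS.
  move=> h; apply: unitS; rewrite /gens_cell /= inE !mem_cat.
  by apply/orP; right; apply/orP; right; apply/orP; right; rewrite h inE.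
have -> : diag4 i k x y z = y *: diag4 i k 1 1 1 + ((x - y) *: e4 F i o0 o0 k + (z - y) *: e4 F i o2 o2 k).
  apply: row4P => a b b' c; rewrite !at4D !at4Z !diag4E !e4E.
  by case: (a == i); case: (c == k); case: (o3P b); case: (o3P b'); rewrite /=; ring.
rewrite addmx_sub ?scalemx_sub //.
have alxy : al4 E i k -> x - y = 0 by move=> /al4P/(_ w wE); rewrite -/x -/y => ->; rewrite subrr.
have aryz : ar4 E i k -> z - y = 0 by move=> /ar4P/(_ w wE); rewrite -/y -/z => ->; rewrite subrr.
case/or4P: diagu => [d2|d0|/and3P[d1 alu alc]|/and3P[d1 aru arc]].
- by rewrite addmx_sub ?scalemx_sub ?e00S ?e22S ?d2.
- move: d0; rewrite /diag /= (al_ar_rank_cell rE) => /andP[/alxy-> /aryz->].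
  by rewrite !scale0r addr0 sub0mx.
- by rewrite (alxy alc) scale0r add0r scalemx_sub // e22S // d1 alu orbT.
- by rewrite (aryz arc) scale0r addr0 scalemx_sub // e00S // d1 aru orbT.
Qed.

Lemma gens_sub v : v \in gens array -> small_keys v /\ (den v <= E)%MS.
Proof.
rewrite /gens cellsE /array zip_map -map_comp => /flatten_mapP[[i k] _ /=].
apply: (gens_cellP (P := fun v => small_keys v /\ (den v <= E)%MS)).
- split; first by case: (o3P i); case: (o3P k).
  by rewrite den_id; exact: (raising_id rE).
- move=> p; have -> : bits (code4 E i k) = [seq bit4 E i k q | q <- offdiag3] by [].
  rewrite -filter_mask mem_filter => /andP[bp _].
  by rewrite den_unit /small_keys /= vec_small.
- move=> h; have := e22_of_al (i := i) (k := k) h; rewrite -den_unit => e; split=> //.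
  by rewrite /small_keys /= (vec_small i o2 o2 k).
- move=> h; have := e00_of_ar (i := i) (k := k) h; rewrite -den_unit => e; split=> //.
  by rewrite /small_keys /= (vec_small i o0 o0 k).
Qed.

Lemma lin_gens_sub : exists x y : F, [/\ x != 0, y != 0 & forall v, v \in lin_gens array ->
  [/\ small_keys v.1, small_keys v.2 & (lin (9 * 9) x y v <= E)%MS]].
Proof.
rewrite /lin_gens; case: ifP => [h|_]; last by exists 1, 1; rewrite oner_neq0.
have /andP[/andP[_ nal] nar] := h.
have [x [y [x0 y0 xy]]] := generic_diag nal nar.
exists x, y; split=> // v; rewrite inE => /eqP->; split=> //.
move: xy; congr (_ <= _)%MS; rewrite /lin -(den_unit o0 o0 o0 o2) -(den_unit o0 o1 o1 o2).
by rewrite den2.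
Qed.

Lemma nines_lt x : x \in nines -> N.lt x 9.
Proof. by rewrite !inE => /or4P[/eqP->|/eqP->|/eqP->|/or4P[/eqP->|/eqP->|/eqP->|/or3P[]/eqP->]]. Qed.

(** By enumeration: for an array of codes outside the two bounds, the vectors
    forced by the codes already make one of the two ranks too large. *)
Theorem bounded_support : (\rank (skew_left E) <= 128)%N -> (\rank (skew_right E) <= 128)%N ->
  (E <= rows_mx (gens bound_a))%MS \/ (E <= rows_mx (gens bound_b))%MS.
Proof.
move=> rkl rkr; have := array_okE; rewrite /array_ok.
case: ifP => [/within_sub h _|_]; first by left; exact: h.
case: ifP => [/within_sub h _|_]; first by right; exact: h.
have [x [y [x0 y0 linE]]] := lin_gens_sub.
have test m (M : 'M[F]_(m, 9 * 9 * 9)) (row : sparse -> N -> sparse) :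
    (\rank M <= 128)%N ->
    (forall a b v z, small_keys v.1 -> small_keys v.2 -> N.lt z 9 ->
       (lin (9 * 9) a b v <= E)%MS ->
       (lin (9 * 9 * 9) a b (row v.1 z, row v.2 z) <= M)%MS) ->
    (128 < test_rank row array)%N = false.
  move=> rkM linM; apply/negbTE; rewrite -leqNgt; apply: leq_trans rkM.
  have Nn : nat_of_bin 729 = (9 * 9 * 9)%N by vm_compute.
  rewrite /test_rank; refine (elim_rank_le (M := M) (N := 729%num) _ Nn x0 y0 _ _).
    move=> _ /allpairsP[[v z] [/= vin zin ->]]; have [sv vE] := gens_sub vin.
    have := linM 1 0 (v, v) z sv sv (nines_lt zin).
    by rewrite /lin /= !scale1r !scale0r !addr0; apply.
  move=> _ /allpairsP[[v z] [/= vin zin ->]]; have [s1 s2 vE] := linE _ vin.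
  exact: linM s1 s2 (nines_lt zin) vE.
by rewrite (test _ _ left_row rkl) ?(test _ _ right_row rkr) // => *;
  [exact: right_row_sub | exact: left_row_sub].
Qed.

End OneSpace.
End Classification.

(** * The triple intersection of three classified subspaces *)

Lemma row_free_tens1 (K : fieldType) m n q (W : 'M[K]_(m, n)) :
  row_free W -> row_free (W *t (1%:M : 'M_q)).
Proof.
move=> /row_freeP[B WB]; apply/row_freeP; exists (B *t (1%:M : 'M_q)).
by rewrite tensmx_mul WB mul1mx tensmx11.
Qed.

Lemma row_free_block (K : fieldType) m1 m2 n1 n2 (A : 'M[K]_(m1, n1)) (B : 'M[K]_(m2, n2)) :
  row_free A -> row_free B -> row_free (block_mx A 0 0 B).
Proof.
move=> /row_freeP[A' AA] /row_freeP[B' BB]; apply/row_freeP; exists (block_mx A' 0 0 B').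
by rewrite mulmx_block !mulmx0 !mul0mx !addr0 !add0r AA BB -scalar_mx_block.
Qed.

Lemma row_free_factor (K : fieldType) r n s (E : 'M[K]_(r, n)) (S : 'M_(s, n)) :
  \rank E = r -> (E <= S)%MS -> exists2 W : 'M_(r, s), row_free W & E = W *m S.
Proof.
move=> rkE /submxP[W EW]; exists W => //.
by rewrite /row_free eqn_leq rank_leq_row -{1}rkE EW mxrankM_maxl.
Qed.

(** Replacing each of the three spaces by a subspace lowers the rank by at most
    the number of rows that are lost: this is Sylvester's inequality for the
    block diagonal matrix of the inclusions. *)
Lemma rank_cube_sub (K : fieldType) n r s1 s2 s3 (E0 E1 E2 : 'M[K]_(r, n * n))
    (S0 : 'M_(s1, n * n)) (S1 : 'M_(s2, n * n)) (S2 : 'M_(s3, n * n)) :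
  \rank E0 = r -> \rank E1 = r -> \rank E2 = r ->
  (E0 <= S0)%MS -> (E1 <= S1)%MS -> (E2 <= S2)%MS ->
  (3 * (r * n) + \rank (cube S0 S1 S2) <=
   (s1 + s2 + s3) * n + \rank (cube E0 E1 E2))%N.
Proof.
move=> rk0 rk1 rk2 /(row_free_factor rk0)[W0 f0 ->] /(row_free_factor rk1)[W1 f1 ->].
move=> /(row_free_factor rk2)[W2 f2 ->].
pose B := block_mx (W0 *t (1%:M : 'M[K]_n)) 0 0
  (block_mx (W1 *t (1%:M : 'M[K]_n)) 0 0 (W2 *t (1%:M : 'M[K]_n))).
have fB : row_free B by rewrite !row_free_block ?row_free_tens1.
have e s t (W : 'M[K]_(r, s)) (S : 'M_(s, n * n)) (Q : 'M_(n * n * n, t)) :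
    ((W *m S) *t 1%:M) *m Q = (W *t (1%:M : 'M_n)) *m ((S *t 1%:M) *m Q).
  by rewrite mulmxA tensmx_mul mul1mx.
have -> : cube (W0 *m S0) (W1 *m S1) (W2 *m S2) = B *m cube S0 S1 S2.
  rewrite /cube /pairwise_diff /B mul_block_col !mul0mx addr0 add0r.
  rewrite mul_block_col !mul0mx addr0 add0r !mul_mx_row !mulmx0.
  have := e _ _ W0 S0 1%:M; rewrite !mulmx1 => <-.
  by rewrite e -mulmxA e !mulmxA.
have := mxrank_mul_min B (cube S0 S1 S2).
rewrite leq_subLR (eqP fB) !mulnDl -[((s1 * n + _) + _)%N]addnA.
set p := \rank _; set q := \rank _. move: p q; clear; lia.
Qed.

Section Contradiction.
Variable F : numFieldType.

Lemma bound_props ub : ub \in [:: bound_a; bound_b] ->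
  size (gens ub) = 21%N /\ all small_keys (gens ub).
Proof. by rewrite !inE => /orP[]/eqP->; split; vm_compute. Qed.

Lemma rank_cube_bounds u0 u1 u2 : u0 \in [:: bound_a; bound_b] ->
  u1 \in [:: bound_a; bound_b] -> u2 \in [:: bound_a; bound_b] ->
  (552 <= \rank (cube (rows_mx F (gens u0)) (rows_mx F (gens u1)) (rows_mx F (gens u2))))%N.
Proof.
move=> h0 h1 h2; apply: (@leq_trans (cube_rank (gens u0) (gens u1) (gens u2))).
  have ok : cubes_ok by vm_compute.
  have mem u : u \in [:: bound_a; bound_b] -> gens u \in bounds := map_f gens (x := u).
  have ok0 := allP ok _ (mem _ h0).
  have ok1 := allP ok0 _ (mem _ h1).
  exact: (allP ok1 _ (mem _ h2)).
have [_ /allP s0] := bound_props h0; have [_ /allP s1] := bound_props h1.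
have [_ /allP s2] := bound_props h2.
move: (gens u0) (gens u1) (gens u2) s0 s1 s2 => V0 V1 V2 s0 s1 s2.
have N1458 : nat_of_bin 1458 = (9 * 9 * 9 + 9 * 9 * 9)%N by vm_compute.
set M := cube _ _ _.
rewrite /cube_rank; refine (elim_rank_le (F := F) (M := M) (N := 1458%num) (x := 1) (y := 1)
  _ N1458 (oner_neq0 _) (oner_neq0 _) _ _) => [r|v]; last by rewrite in_nil.
rewrite !mem_cat => /or3P[] /allpairsP[[v z] [vin zin ->]].
- exact: (cube_row1_sub _ _ (s1 _ vin) (nines_lt zin) (rows_mx_sub F vin)).
- exact: (cube_row2_sub _ _ (s2 _ vin) (nines_lt zin) (rows_mx_sub F vin)).
- exact: (cube_row0_sub _ _ (s0 _ vin) (nines_lt zin) (rows_mx_sub F vin)).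
Qed.

Theorem bounded_cube (E : 'I_3 -> 'M[F]_(16, 9 * 9)) :
  (forall i, \rank (E i) = 16) ->
  (forall i, (E i <= rows_mx F (gens bound_a))%MS \/ (E i <= rows_mx F (gens bound_b))%MS) ->
  (416 < \rank (cube (E o0) (E o1) (E o2)))%N.
Proof.
move=> rkE bE.
have bd i : exists2 u, u \in [:: bound_a; bound_b] & (E i <= rows_mx F (gens u))%MS.
  by case: (bE i) => h; [exists bound_a | exists bound_b]; rewrite // !inE eqxx ?orbT.
have [u0 m0 h0] := bd o0; have [u1 m1 h1] := bd o1; have [u2 m2 h2] := bd o2.
have := rank_cube_sub (rkE o0) (rkE o1) (rkE o2) h0 h1 h2.
have := rank_cube_bounds m0 m1 m2; move: (\rank _) (\rank _) => p q hp.
have [-> _] := bound_props m0; have [-> _] := bound_props m1; have [-> _] := bound_props m2.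
rewrite -(ltn_add2l ((21 + 21 + 21) * 9)) => hq; apply: leq_trans hq.
exact: leq_trans (leq_add (leqnn (3 * (16 * 9))) hp).
Qed.
End Contradiction.

(** * Symmetries of the matrix multiplication tensor *)

Section Sums.
Variable (K : comNzRingType).

Lemma sum_mxtens m n (f : 'I_(m * n) -> K) :
  \sum_u f u = \sum_a \sum_b f (mxtens_index (a, b)).
Proof.
rewrite pair_big (reindex (@mxtens_index m n)); last first.
  by exists (@mxtens_unindex m n) => x _; rewrite ?mxtens_indexK ?mxtens_unindexK.
by apply: eq_bigr => -[].
Qed.

Lemma sum_delta (I : finType) (a : I) (f : I -> K) : \sum_x (x == a)%:R * f x = f a.
Proof.
rewrite (bigD1 a) //= eqxx mul1r big1 ?addr0 // => x /negbTE->; exact: mul0r.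
Qed.

End Sums.

Section Matmul.
Variable R : realType.
Local Notation C := R[i].
Local Notation frame := ('I_3 -> 'M[C]_(3 * 3)).
Local Notation frame3 := ('I_3 -> 'M[C]_3).

(** With all three factors indexed by the same type the tensor is cyclically
    symmetric. *)
Definition matmul (p q s : 'I_(3 * 3)) : C :=
  let ij := mxtens_unindex p in let jk := mxtens_unindex q in let ki := mxtens_unindex s in
  [&& ki.2 == ij.1, ij.2 == jk.1 & jk.2 == ki.1]%:R.

Lemma flat_matmulE k a i j j' l :
  flat matmul (mxtens_index (k, a)) (mxtens_index (mxtens_index (i, j), mxtens_index (j', l))) =
  (a == i)%:R * (j == j')%:R * (l == k)%:R.
Proof. by rewrite mxE !mxtens_indexK /matmul !mxtens_indexK /= -!natrM !mulnb andbA. Qed.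

Definition sandwich (g h : frame3) : frame := fun i => g i *t h (i + 1).

(** The factor acting on the summed index cancels against its dual, so that
    changes of basis in the three underlying spaces preserve the tensor. *)
Lemma flat_sandwich (g h : frame3) (c : 'I_3 -> C) i :
  (forall i, (h i)^T *m g i = (c i)%:M) ->
  (flat matmul *m pair_mx (sandwich g h) i <= flat matmul)%MS.
Proof.
move=> hg; apply/submxP; exists (c (i + 1) *: (h (i + 1 + 1) *t g i)).
apply/matrixP => s u; case: (mxtens_indexP s) => k a.
case: (mxtens_indexP u) => p q; case: (mxtens_indexP p) => i0 j.
case: (mxtens_indexP q) => j' l.
transitivity (c (i + 1) * (j == j')%:R * g i a i0 * h (i + 1 + 1) k l).
  rewrite mxE sum_mxtens sum_mxtens.
  transitivity (\sum_x (x == a)%:R * \sum_y \sum_z \sum_w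
     ((w == k)%:R * ((y == z)%:R * (g i x i0 * h (i + 1) y j * g (i + 1) z j' * h (i + 1 + 1) w l)))).
    apply: eq_bigr => x _; rewrite big_distrr; apply: eq_bigr => y _; rewrite sum_mxtens /=.
    rewrite big_distrr; apply: eq_bigr => z _; rewrite big_distrr; apply: eq_bigr => w _ /=.
    rewrite flat_matmulE /pair_mx /sandwich !tensmxE [a == x]eq_sym; ring.
  rewrite sum_delta.
  transitivity (\sum_y g i a i0 * h (i + 1 + 1) k l * (h (i + 1) y j * g (i + 1) y j')).
    apply: eq_bigr => y _.
    transitivity (\sum_z (z == y)%:R * (g i a i0 * h (i + 1 + 1) k l * (h (i + 1) y j * g (i + 1) z j'))).
      by apply: eq_bigr => z _; rewrite sum_delta [y == z]eq_sym; ring.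
    by rewrite sum_delta.
  rewrite -big_distrr /=; have -> : \sum_y h (i + 1) y j * g (i + 1) y j' = ((h (i + 1))^T *m g (i + 1)) j j'.
    by rewrite mxE; apply: eq_bigr => y _; rewrite mxE.
  by rewrite hg mxE -mulr_natr; ring.
rewrite mxE sum_mxtens.
transitivity (\sum_x (x == l)%:R * \sum_y (y == i0)%:R *
   (c (i + 1) * (j == j')%:R * g i a y * h (i + 1 + 1) k x)).
  by rewrite sum_delta sum_delta.
apply: eq_bigr => x _; rewrite big_distrr; apply: eq_bigr => y _ /=.
rewrite flat_matmulE mxE tensmxE [x == l]eq_sym; ring.
Qed.

(** The infinitesimal action of an endomorphism of the f-th space: on the
    factor where that space comes first, and dually where it comes second. *)
Definition infinitesimal (e : 'M[C]_3) (f : 'I_3) : frame := fun i =>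
  if i == f then e *t 1%:M else if i + 1 == f then - ((1%:M : 'M_3) *t e^T) else 0.

Lemma next_neq (i : 'I_3) : (i + 1 == i) = false.
Proof. by case: (o3P i). Qed.

Lemma infinitesimal_sq e f i : e *m e = 0 ->
  infinitesimal e f i *m infinitesimal e f i = 0.
Proof.
move=> e2; rewrite /infinitesimal; case: eqP => [_|_].
  by rewrite tensmx_mul e2 mulmx1; apply/matrixP => u v; rewrite !mxE mul0r.
case: eqP => [_|_]; last by rewrite mul0mx.
rewrite mulmxN mulNmx opprK tensmx_mul -trmx_mul e2 trmx0 mulmx1.
by apply/matrixP => u v; rewrite !mxE mulr0.
Qed.

Lemma infinitesimal_comm e e' d c f i : e *m e' = e' *m e + c *: d ->
  infinitesimal e f i *m infinitesimal e' f i =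
  infinitesimal e' f i *m infinitesimal e f i + c *: infinitesimal d f i.
Proof.
move=> ee; rewrite /infinitesimal; case: eqP => [_|_].
  by rewrite !tensmx_mul ee !mulmx1 tensmxDl tensmxZl.
case: eqP => [_|_]; last by rewrite !mul0mx scaler0 addr0.
rewrite !(mulmxN, mulNmx) !opprK !tensmx_mul -!trmx_mul ee !mulmx1 linearD linearZ /=.
by rewrite tensmxDr tensmxZr scalerN addrK.
Qed.

Lemma infinitesimal_comm_neq e e' f f' i : f != f' ->
  infinitesimal e f i *m infinitesimal e' f' i =
  infinitesimal e' f' i *m infinitesimal e f i.
Proof.
move=> ff; rewrite /infinitesimal.
case: (eqVneq i f) => [->|nif].
  rewrite (negbTE ff); case: eqP => _; last by rewrite mulmx0 mul0mx.
  by rewrite mulmxN mulNmx !tensmx_mul !mulmx1 !mul1mx.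
case: (eqVneq i f') => [->|nif'].
  case: eqP => _; last by rewrite mulmx0 mul0mx.
  by rewrite mulmxN mulNmx !tensmx_mul !mulmx1 !mul1mx.
case: (eqVneq (i + 1) f) => [->|_]; last by rewrite mulmx0 mul0mx.
by rewrite (negbTE ff) mulmx0 mul0mx.
Qed.

Lemma infinitesimal_mul0 e e' f i : e *m e' = 0 -> e' *m e = 0 ->
  infinitesimal e f i *m infinitesimal e' f i = 0.
Proof.
move=> ee e'e; rewrite /infinitesimal; case: eqP => [_|_].
  by rewrite tensmx_mul ee mulmx1; apply/matrixP => u v; rewrite !mxE mul0r.
case: eqP => [_|_]; last by rewrite mul0mx.
rewrite mulmxN mulNmx opprK tensmx_mul -trmx_mul e'e trmx0 mulmx1.
by apply/matrixP => u v; rewrite !mxE mulr0.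
Qed.

Lemma one_param_sandwich e f t i :
  one_param (infinitesimal e f) t i =
  sandwich (fun i => if i == f then 1%:M + t *: e else 1%:M)
           (fun i => if i == f then 1%:M - t *: e^T else 1%:M) i.
Proof.
rewrite /one_param /infinitesimal /sandwich.
case: (eqVneq i f) => [->|_].
  by rewrite next_neq tensmxDl tensmxZl tensmx11.
case: eqP => _; last by rewrite scaler0 addr0 tensmx11.
by rewrite tensmxDr -scaleNr tensmxZr tensmx11 scalerN scaleNr.
Qed.

Lemma flat_one_param e f t i : e *m e = 0 ->
  (flat matmul *m pair_mx (one_param (infinitesimal e f) t) i <= flat matmul)%MS.
Proof.
move=> e2; rewrite /pair_mx !one_param_sandwich.
apply: (@flat_sandwich _ _ (fun=> 1)) => {}i.
case: eqP => _; last by rewrite trmx1 mulmx1.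
rewrite linearB linearZ /= trmx1 trmxK mulmxBl mul1mx mulmxDr mulmx1 -scalemxAl.
by rewrite -scalemxAr e2 !scaler0 addr0 addrK.
Qed.

End Matmul.

(** * A Borel subgroup of the symmetries *)

Section Borel.
Variable R : realType.
Local Notation C := R[i].

(** The root (2, 0) comes first because it is the commutator of the other two. *)
Definition positive_roots : seq ('I_3 * 'I_3) := [:: (o2, o0); (o1, o0); (o2, o1)].
Definition root_vector k : 'M[C]_3 := let p := nth (o2, o0) positive_roots (k %/ 3) in delta_mx p.1 p.2.
(** Three roots for each of the three spaces. *)
Definition raisers (k : nat) : 'I_3 -> 'M[C]_(3 * 3) := infinitesimal (root_vector k) (inord (k %% 3)).

Lemma root_sq k : (k < 9)%N -> root_vector k *m root_vector k = 0.
Proof.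
by case: k => [|[|[|[|[|[|[|[|[|k]]]]]]]]] // _; rewrite mul_delta_mx_cond mulr0n.
Qed.

Lemma commuting_normal n (x y : 'I_3 -> 'M[C]_n) : (forall i, x i *m y i = y i *m x i) ->
  forall i, x i *m y i = y i *m x i + 0 *: y i /\ 0 *: (y i *m x i) = 0.
Proof. by move=> xy i; rewrite xy !scale0r addr0. Qed.

Lemma infinitesimal_commute e e' f i : e *m e' = e' *m e ->
  infinitesimal e f i *m infinitesimal e' f i =
  infinitesimal e' f i *m infinitesimal e f i :> 'M[C]_(3 * 3).
Proof.
move=> ee; have h : e *m e' = e' *m e + 0 *: e by rewrite scale0r addr0.
apply: etrans (infinitesimal_comm f i h) _.
by move: (infinitesimal e f i) (infinitesimal e' f i) => x y; rewrite scale0r addr0.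
Qed.

Lemma raisers_normal k j : (j < k < 9)%N -> exists c l, (l < k)%N /\ forall i,
  raisers k i *m raisers j i = raisers j i *m raisers k i + c *: raisers l i /\
  c *: (raisers l i *m raisers k i) = 0.
Proof.
move=> /andP[jk k9].
have commute := commuting_normal (x := raisers k) (y := raisers j).
case: (eqVneq (k %% 3)%N (j %% 3)%N) => [kj|kj]; last first.
  exists 0, j; split; first exact: jk.
  apply: commute => i; apply: infinitesimal_comm_neq; apply: contra kj => /eqP h.
  by have := congr1 val h; rewrite /= !inordK ?ltn_mod // => ->.
case: (boolP ((k %/ 3 == 2) && (j %/ 3 == 1))%N) => [/andP[/eqP k2 /eqP j1]|nkj].
  exists 1, (k %% 3)%N; split; first by rewrite {2}(divn_eq k 3) k2 -{1}[(k %% 3)%N]add0n ltn_add2r.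
  have rk : root_vector k = delta_mx o2 o1 by rewrite /root_vector k2.
  have rj : root_vector j = delta_mx o1 o0 by rewrite /root_vector j1.
  have rl : root_vector (k %% 3) = delta_mx o2 o0 by rewrite /root_vector divn_small // ltn_mod.
  rewrite /raisers -kj modn_mod rk rj rl; move: (inord _) => f i; split.
    by apply: infinitesimal_comm; rewrite !mul_delta_mx_cond eqxx mulr1n mulr0n add0r scale1r.
  by rewrite scale1r; apply: infinitesimal_mul0; rewrite mul_delta_mx_cond mulr0n.
exists 0, j; split; first exact: jk.
apply: commute => i; rewrite /raisers kj; apply: infinitesimal_commute.
have jk3 : (j %/ 3 < k %/ 3)%N.
  by move: jk; rewrite {1}(divn_eq j 3) {1}(divn_eq k 3) kj ltn_add2r ltn_mul2r.
have k3 : (k %/ 3 < 3)%N by rewrite ltn_divLR.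
rewrite /root_vector; move: jk3 k3 nkj; case: (k %/ 3)%N => [|[|[|//]]]; case: (j %/ 3)%N => [|[|//]] //= _ _ _;
  by rewrite !mul_delta_mx_cond !mulr0n.
Qed.

(** The torus weights of a space are 0, 1, 3, whose differences are distinct and
    at most 3 in absolute value; scaling them by powers of 7 keeps the three
    spaces apart.  The constant 147 = 3 * 7 ^ 2 makes the dual weights
    nonnegative. *)
Definition level (f a : 'I_3) : nat := (7 ^ f * nth 0 [:: 0; 1; 3] a)%N.
Definition weight (i : 'I_3) (u : 'I_(3 * 3)) : nat :=
  let v := mxtens_unindex u in (level i v.1 + (147 - level (i + 1)%R v.2))%N.

Lemma level_le f a : (level f a <= 147)%N.
Proof. by case: (o3P f); case: (o3P a). Qed.

Lemma torusE t i : torus weight t i =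
  diag_mx (\row_a t ^+ level i a) *t diag_mx (\row_a t ^+ (147 - level (i + 1) a)) :> 'M[C]_(3 * 3).
Proof.
apply/matrixP => u v; case: (mxtens_indexP u) => a b; case: (mxtens_indexP v) => a' b'.
rewrite tensmxE !mxE (can_eq (@mxtens_indexK _ _)) xpair_eqE /weight mxtens_indexK /=.
by case: eqP; case: eqP; rewrite ?mulr1n ?mulr0n ?mulr0 ?mul0r // exprD.
Qed.

Lemma flat_torus (t : C) i : (flat (@matmul R) *m pair_mx (torus weight t) i <= flat (@matmul R))%MS.
Proof.
rewrite /pair_mx !torusE.
apply: (@flat_sandwich _ (fun i => diag_mx (\row_a t ^+ level i a))
  (fun i => diag_mx (\row_a t ^+ (147 - level i a))) (fun=> t ^+ 147)) => {}i.
apply/matrixP => a b; rewrite tr_diag_mx mul_diag_mx !mxE.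
by case: eqP => [->|_]; rewrite ?mulr1n ?mulr0n ?mulr0 // -exprD subnK // level_le.
Qed.

Lemma torus_raisers k t : (k < 9)%N -> t != 0 -> exists c, forall i,
  torus weight t i *m raisers k i = c *: raisers k i *m torus weight t i.
Proof.
move=> k9 t0; rewrite /raisers /root_vector.
move: (inord _) (nth _ _ _) => f [a b] /=; exists (t ^+ level f a / t ^+ level f b) => i.
have key : t ^+ level f a / t ^+ level f b * t ^+ level f b = t ^+ level f a.
  by rewrite mulfVK // expf_neq0.
have key' : t ^+ level f a / t ^+ level f b * t ^+ (147 - level f a) = t ^+ (147 - level f b).
  apply: (mulIf (expf_neq0 (level f b) t0)); rewrite mulrAC key -!exprD.
  by rewrite subnKC ?subnK ?level_le.
have gd (g : 'rV[C]_3) x y : diag_mx g *m delta_mx x y = g 0 x *: delta_mx x y.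
  apply/matrixP => p q; rewrite mul_diag_mx !mxE; case: eqP => [->//|_].
  by rewrite /= !mulr0.
have dg (g : 'rV[C]_3) x y : delta_mx x y *m diag_mx g = g 0 y *: delta_mx x y.
  apply/matrixP => p q; rewrite mul_mx_diag !mxE mulrC; case: (q =P y) => [->//|_].
  by rewrite andbF !mulr0.
rewrite torusE /infinitesimal; case: (eqVneq i f) => [->|_].
  by rewrite -tensmxZl !tensmx_mul mulmx1 mul1mx -scalemxAl gd dg !mxE scalerA key.
case: eqP => [->|_]; last by rewrite scaler0 mul0mx mulmx0.
rewrite scalerN mulmxN mulNmx -tensmxZr !tensmx_mul mulmx1 mul1mx trmx_delta -scalemxAl.
by rewrite gd dg !mxE scalerA key'.
Qed.

End Borel.

(** * Action of the Borel subgroup in coordinates *)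

Section Operators.
Variable F : numFieldType.
Implicit Types (v : 'rV[F]_(9 * 9)) (A : 'M[F]_3).

Definition tens4 A1 A2 A3 A4 : 'M[F]_(9 * 9) := (A1 *t A2 : 'M_9) *t (A3 *t A4 : 'M_9).

Lemma tens4E v A1 A2 A3 A4 i j j' k : at4 (v *m tens4 A1 A2 A3 A4) i j j' k =
  \sum_a \sum_b \sum_c \sum_d at4 v a b c d * (A1 a i * A2 b j * (A3 c j' * A4 d k)).
Proof.
rewrite /at4 mxE (@sum_mxtens _ 9 9) (@sum_mxtens _ 3 3).
apply: eq_bigr => a _; apply: eq_bigr => b _; rewrite (@sum_mxtens _ 3 3).
apply: eq_bigr => c _; apply: eq_bigr => d _.
by rewrite /tens4 /pos !tensmxE; congr (_ * (_ * _)); exact: tensmxE.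
Qed.

(** The matrices in play have at most one nonzero entry in each column. *)
Definition monomial A (c : 'I_3 -> F) (s : 'I_3 -> 'I_3) :=
  forall a i, A a i = (a == s i)%:R * c i.

Lemma monomial1 : monomial 1%:M (fun=> 1) id.
Proof. by move=> a i; rewrite mxE mulr1. Qed.

Lemma monomial_delta x y : monomial (delta_mx x y) (fun i => (i == y)%:R) (fun=> x).
Proof. by move=> a i; rewrite mxE -natrM mulnb. Qed.

Lemma tens4_monomial v A1 A2 A3 A4 c1 c2 c3 c4 s1 s2 s3 s4 i j j' k :
  monomial A1 c1 s1 -> monomial A2 c2 s2 -> monomial A3 c3 s3 -> monomial A4 c4 s4 ->
  at4 (v *m tens4 A1 A2 A3 A4) i j j' k =
  c1 i * c2 j * c3 j' * c4 k * at4 v (s1 i) (s2 j) (s3 j') (s4 k).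
Proof.
move=> m1 m2 m3 m4; rewrite tens4E.
transitivity (\sum_a (a == s1 i)%:R * \sum_b (b == s2 j)%:R * \sum_c (c == s3 j')%:R *
  \sum_d (d == s4 k)%:R * (c1 i * c2 j * c3 j' * c4 k * at4 v a b c d)).
  apply: eq_bigr => a _; rewrite big_distrr; apply: eq_bigr => b _ /=.
  rewrite !big_distrr; apply: eq_bigr => c _ /=.
  rewrite !big_distrr; apply: eq_bigr => d _ /=.
  by rewrite m1 m2 m3 m4; ring.
by rewrite !sum_delta.
Qed.

Lemma tens4_first a b v : v *m tens4 (delta_mx a b) 1%:M 1%:M 1%:M = first_op a b v.
Proof.
apply: row4P => i j j' k.
rewrite (tens4_monomial _ _ _ _ _ (monomial_delta a b) monomial1 monomial1 monomial1) row4E.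
by rewrite !mulr1.
Qed.

Lemma tens4_last a b v : v *m tens4 1%:M 1%:M 1%:M (delta_mx b a) = last_op a b v.
Proof.
apply: row4P => i j j' k.
rewrite (tens4_monomial _ _ _ _ _ monomial1 monomial1 monomial1 (monomial_delta b a)) row4E.
by rewrite !mul1r.
Qed.

Lemma tens4_mid a b v : v *m (tens4 1%:M 1%:M (delta_mx a b) 1%:M -
  tens4 1%:M (delta_mx b a) 1%:M 1%:M) = mid_op a b v.
Proof.
apply: row4P => i j j' k; rewrite mulmxBr at4D at4N.
rewrite (tens4_monomial _ _ _ _ _ monomial1 monomial1 (monomial_delta a b) monomial1).
rewrite (tens4_monomial _ _ _ _ _ monomial1 (monomial_delta b a) monomial1 monomial1) row4E.
by rewrite !mul1r !mulr1.
Qed.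

End Operators.

Section Stability.
Variable R : realType.
Local Notation C := R[i].

Lemma tens_mx0 m n p q (A : 'M[C]_(m, n)) : A *t (0 : 'M_(p, q)) = 0.
Proof. by apply/matrixP => u v; rewrite !mxE mulr0. Qed.
Lemma tens_0mx m n p q (A : 'M[C]_(m, n)) : (0 : 'M_(p, q)) *t A = 0.
Proof. by apply/matrixP => u v; rewrite !mxE mul0r. Qed.

Lemma tensmxNl m1 m2 p q (A : 'M[C]_(m1, p)) (D : 'M_(m2, q)) : (- A) *t D = - (A *t D).
Proof. by apply/matrixP => u v; rewrite !mxE mulNr. Qed.
Lemma tensmxNr m1 m2 p q (A : 'M[C]_(m1, p)) (D : 'M_(m2, q)) : D *t (- A) = - (D *t A).
Proof. by apply/matrixP => u v; rewrite !mxE mulrN. Qed.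

Lemma next2_neq (i : 'I_3) : (i + 1 + 1 == i) = false.
Proof. by case: (o3P i). Qed.

Lemma lie_first e i : lie (infinitesimal e i) i = tens4 e 1%:M 1%:M 1%:M :> 'M[C]_(3 * 3 * (3 * 3)).
Proof.
by rewrite /lie /infinitesimal eqxx next_neq next2_neq tens_mx0 addr0 -(@tensmx11 _ 3 3).
Qed.

Lemma lie_mid e i : lie (infinitesimal e (i + 1)) i =
  tens4 1%:M 1%:M e 1%:M - tens4 1%:M e^T 1%:M 1%:M :> 'M[C]_(3 * 3 * (3 * 3)).
Proof.
rewrite /lie /infinitesimal eqxx [i == _]eq_sym next_neq tensmxNl addrC.
by rewrite -(@tensmx11 _ 3 3).
Qed.

Lemma lie_last e i : lie (infinitesimal e (i + 1 + 1)) i =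
  - tens4 1%:M 1%:M 1%:M e^T :> 'M[C]_(3 * 3 * (3 * 3)).
Proof.
rewrite /lie /infinitesimal eqxx [i == _]eq_sym next2_neq [i + 1 == _]eq_sym next_neq.
by rewrite tens_0mx add0r tensmxNr -(@tensmx11 _ 3 3).
Qed.

Variables (r : nat) (L : 'I_3 -> 'M[C]_(r, 3 * 3 * (3 * 3))).
Hypothesis sL : forall k, (k < 9)%N -> stable (raisers R k) L.

Lemma stable_root ab f : ab \in simple_roots -> stable (infinitesimal (delta_mx ab.1 ab.2) f) L.
Proof.
have st k : (k < 9)%N -> stable (infinitesimal (root_vector R k) (inord (k %% 3))) L by exact: sL.
have fE p : inord ((p * 3 + f) %% 3) = f by rewrite modnMDl modn_small // inord_val.
rewrite !inE => /orP[] /eqP->.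
  by have := st (1 * 3 + f)%N; rewrite fE /root_vector divnMDl // divn_small //; apply; case: (o3P f).
by have := st (2 * 3 + f)%N; rewrite fE /root_vector divnMDl // divn_small //; apply; case: (o3P f).
Qed.

Variable i : 'I_3.
Local Notation E := (L i : 'M[C]_(r, 9 * 9)).

Lemma stable_rows (M : 'M[C]_(9 * 9)) (v : 'rV_(9 * 9)) :
  (E *m M <= E)%MS -> (v <= E)%MS -> (v *m M <= E)%MS.
Proof. by move=> EM vE; apply: submx_trans EM; exact: submxMr. Qed.

Lemma stable_first ab (v : 'rV_(9 * 9)) : ab \in simple_roots -> (v <= E)%MS -> (first_op ab.1 ab.2 v <= E)%MS.
Proof.
move=> /(stable_root i)/(_ i); rewrite lie_first -tens4_first; exact: stable_rows.
Qed.

Lemma stable_mid ab (v : 'rV_(9 * 9)) : ab \in simple_roots -> (v <= E)%MS -> (mid_op ab.1 ab.2 v <= E)%MS.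
Proof.
move=> /(stable_root (i + 1))/(_ i); rewrite lie_mid trmx_delta -tens4_mid; exact: stable_rows.
Qed.

Lemma stable_last ab (v : 'rV_(9 * 9)) : ab \in simple_roots -> (v <= E)%MS -> (last_op ab.1 ab.2 v <= E)%MS.
Proof.
move=> /(stable_root (i + 1 + 1))/(_ i); rewrite lie_last trmx_delta -tens4_last mulmxN eqmx_opp.
exact: stable_rows.
Qed.

End Stability.

(** * Grading of a fixed subspace by the torus *)

(** The torus weight of an element is the same for all diagonal elements of a
    cell and determines the element otherwise. *)
Definition color (u : 'I_(9 * 9)) : 'I_3 * 'I_3 * ('I_3 * 'I_3) :=
  let: (i, j, (j', k)) := unpos u in if j == j' then (i, o0, (o0, k)) else (i, j, (j', k)).

Definition weight4 (m i j j' k : 'I_3) : nat :=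
  (level m i + (147 - level (m + 1)%R j) + (level (m + 1)%R j' + (147 - level (m + 1 + 1)%R k)))%N.

Lemma color_pos i j j' k : color (pos i j j' k) =
  if j == j' then (i, o0, (o0, k)) else (i, j, (j', k)).
Proof. by rewrite /color posK. Qed.

Lemma weight_color m i j j' k a b b' c :
  (weight4 m i j j' k == weight4 m a b b' c) =
  (color (pos i j j' k) == color (pos a b b' c)).
Proof.
rewrite !color_pos.
pose s := [:: o0; o1; o2].
have mem x : x \in s by case: (o3P x).
pose P m i j j' k a b b' c := (weight4 m i j j' k == weight4 m a b b' c) ==
  ((if j == j' then (i, o0, (o0, k)) else (i, j, (j', k))) ==
   (if b == b' then (a, o0, (o0, c)) else (a, b, (b', c)))).
have chk : all (fun m => all (fun i => all (fun j => all (fun j' => all (fun k =>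
   all (fun a => all (fun b => all (fun b' => all (fun c => P m i j j' k a b b' c)
   s) s) s) s) s) s) s) s) s by vm_compute.
suff /eqP : P m i j j' k a b b' c by [].
exact: (allP (allP (allP (allP (allP (allP (allP (allP (allP chk m (mem m)) i (mem i)) j (mem j)) j'
 (mem j')) k (mem k)) a (mem a)) b (mem b)) b' (mem b')) c (mem c)).
Qed.

Lemma sum3 (f : 'I_3 -> nat) : (\sum_i f i = f o0 + f o1 + f o2)%N.
Proof.
rewrite !big_ord_recl big_ord0 addn0 addnA.
by congr (f _ + f _ + f _)%N; exact: val_inj.
Qed.

Section Weights.
Variable R : realType.
Local Notation C := R[i].

Definition torus_diag m : 'rV[C]_(9 * 9) :=
  \row_u let: (i, j, (j', k)) := unpos u in 2%:R ^+ weight4 m i j j' k.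

Lemma pair_torusE m : pair_mx (torus (@weight) (2%:R : C)) m = diag_mx (torus_diag m).
Proof.
apply/matrixP => u v; case: (posP u) => i j j' k; case: (posP v) => a b b' c.
rewrite /pair_mx [LHS]tensmxE !mxE posK pos_eq /weight !mxtens_indexK /=.
rewrite !(can_eq (@mxtens_indexK _ _)) !xpair_eqE /weight4 !exprD.
case: (i == a); case: (j == b); case: (j' == b'); case: (k == c);
  by rewrite ?mulr1n ?mulr0n ?mulr0 ?mul0r.
Qed.

Lemma two_inj : injective (fun x => 2%:R ^+ x : C).
Proof.
move=> x y /eqP; rewrite -!natrX eqr_nat => /eqP; exact: expnI.
Qed.

Lemma torus_color m i j j' k :
  color_proj C (torus_diag m 0) (torus_diag m 0 (pos i j j' k)) =
  color_proj C color (color (pos i j j' k)).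
Proof.
congr diag_mx; apply/rowP => u; rewrite !mxE; case: (posP u) => a b b' c.
by rewrite !posK (inj_eq two_inj) weight_color.
Qed.

Lemma color_off (v : 'rV[C]_(9 * 9)) i j j' k : j != j' ->
  v *m color_proj C color (i, j, (j', k)) = at4 v i j j' k *: e4 C i j j' k.
Proof.
move=> jj; apply: row4P => a b b' c; rewrite at4Z e4E /at4 mul_coord_proj color_pos.
case: (eqVneq a i) => [->|ai]; last first.
  by case: ifP => _; rewrite !xpair_eqE (negbTE ai) !mulr0.
case: (eqVneq c k) => [->|ck]; last first.
  by case: ifP => _; rewrite !xpair_eqE (negbTE ck) !andbF !mulr0.
move: jj; case: (o3P j); case: (o3P j') => // _; case: (o3P b); case: (o3P b');
  by rewrite /= !xpair_eqE ?eqxx /= ?mulr0.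
Qed.

Lemma e4_color i j j' k : j != j' ->
  e4 C i j j' k *m color_proj C color (i, j, (j', k)) = e4 C i j j' k.
Proof. by move=> jj; rewrite color_off // e4E !eqxx scale1r. Qed.

Lemma color_cell i k : color_proj C color (i, o0, (o0, k)) = cell_proj C i k.
Proof.
congr diag_mx; apply/rowP => u; rewrite !mxE; case: (posP u) => a b b' c; congr (_%:R).
rewrite color_pos !inE !pos_eq.
by case: (o3P b); case: (o3P b'); rewrite /= !xpair_eqE; case: (a == i); case: (c == k).
Qed.

Lemma color_none i j k : j != o0 -> color_proj C color (i, j, (j, k)) = 0.
Proof.
move=> j0; apply/matrixP => w u; rewrite !mxE; case: (posP w) => a b b' c; rewrite color_pos.
rewrite (_ : (_ == _ :> 'I_3 * 'I_3 * _) = false) ?mul0rn //; apply/negbTE; move: j0.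
by case: (o3P j) => // _; case: (o3P b); case: (o3P b'); rewrite /= !xpair_eqE ?andbF.
Qed.

Variables (r : nat) (E : 'M[C]_(r, 9 * 9)) (m : 'I_3).
Hypothesis wE : (E *m diag_mx (torus_diag m) <= E)%MS.

Lemma color_sub i j j' k : (E *m color_proj C color (color (pos i j j' k)) <= E)%MS.
Proof. by rewrite -(torus_color m); exact: eigen_proj_sub. Qed.

Lemma color_sub_cell i k : (E *m cell_proj C i k <= E)%MS.
Proof. by rewrite -color_cell; have := color_sub i o0 o0 k; rewrite color_pos. Qed.

Lemma color_sub_off i k j j' (v : 'rV_(9 * 9)) : j != j' -> (v <= E)%MS ->
  (at4 v i j j' k *: e4 C i j j' k <= E)%MS.
Proof.
move=> jj vE; rewrite -color_off //; have := color_sub i j j' k; rewrite color_pos (negbTE jj).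
exact: submx_trans (submxMr _ vE).
Qed.

Lemma color_sub_all c : (E *m color_proj C color c <= E)%MS.
Proof.
case: c => -[i j] [j' k]; case: (eqVneq j j') => [<-|jj].
  case: (eqVneq j o0) => [->|j0]; first by rewrite color_cell color_sub_cell.
  by rewrite color_none // mulmx0 sub0mx.
by have := color_sub i j j' k; rewrite color_pos (negbTE jj).
Qed.

Lemma rank_color_off i k j j' : j != j' ->
  \rank (E *m color_proj C color (i, j, (j', k))) = (e4 C i j j' k <= E)%MS.
Proof.
have e1 : \rank (e4 C i j j' k) = 1%N := mxrank_delta C (0 : 'I_1) (pos i j j' k).
move=> jj; case: (boolP (e4 C i j j' k <= E)%MS) => eE.
  apply: etrans e1; apply/eqP; rewrite eqn_leq !mxrankS //.
    by rewrite -{1}(e4_color _ _ jj) submxMr.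
  by apply/row_subP => s; rewrite row_mul color_off // scalemx_sub.
apply/eqP; rewrite mxrank_eq0 -submx0; apply/row_subP => s; rewrite row_mul color_off //.
have [->|nz] := eqVneq (at4 (row s E) i j j' k) 0; first by rewrite scale0r sub0mx.
case/negP: eE; rewrite -(eqmx_scale _ nz); apply: color_sub_off => //; exact: row_sub.
Qed.

Lemma color_rank : \rank E = (\sum_(i < 3) \sum_(k < 3)
    (\sum_(p <- offdiag3) (e4 C i p.1 p.2 k <= E)%MS + \rank (E *m cell_proj C i k)))%N.
Proof.
rewrite (rank_graded color_sub_all).
pose G i j j' k := \rank (E *m color_proj C color (i, j, (j', k))).
transitivity (\sum_i \sum_k \sum_j \sum_j' G i j j' k)%N.
  rewrite (eq_bigr (fun c => G c.1.1 c.1.2 c.2.1 c.2.2)) => [|[[i j] [j' k]] _ //].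
  rewrite -(pair_bigA _ (fun p q => G p.1 p.2 q.1 q.2)) /=.
  rewrite -(pair_bigA _ (fun i j => \sum_q G i j q.1 q.2)%N) /=.
  apply: eq_bigr => i _; rewrite [RHS]exchange_big /=; apply: eq_bigr => j _.
  by rewrite -(pair_bigA _ (fun j' k => G i j j' k)) /= exchange_big.
apply: eq_bigr => i _; apply: eq_bigr => k _.
have sum_j j : (\sum_j' G i j j' k = G i j o0 k + G i j o1 k + G i j o2 k)%N by exact: sum3.
rewrite sum3 !sum_j.
have off j j' : j != j' -> G i j j' k = (e4 C i j j' k <= E)%MS by exact: rank_color_off.
have -> : G i o0 o0 k = \rank (E *m cell_proj C i k) by rewrite /G color_cell.
have none j : j != o0 -> G i j j k = 0%N by move=> j0; rewrite /G color_none // mulmx0 mxrank0.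
rewrite (none o1) // (none o2) // !off // /offdiag3 !big_cons big_nil.
pose b (p : 'I_3 * 'I_3) : nat := (e4 C i p.1 p.2 k <= E)%MS; rewrite -!/(b (_, _)) /=.
move: (\rank (E *m cell_proj C i k)) (b (o0, o1)) (b (o0, o2)) (b (o1, o0)) (b (o1, o2)) (b (o2, o0)) (b (o2, o1)).
clear; move=> *; lia.
Qed.

End Weights.

(** * Nonexistence of configurations of dimension 16 *)

Section Final.
Variable R : realType.
Local Notation C := R[i].
Local Notation W := (flat (@matmul R)).

Lemma raising_of_fixed r (L : 'I_3 -> 'M[C]_(r, 3 * 3 * (3 * 3))) :
  (forall k, (k < 9)%N -> stable (raisers R k) L) ->
  (forall i, (L i *m pair_mx (torus (@weight) (2%:R : C)) i <= L i)%MS) ->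
  (forall i, (W <= L i)%MS) -> forall i, raising (L i : 'M[C]_(r, 9 * 9)).
Proof.
move=> sL tL WL i.
have wE : ((L i : 'M[C]_(r, 9 * 9)) *m diag_mx (torus_diag R i) <= L i)%MS.
  by rewrite -pair_torusE; exact: tL.
split.
- move=> a c; have h : (row (mxtens_index (c, a)) W <= L i)%MS := submx_trans (row_sub _ _) (WL i).
  have -> : diag4 a c 1 1 1 = row (mxtens_index (c, a)) W :> 'rV[C]_(9 * 9); last exact: h.
  apply: row4P => i0 j j' k; rewrite diag4E /at4 mxE [RHS]flat_matmulE -!natrM !mulnb.
  rewrite [a == i0]eq_sym; case: (i0 == a); case: (k == c); case: (o3P j); case: (o3P j');
   by rewrite /= ?mulr1 ?mul0r ?mulr0.
- by move=> ab hab v; exact: (stable_first sL).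
- by move=> ab hab v; exact: (stable_last sL).
- by move=> ab hab v; exact: (stable_mid sL).
- by move=> a c j j' v; exact: (color_sub_off wE).
- by move=> a c v; apply: stable_rows; exact: (color_sub_cell wE).
- exact: (color_rank wE).
Qed.

Lemma no_apolar (E : 'I_3 -> 'M[C]_(16, 3 * 3 * (3 * 3))) : ~ apolar W E.
Proof.
move=> apE.
have [|||||L apL [sL tL]] := @borel_fixed R (3 * 3) 16 (raisers R) 9 (@weight) (apolar W) E
  (apolar_degenerable 16 W) _ _ _ _ _ apE.
- by move=> k i k9; apply: infinitesimal_sq; exact: root_sq.
- move=> k D t k9; apply: apolar_act => i.
    by apply: one_param_unit => j; apply: infinitesimal_sq; exact: root_sq.
  by apply: flat_one_param; exact: root_sq.
- exact: raisers_normal.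
- move=> D t t0; apply: apolar_act => i; last exact: flat_torus.
  by apply: torus_unit; rewrite pnatr_eq0 -lt0n.
- by move=> k t; exact: torus_raisers.
have rL := raising_of_fixed sL tL (apolar_sub apL).
have rk i : \rank (L i : 'M[C]_(16, 9 * 9)) = 16 := apolar_rank apL i.
have bd i := bounded_support (rL i) (rk i) (apolar_left apL i) (apolar_right apL i).
have := apolar_cube apL.
have -> : (0 : 'I_3) = o0 by exact/val_inj.
have -> : 1 + 1 = o2 by exact/val_inj.
have -> : (1 : 'I_3) = o1 by exact/val_inj.
have -> : (3 * (16 * (3 * 3)) - 16 = 416)%N by [].
by rewrite leqNgt (bounded_cube rk bd).
Qed.

End Final.

(** * The lower bound *)

Section Tensors.
Variable R : realType.
Local Notation C := R[i].

Lemma matmul_tensorE (p q s : 'I_3 * 'I_3) : matmul_tensor C 3 3 3 (p, q, s) =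
  [&& s.2 == p.1, p.2 == q.1 & q.2 == s.1]%:R.
Proof.
case: p q s => [i j] [j' k] [k' i'] /=.
rewrite /matmul_tensor sum_ffunE.
transitivity (\sum_x (x == i)%:R * \sum_y (y == j)%:R * \sum_z (z == k)%:R *
   ((j' == y)%:R * (k' == z)%:R * (i' == x)%:R) : C).
  apply: eq_bigr => x _; rewrite sum_ffunE big_distrr; apply: eq_bigr => y _ /=.
  rewrite sum_ffunE !big_distrr; apply: eq_bigr => z _ /=.
  rewrite !ffunE /= !xpair_eqE -!mulnb !natrM [i == x]eq_sym [j == y]eq_sym [k == z]eq_sym; ring.
rewrite !sum_delta -!natrM !mulnb; congr (_%:R).
by rewrite [j == _]eq_sym [k == _]eq_sym; case: (i' == i); case: (j' == j); case: (k' == k).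
Qed.

(** The k-th triple of basis vectors is (x, y, z) with x = k mod 9, y = x + a and
    z = 7 x + 8 a = - 2 x - a modulo 9, where a is k div 9: any two of the three
    coordinates determine x and a. *)
Definition position (k i : nat) : nat :=
  let x := (k %% 9)%N in let a := (k %/ 9)%N in
  nth 0%N [:: x; (x + a) %% 9; (7 * x + 8 * a) %% 9]%N i.

Lemma position_inj (i : 'I_3) : injective (fun k : 'I_16 =>
  (inord (position k i) : 'I_9, inord (position k (i + 1)%R) : 'I_9)).
Proof.
have chk : all (fun i => all (fun k => all (fun l =>
   ((position k i == position l i) && (position k (i.+1 %% 3) == position l (i.+1 %% 3)))
     ==> (k == l)) (iota 0 16)) (iota 0 16)) (iota 0 3) by vm_compute.
have small : all (fun i => all (fun k => position k i < 9)%N (iota 0 16)) (iota 0 3) by vm_compute.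
have mem m (x : 'I_m) : (x : nat) \in iota 0 m by rewrite mem_iota /= add0n ltn_ord.
have sm (k : 'I_16) (j : 'I_3) : (position k j < 9)%N := allP (allP small _ (mem _ j)) _ (mem _ k).
move=> k l kl; have e1 := congr1 (fun x => nat_of_ord x.1) kl.
have e2 := congr1 (fun x => nat_of_ord x.2) kl.
rewrite [LHS]inordK ?[RHS]inordK ?sm // in e1; rewrite [LHS]inordK ?[RHS]inordK ?sm // in e2.
have := allP (allP (allP chk _ (mem _ i)) _ (mem _ k)) _ (mem _ l).
have -> : (i.+1 %% 3 = (i + 1)%R :> nat)%N by case: (o3P i).
by rewrite e1 e2 !eqxx => /eqP h; exact: val_inj.
Qed.

Lemma rank_one_sum_pad m (S : {ffun ('I_3 * 'I_3) * ('I_3 * 'I_3) * ('I_3 * 'I_3) -> C}) :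
  (m <= 16)%N -> sum_of_rank_one m S ->
  exists v : 'I_16 -> 'I_3 -> 'I_(3 * 3) -> C, forall p q s,
    rank_one_sum v 0 p q s = S (mxtens_unindex p, mxtens_unindex q, mxtens_unindex s).
Proof.
move=> m16 [t [t1 ->]].
have /choice[a /choice[b /choice[c abc]]] : forall k, exists a b c, t k = tprod a b c.
  by move=> k; have [a [b [c [_ _ _ e]]]] := t1 k; exists a, b, c.
pose w (k : 'I_m) (i : 'I_3) p : C := nth 0 [:: a k p; b k p; c k p] i.
pose v (k : 'I_16) (i : 'I_3) (p : 'I_(3 * 3)) : C :=
  if insub (k : nat) is Some k' then w k' i (mxtens_unindex p) else 0.
exists v => p q s; rewrite /rank_one_sum sum_ffunE.
pose G (k : nat) : C := if insub k is Some k' then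
  w k' 0 (mxtens_unindex p) * w k' (0 + 1) (mxtens_unindex q) * w k' (0 + 1 + 1) (mxtens_unindex s) else 0.
transitivity (\sum_(k < 16) G k).
  by apply: eq_bigr => k _; rewrite /v /G; case: insub => [k'|] //; rewrite !mul0r.
transitivity (\sum_(k < m) G k); last first.
  by apply: eq_bigr => k _; rewrite /G valK abc !ffunE.
rewrite -!(big_mkord xpredT G) (@big_cat_nat _ _ _ m 0 16) //= [X in _ + X]big1_seq ?addr0 //.
move=> k; rewrite mem_index_iota => /and3P[_ mk _]; rewrite /G insubF //.
by rewrite ltnNge mk.
Qed.

End Tensors.

Theorem theorem1p1 (R : realType) :
  (17 <= border_rank (matmul_tensor R[i] 3 3 3))%N.
Proof.
rewrite leqNgt; apply/negP; rewrite /border_rank; case: ex_minnP => m /asboolP[S [Sm SC]] _ m17.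
have /choice[v vP] (t : nat) := rank_one_sum_pad m17 (Sm t).
have [E apE] : exists E : 'I_3 -> 'M[R[i]]_(16, 3 * 3 * (3 * 3)), apolar (flat (@matmul R)) E; last exact: no_apolar apE.
apply: (@border_apolarity R (3 * 3) 16 (fun k i => (inord (position k i) : 'I_9)) (@matmul R) v).
- exact: position_inj.
- move=> p q s; rewrite /matmul; congr (_%:R) => /=.
  by rewrite andbC andbA.
- move=> p q s; have := SC (mxtens_unindex p, mxtens_unindex q, mxtens_unindex s).
  rewrite matmul_tensorE.
  by have -> : (fun t => rank_one_sum (v t) 0 p q s : R[i]^o) =
    (fun t => S t (mxtens_unindex p, mxtens_unindex q, mxtens_unindex s)) by exact/funext.
Qed.
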